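(* Let $P = \exp(-V)$ and $Q = \exp(-W)$ be probability measures on $\mathbb{R}^d$ with finite second moments. For $\varepsilon > 0$, let $\varphi_\varepsilon$ denote the entropic Brenier potential from $P$ to $Q$ (defined in the context). (1) Suppose that the ordered pair $(P, Q)$ satisfies the regularity conditions (stated in the context), and that there are constants $\beta_V \in \mathbb{R}$ and $\alpha_W > 0$ such that $\nabla^2 V \preceq \beta_V I$ on $\mathbb{R}^d$ and $\nabla^2 W \succeq \alpha_W I \succ 0$ on $\Omega_Q := \operatorname{int}(\operatorname{supp}(Q))$. Then, for every $\varepsilon > 0$ and all $x \in \mathbb{R}^d$, $$\nabla^2 \varphi_\varepsilon(x) \preceq \frac{1}{2}\Bigl(\sqrt{4\beta_V/\alpha_W + \varepsilon^2 \beta_V^2} - \varepsilon \beta_V\Bigr)\, I .$$ (2) Suppose that the ordered pair $(Q, P)$ satisfies the regularity conditions (that is, the roles of $P$ and $Q$ are exchanged), and that there are constants $\alpha_V > 0$ and $\beta_W \in \mathbb{R}$ such that $\nabla^2 V \succeq \alpha_V I \succ 0$ on $\Omega_P := \operatorname{int}(\operatorname{supp}(P))$ and $\nabla^2 W \preceq \beta_W I$ on $\mathbb{R}^d$. Then, for every $\varepsilon > 0$ and all $x \in \Omega_P$, $$\nabla^2 \varphi_\varepsilon(x) \succeq \frac{1}{2}\Bigl(\sqrt{4\alpha_V/\beta_W + \varepsilon^2 \alpha_V^2} - \varepsilon \alpha_V\Bigr)\, I .$$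
   Context: Notation: $\preceq$ is the positive semidefinite (Loewner) order on symmetric matrices, $I$ is the $d\times d$ identity matrix, $\|\cdot\|$ is the Euclidean norm. A probability measure is identified with its Lebesgue density, so $P=\exp(-V)$ means that $P$ has density $\exp(-V)$ with $V:\mathbb{R}^d\to\mathbb{R}\cup\{\infty\}$. Regularity conditions. An ordered pair $(\mu,\nu)$ of probability measures on $\mathbb{R}^d$ satisfies the regularity conditions if: (i) $\mu$ has full support on $\mathbb{R}^d$, and $\nu$ is supported on a convex subset of $\mathbb{R}^d$; let $\Omega_\nu$ be the interior of the support of $\nu$, a convex open set; (ii) $\mu$ and $\nu$ admit positive Lebesgue densities on $\mathbb{R}^d$ and $\Omega_\nu$ respectively, written $\exp(-U_\mu)$ and $\exp(-U_\nu)$ for functions $U_\mu,U_\nu:\mathbb{R}^d\to\mathbb{R}\cup\{\infty\}$; (iii) $U_\mu$ and $U_\nu$ are twice continuously differentiable on $\mathbb{R}^d$ and $\Omega_\nu$ respectively. Entropic optimal transport. Let $\Pi(P,Q)$ be the set of probability measures on $\mathbb{R}^d\times\mathbb{R}^d$ with marginals $P$ and $Q$. For $\varepsilon>0$, the entropic optimal transport problem is $$\min_{\pi\in\Pi(P,Q)} \int \tfrac12\|x-y\|^2\, d\pi(x,y) + \varepsilon\, D_{\mathrm{KL}}(\pi\,\|\,P\otimes Q).$$ It has a unique solution $\pi_\varepsilon$, of the form $$\pi_\varepsilon(dx,dy)=\exp\Bigl(\tfrac{f_\varepsilon(x)+g_\varepsilon(y)-\frac12\|x-y\|^2}{\varepsilon}\Bigr)P(dx)\,Q(dy),$$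 where $(f_\varepsilon,g_\varepsilon)\in L^1(P)\times L^1(Q)$ maximizes $$\int f\,dP+\int g\,dQ-\varepsilon\iint e^{(f(x)+g(y)-\frac12\|x-y\|^2)/\varepsilon}\,dP(x)\,dQ(y)+\varepsilon .$$ The functions $f_\varepsilon,g_\varepsilon$ are taken to be the versions satisfying the dual optimality conditions pointwise: $$f_\varepsilon(x)=-\varepsilon\log\int e^{(g_\varepsilon(y)-\frac12\|x-y\|^2)/\varepsilon}\,dQ(y)\quad (x\in\mathbb{R}^d),$$ $$g_\varepsilon(y)=-\varepsilon\log\int e^{(f_\varepsilon(x)-\frac12\|x-y\|^2)/\varepsilon}\,dP(x)\quad (y\in\mathbb{R}^d),$$ and are normalized by $\int f_\varepsilon\,dP=\int g_\varepsilon\,dQ$. The entropic Brenier potentials are $$\varphi_\varepsilon:=\tfrac12\|\cdot\|^2-f_\varepsilon,\qquad \psi_\varepsilon:=\tfrac12\|\cdot\|^2-g_\varepsilon .$$ *)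

(* Defs.v *)
From HB Require Import structures.
From mathcomp Require Import all_boot all_order all_algebra.
From mathcomp Require Import all_classical all_reals all_analysis.
From mathcomp Require Import measurable_realfun.

Set Implicit Arguments.
Unset Strict Implicit.
Unset Printing Implicit Defensive.

Import Order.TTheory GRing.Theory Num.Theory.
Import numFieldNormedType.Exports.

Local Open Scope classical_set_scope.
Local Open Scope ring_scope.

Definition borel_rV_display : measure_display.
Proof. exact: default_measure_display. Qed.

(* R^d is 'rV[R]_d with its Borel sigma-algebra. *)
HB.instance Definition _ (R : realType) (d : nat) :=
  @isMeasurable.Build borel_rV_display 'rV[R]_d
    <<s [set A : set 'rV[R]_d | open A] >> (@sigma_algebra0 _ _ _)
    (@sigma_algebraC _ _) (@sigma_algebra_bigcup _ _ _).

Section borel_rV.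
Context {R : realType}.

Lemma open_measurable_rV d (A : set 'rV[R]_d) : open A -> measurable A.
Proof. by move=> oA; exact: sub_sigma_algebra. Qed.

Lemma measurable_coord d (i : 'I_d) :
  measurable_fun [set: 'rV[R]_d] (fun v => v 0 i).
Proof.
apply: (measurability _ (RGenOpens.measurableE R)) => _ [_ [a [b -> <-]]].
rewrite setTI; apply: open_measurable_rV; apply: open_comp => //.
by move=> x _; exact: coord_continuous.
Qed.

Local Definition ratrV d (q : 'rV[rat]_d) : 'rV[R]_d := map_mx ratr q.

Local Lemma open_rV_bigcup d (A : set 'rV[R]_d) : open A ->
  A = \bigcup_(q in [set q : 'rV[rat]_d * nat |
        ball (ratrV q.1) q.2.+1%:R^-1 `<=` A])
      ball (ratrV q.1) q.2.+1%:R^-1.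
Proof.
move=> oA; apply/seteqP; split=> [x Ax|x [q /= qA]]; last exact: qA.
have /nbhs_ballP[e /= e0 eA] : nbhs x A by exact: open_nbhs_nbhs.
have [k ke] : exists k : nat, k.+1%:R^-1 < e / 2.
  have e20 : 0 < e / 2 by rewrite divr_gt0.
  have [N _ /(_ _ (leqnn N))] := near_infty_natSinv_lt (PosNum e20).
  by exists N.
have k0 : 0 < k.+1%:R^-1 :> R by rewrite invr_gt0.
have /choice[q xq] : forall j : 'I_d,
    exists r : rat, ball (x 0 j) k.+1%:R^-1 (ratr r).
  move=> j.
  have [r] := @rat_in_itvoo R _ (x 0 j + k.+1%:R^-1) (ltr_pwDr k0 (lexx _)).
  rewrite in_itv/= => /andP[xr rk]; exists r.
  by rewrite /ball/= distrC ger0_norm ?subr_ge0 ?ltW// ltrBlDl.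
pose qv : 'rV[rat]_d := \row_j q j.
have qx : ball x k.+1%:R^-1 (ratrV qv).
  by split=> // i j; rewrite ord1 !mxE; exact: xq.
exists (qv, k) => /=; last exact: ball_sym.
move=> y /(ball_triangle qx) xy; apply: eA; apply: le_ball xy.
by rewrite (splitr e) lerD// ltW.
Qed.

Lemma measurable_rVP d0 (T : measurableType d0) d (f : T -> 'rV[R]_d) :
  (forall i, measurable_fun setT (fun x => f x 0 i)) -> measurable_fun setT f.
Proof.
move=> mf.
apply: (measurability [set A : set 'rV[R]_d | open A]) => [//|] _ [A oA <-].
rewrite setTI (open_rV_bigcup oA) preimage_bigcup bigcup_mkcond.
apply: countable_bigcupT_measurable; first exact: countableP.
move=> [q k]; case: ifPn => // _.
have k0 : 0 < k.+1%:R^-1 :> R by rewrite invr_gt0.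
rewrite (_ : _ @^-1` _ = \bigcap_(i in [set: 'I_d])
    ((fun x => f x 0 i) @^-1` ball (ratrV q 0 i) k.+1%:R^-1)).
  apply: fin_bigcap_measurable; first exact: finite_finset.
  move=> i _; rewrite -[X in measurable X]setTI; apply: mf => //.
  by apply: open_measurable; exact: ball_open.
apply/seteqP; split=> [x [_ qfx] i _|x qfx]; first exact: qfx.
by split=> // i j; rewrite ord1; exact: qfx.
Qed.

(* 'rV[R]_(1 + d) is convertible to 'rV[R]_d.+1. *)
Definition cons_rV d (p : R * 'rV[R]_d) : 'rV[R]_d.+1 := row_mx p.1%:M p.2.

Local Definition uncons_rV d (v : 'rV[R]_d.+1) : R * 'rV[R]_d :=
  (v 0 0, rsubmx (v : 'rV_(1 + d))).

Local Lemma cons_rVK d : cancel (@cons_rV d) (@uncons_rV d).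
Proof.
move=> [x v]; rewrite /uncons_rV /cons_rV row_mxKr; congr pair.
rewrite (_ : _ 0 = row_mx x%:M v 0 (lshift d 0)); first by rewrite row_mxEl mxE.
by congr (row_mx _ _ _ _); exact: val_inj.
Qed.

Lemma measurable_cons_rV d : measurable_fun setT (@cons_rV d).
Proof.
apply: measurable_rVP => i; rewrite /cons_rV.
case: (@split_ordP 1 d i) => j ->.
  rewrite (_ : (fun _ => _) = fst) ?ord1; first exact: measurable_fst.
  by apply/funext => p; rewrite (@row_mxEl _ 1 1 d) mxE.
rewrite (_ : (fun _ => _) = (fun v : 'rV[R]_d => v 0 j) \o snd).
  exact: (measurableT_comp (measurable_coord j)).
by apply/funext => p; rewrite (@row_mxEr _ 1 1 d).
Qed.

Local Lemma measurable_uncons_rV d : measurable_fun setT (@uncons_rV d).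
Proof.
apply/measurable_fun_pairP; split; first exact: measurable_coord.
apply: measurable_rVP => i.
rewrite (_ : (fun _ => _) = (fun v : 'rV[R]_d.+1 => v 0 (rshift 1 i))).
  exact: measurable_coord.
by apply/funext => v; rewrite /uncons_rV /= mxE.
Qed.

Section cons_measure.
Context d (mu : {sigma_finite_measure set 'rV[R]_d -> \bar R}).

Definition cons_measure : set 'rV[R]_d.+1 -> \bar R :=
  pushforward (lebesgue_measure \x mu)%E (@cons_rV d).

Let cons_measure0 : cons_measure set0 = 0%E.
Proof. by rewrite /cons_measure /pushforward preimage_set0 measure0. Qed.

Let cons_measure_ge0 A : (0 <= cons_measure A)%E.
Proof. exact: (measure_ge0 (lebesgue_measure \x mu)%E). Qed.

Let cons_measure_semi_sigma_additive : semi_sigma_additive cons_measure.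
Proof.
have mc := @measurable_cons_rV d.
move=> F mF tF mUF.
exact: (@measure_semi_sigma_additive _ _ _
  (measure_function_pushforward__canonical__measure_function_Measure
    (lebesgue_measure \x mu)%E mc) F mF tF mUF).
Qed.

HB.instance Definition _ := isMeasure.Build _ _ _ cons_measure
  cons_measure0 cons_measure_ge0 cons_measure_semi_sigma_additive.

Let sigma_finite_cons_measure : sigma_finite setT cons_measure.
Proof.
have /sigma_finiteP[F [FT ndF Foo]] := sigma_finiteT (@lebesgue_measure R).
have /sigma_finiteP[G [GT ndG Goo]] := sigma_finiteT mu.
have mFG k : measurable (F k `*` G k).
  by have [? _] := Foo k; have [? _] := Goo k; exact: measurableX.
exists (fun k => @uncons_rV d @^-1` (F k `*` G k)) => [|k].
  rewrite -preimage_bigcup; apply/seteqP; split=> // v _.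
  have [n _ Fn] : (\bigcup_k F k) (uncons_rV v).1 by rewrite -FT.
  have [k _ Gk] : (\bigcup_k G k) (uncons_rV v).2 by rewrite -GT.
  exists (maxn n k) => //; split.
    by move: Fn; apply/subsetPset/ndF; exact: leq_maxl.
  by move: Gk; apply/subsetPset/ndG; exact: leq_maxr.
split.
  rewrite -[X in measurable X]setTI.
  by apply: measurable_uncons_rV; [exact: measurableT|exact: mFG].
rewrite /cons_measure /pushforward (_ : _ @^-1` _ = F k `*` G k); last first.
  rewrite -comp_preimage (_ : _ \o _ = id) ?preimage_id//.
  by apply/funext => p; exact: cons_rVK.
have [mF Fk] := Foo k; have [mG Gk] := Goo k.
by rewrite product_measure1E// lte_mul_pinfty// ge0_fin_numE.
Qed.

HB.instance Definition _ :=
  Measure_isSigmaFinite.Build _ _ _ cons_measure sigma_finite_cons_measure.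
End cons_measure.

Fixpoint lebesgue_rV (d : nat) : {sigma_finite_measure set 'rV[R]_d -> \bar R} :=
  if d is d'.+1 then cons_measure (lebesgue_rV d') else \d_(0 : 'rV[R]_0).

Lemma lebesgue_rV_box d (a b : 'rV[R]_d) : (forall i, a 0 i <= b 0 i) ->
  lebesgue_rV d [set v | forall i, v 0 i \in `[a 0 i, b 0 i]] =
  (\prod_i (b 0 i - a 0 i))%:E.
Proof.
elim: d => [|d IHd] in a b *; move=> ab.
  by rewrite big_ord0 /= diracE mem_set// => -[].
rewrite big_ord_recl /= /cons_measure /pushforward.
pose a' := \row_i a 0 (lift ord0 i); pose b' := \row_i b 0 (lift ord0 i).
pose B := [set v : 'rV[R]_d | forall i, v 0 i \in `[a' 0 i, b' 0 i]].
have mB : measurable B.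
  rewrite (_ : B = \bigcap_(i in [set: 'I_d])
      ((fun v => v 0 i) @^-1` `[a' 0 i, b' 0 i]%classic)).
    apply: fin_bigcap_measurable => [|i _].
      exact: finite_finset.
    by rewrite -[X in measurable X]setTI; apply: measurable_coord.
  by apply/seteqP; split=> [v vB i _|v vB i]; [exact: vB|exact: (vB i I)].
have muB : lebesgue_rV d B = (\prod_i (b' 0 i - a' 0 i))%:E.
  by apply: IHd => i; rewrite !mxE.
rewrite (_ : _ @^-1` _ = `[a 0 0, b 0 0]%classic `*` B).
  rewrite product_measure1E//= muB lebesgue_measure_itv/= lte_fin.
  under eq_bigr do rewrite !mxE.
  case: ltgtP (ab 0) => [_ _|//|-> _]; first by rewrite EFinM EFinB.
  by rewrite subrr mul0r mul0e.
have consE (x : R) (v : 'rV[R]_d) :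
    cons_rV (x, v) 0 0 = x /\ forall i, cons_rV (x, v) 0 (lift ord0 i) = v 0 i.
  split=> [|i]; rewrite /cons_rV /=.
    transitivity (row_mx x%:M v 0 (lshift d 0)); last by rewrite row_mxEl mxE.
    by congr (row_mx _ _ _ _); exact: val_inj.
  transitivity (row_mx x%:M v 0 (rshift 1 i)); last by rewrite row_mxEr.
  by congr (row_mx _ _ _ _); exact: val_inj.
apply/seteqP; split=> [[x v] xv|[x v] [/= xab vB] i].
  have [x0 vi] := consE x v; split=> /= [|i]; first by have := xv 0; rewrite x0.
  by have := xv (lift ord0 i); rewrite vi !mxE.
have [x0 vi] := consE x v; have [j ->|->] := unliftP ord0 i.
  by rewrite vi; have := vB j; rewrite !mxE.
by rewrite x0.
Qed.

End borel_rV.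

Section calculus.
Context {R : realType} {d : nat}.
Implicit Types (u : 'rV[R]_d -> R) (F : 'rV[R]_d -> \bar R) (x : 'rV[R]_d).

(* Euclidean; the norm `|x| that the library puts on 'rV[R]_d is the sup norm. *)
Definition sqnorm x : R := \sum_(i < d) x 0 i ^+ 2.

Definition psd (A : 'M[R]_d) : Prop :=
  A^T = A /\ forall v : 'rV[R]_d, 0 <= (v *m A *m v^T) 0 0.

Definition loewner (A B : 'M[R]_d) : Prop := psd (B - A).

Definition partial (i : 'I_d) u : 'rV[R]_d -> R := 'D_(delta_mx 0 i) u.

Definition twice_differentiable u x : Prop :=
  (\forall y \near x, differentiable u y) /\
  forall i, differentiable (partial i u) x.

(* 'D_v is total: the derivatives below are only meaningful at the points
   where twice_differentiable holds. *)
Definition hessian u x : 'M[R]_d :=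
  \matrix_(i, j) partial i (partial j u) x.

(* Potentials take extended real values; their derivatives at x are those of
   the underlying real function, provided that they are finite around x. *)
Definition etwice_differentiable F x : Prop :=
  (\forall y \near x, F y \is a fin_num) /\ twice_differentiable (fine \o F) x.

Definition ehessian F x : 'M[R]_d := hessian (fine \o F) x.

Definition C2_on (A : set 'rV[R]_d) F : Prop :=
  forall x, A x -> etwice_differentiable F x /\ {for x, continuous (ehessian F)}.

End calculus.

Section regularity.
Context {R : realType} {d : nat}.
Implicit Types (mu nu : probability 'rV[R]_d R) (U : 'rV[R]_d -> \bar R).

Definition supp mu : set 'rV[R]_d :=
  [set x | forall A, open A -> A x -> (0 < mu A)%E].

Definition finite_second_moment mu : Prop :=
  (\int[mu]_x (sqnorm x)%:E < +oo)%E.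

(* mu = exp (- U), with U : R^d -> R \cup {+oo} and exp (- oo) = 0. *)
Definition has_potential mu U : Prop :=
  [/\ measurable_fun setT U,
      forall x, U x != -oo%E &
      forall A, measurable A ->
        mu A = (\int[lebesgue_rV d]_(x in A) expeR (- U x))%E].

Record regular mu nu (Umu Unu : 'rV[R]_d -> \bar R) : Prop := Regular {
  regular_full_support : supp mu = setT ;
  regular_convex_support : @convex_set R 'rV[R]_d (supp nu) ;
  regular_potential_l : has_potential mu Umu ;
  regular_potential_r : has_potential nu Unu ;
  regular_positive_l : forall x, (0 < expeR (- Umu x))%E ;
  regular_positive_r : forall x, (supp nu)° x -> (0 < expeR (- Unu x))%E ;
  regular_C2_l : C2_on setT Umu ;
  regular_C2_r : C2_on (supp nu)° Unu }.

End regularity.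

Section entropic.
Context {R : realType} {d : nat}.
Variables (P Q : probability 'rV[R]_d R) (eps : R).
Implicit Types f g : 'rV[R]_d -> \bar R.
Local Open Scope ereal_scope.

Definition cost (x y : 'rV[R]_d) : R := (sqnorm (x - y) / 2)%R.

Definition dual_objective f g : \bar R :=
  \int[P]_x f x + \int[Q]_y g y
  - eps%:E * \int[P]_x \int[Q]_y
      expeR (eps^-1%:E * (f x + g y - (cost x y)%:E))
  + eps%:E.

(* The dual optimality conditions are required at every point of R^d, and the
   integrals in them may diverge off the supports: the potentials are then
   -oo, hence the extended real values. *)
Record entropic_potentials f g : Prop := EntropicPotentials {
  entropic_integrable_l : P.-integrable setT f ;
  entropic_integrable_r : Q.-integrable setT g ;
  entropic_maximal : forall f' g',
    P.-integrable setT f' -> Q.-integrable setT g' ->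
    dual_objective f' g' <= dual_objective f g ;
  entropic_optimality_l : forall x,
    f x = - (eps%:E *
      lne (\int[Q]_y expeR (eps^-1%:E * (g y - (cost x y)%:E)))) ;
  entropic_optimality_r : forall y,
    g y = - (eps%:E *
      lne (\int[P]_x expeR (eps^-1%:E * (f x - (cost x y)%:E)))) ;
  entropic_normalized : \int[P]_x f x = \int[Q]_y g y }.

Definition brenier_potential f (x : 'rV[R]_d) : \bar R :=
  (sqnorm x / 2)%:E - f x.

End entropic.

(* Main.v *)
(* Write the Schrodinger system multiplicatively. With c = 1 / eps,
   Phi = exp (phi / eps) and Psi = exp (psi / eps), the optimality conditions
   say that Phi is the Laplace transform x |-> \int exp (c <x, y>) Psi^-1 dQ and
   Psi the Laplace transform y |-> \int exp (c <x, y>) Phi^-1 dP.  Instead of the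
   covariance inequalities of Brascamp-Lieb and Cramer-Rao we use their
   integrated forms, which only involve second differences.
   (a) If psi is m-convex, then c psi + W is (c m + alpha)-convex on Omega_Q and
       the Prekopa-Leindler inequality makes phi c / (c m + alpha)-smooth.
   (b) If phi is L-smooth, then c phi + V is (c L + beta)-smooth; after a
       translation the integrands of Psi at y + w, y - w compare pointwise with
       the one at y, and Cauchy-Schwarz makes psi c / (c L + beta)-convex.
   Starting from the convexity of psi, the smallest smoothness constant L of phi
   thus satisfies L <= c / (c (c / (c L + beta)) + alpha), which is the first
   bound; (b) then gives the second one, with P and Q exchanged. *)
Require Import Defs.
From HB Require Import structures.
From mathcomp Require Import all_boot all_order all_algebra.
From mathcomp Require Import all_classical all_reals all_analysis.
From mathcomp Require Import measurable_realfun lra ring.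

Set Implicit Arguments.
Unset Strict Implicit.
Unset Printing Implicit Defensive.

Import Order.TTheory GRing.Theory Num.Theory.
Import numFieldNormedType.Exports.

Local Open Scope classical_set_scope.
Local Open Scope ring_scope.

(** * The Prekopa-Leindler inequality *)

(** Second differences pass through integrals and logarithms, so neither (a) nor (b) differentiates
    a potential: Hessians occur only at the two ends, to read the hypotheses on V and W and to state
    the conclusion on phi. Two obstacles shape the rest. The first is finiteness. Integrability of f
    and g makes Phi and Psi finite only almost everywhere; finiteness at every point of the interior
    of the support follows because the set where a Laplace transform is finite is stable under
    midpoints. To replace P and Q by densities on these interiors, the boundary of a convex set has
    to be Lebesgue-null. The second is the sign of beta, an arbitrary real, whereas (b) needs c L +
    beta > 0. In positive dimension beta > 0 is automatic, since exp (- V) with V concave cannot be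
    a finite density on R^d; dimension 0 is treated apart. No iteration of (a) and (b) is required:
    the infimum of the admissible L is itself admissible, and one round applied to it gives the
    inequality on L, which after clearing denominators is L (L + eps beta) <= beta / alpha. The
    stated constant is the positive root of this quadratic. *)

Lemma lebesgue_measure_affine {R : realType} (r a : R) (A : set R) :
  0 < r -> measurable A ->
  (lebesgue_measure A = r%:E * lebesgue_measure ((fun x => r * x + a)%R @^-1` A))%E.
Proof.
move=> r0 mA.
have mf : measurable_fun setT ((fun x => r * x + a) : measurableTypeR R -> measurableTypeR R).
  apply: measurable_funD => //; exact: measurable_funM.
(* The right-hand side, as a function of [A], is a scaled pushforward; it gives half-open intervals
   their length, hence is Lebesgue measure. *)
pose mu : {measure set (measurableTypeR R) -> \bar R} :=
  mscale (NngNum (ltW r0)) (measure_function_pushforward__canonical__measure_function_Measure (@lebesgue_measure R) mf).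
have := @lebesgue_measure_unique R mu _ A mA.
move=> ->//.
move=> _ [[b c]] /= _ <-.
rewrite /mu /mscale /= /pushforward.
rewrite (_ : _ @^-1` _ = `](b - a) / r, (c - a) / r]%classic); last first.
  apply/seteqP; split=> x /=; rewrite !in_itv/= ltr_pdivrMr// ler_pdivlMr// ltrBlDr lerBrDr (mulrC x);
  by [].
rewrite !lebesgue_measure_itv /= !lte_fin ltr_pM2r ?invr_gt0// ltrD2r.
case: ifPn => _; last by rewrite mule0.
by rewrite -!EFinB -EFinM; congr EFin; field; rewrite gt_eqF.
Qed.

Lemma lebesgue_measure_shift {R : realType} (a : R) (A : set R) :
  measurable A -> lebesgue_measure ((fun x => x - a) @^-1` A) = lebesgue_measure A.
Proof.
move=> mA; rewrite (lebesgue_measure_affine (- a) ltr01 mA) mul1e.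
by rewrite (_ : (fun x => 1 * x - a) = (fun x => x - a))//; apply/funext => x; rewrite mul1r.
Qed.

Lemma measurable_affine {R : realType} (r a : R) (A : set R) :
  measurable A -> measurable ((fun x => r * x + a) @^-1` A).
Proof.
move=> mA; 
have mf : measurable_fun setT ((fun x => r * x + a) : measurableTypeR R -> measurableTypeR R).
  by apply: measurable_funD => //; exact: measurable_funM.
by rewrite -[X in measurable X]setTI; exact: mf.
Qed.

Lemma brunn_minkowski_line_bounded {R : realType} (n : R) (A B C : set R) :
  measurable A -> measurable B -> measurable C -> A !=set0 -> B !=set0 ->
  A `<=` `[- n, n] -> B `<=` `[- n, n] ->
  (forall a b, A a -> B b -> C (a + b)) ->
  (lebesgue_measure A + lebesgue_measure B <= lebesgue_measure C)%E.
Proof.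
move=> mA mB mC A0 B0 An Bn ABC; apply/lee_addgt0Pr => e e0.
have e20 : 0 < e / 2 by rewrite divr_gt0.
have hA : has_sup A by split=> //; exists n => x /An /=; rewrite in_itv/= => /andP[].
have hB : has_inf B by split=> //; exists (- n) => x /Bn /=; rewrite in_itv/= => /andP[].
have [a Aa sa] := sup_adherent e20 hA.
have [b Bb ib] := inf_adherent e20 hB.
(* A + b and a + B lie in C and overlap inside I, whose length is e. *)
pose A' := (fun x => x - b) @^-1` A; pose B' := (fun x => x - a) @^-1` B.
pose I := `[a + b - e / 2, a + b + e / 2]%classic : set R.
have mshift c (D : set R) : measurable D -> measurable ((fun x => x - c) @^-1` D).
  move=> mD; have := measurable_affine 1 (- c) mD.
  by rewrite (_ : (fun x => 1 * x - c) = (fun x => x - c))//; apply/funext => x; rewrite mul1r.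
have mA' : measurable A' by exact: mshift.
have mB' : measurable B' by exact: mshift.
have mI : measurable I by exact: measurable_itv.
have mBI : measurable (B' `\` I) by exact: measurableD.
have muI : lebesgue_measure I = e%:E.
  rewrite lebesgue_measure_itv/= lte_fin ifT; last by lra.
  by rewrite -EFinB; congr EFin; lra.
have <- : lebesgue_measure A' = lebesgue_measure A by exact: lebesgue_measure_shift.
have <- : lebesgue_measure B' = lebesgue_measure B by exact: lebesgue_measure_shift.
have B'I : (lebesgue_measure B' <= lebesgue_measure (B' `\` I) + e%:E)%E.
  rewrite -muI; apply: (le_trans _ (measureU2 (@lebesgue_measure R) mBI mI)).
  apply: le_measure; rewrite ?inE//; first exact: measurableU.
  by move=> x B'x; have [|] := pselect (I x); [right|left].
apply: le_trans (leeD2l _ B'I) _; rewrite addeA leeD2r//.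
rewrite -measureU//; last first.
  apply/seteqP; split=> // x [A'x [B'x]]; apply; rewrite /I /= in_itv/=; apply/andP; split.
    have := ge_inf hB.2 B'x; lra.
  have := ub_le_sup hA.2 A'x; lra.
apply: le_measure; rewrite ?inE//; first exact: measurableU.
move=> x [A'x|[B'x _]].
  by rewrite -(subrK b x); exact: ABC.
by rewrite -(subrK a x) addrC; exact: ABC.
Qed.

(** Exhaustion by [[- n, n]]: truncating [A] and [B] only weakens the hypothesis on [C], which is
    kept whole. The bounded case applies once [n] is large enough for both truncations to be
    nonempty. *)
Lemma brunn_minkowski_line {R : realType} (A B C : set R) :
  measurable A -> measurable B -> measurable C -> A !=set0 -> B !=set0 ->
  (forall a b, A a -> B b -> C (a + b)) ->
  (lebesgue_measure A + lebesgue_measure B <= lebesgue_measure C)%E.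
Proof.
move=> mA mB mC [a0 Aa0] [b0 Bb0] ABC.
pose J n : set R := `[- n%:R, n%:R]%classic.
have mJ D n : measurable D -> measurable (D `&` J n).
  by move=> mD; apply: measurableI => //; exact: measurable_itv.
have JT D : D = \bigcup_n (D `&` J n).
  rewrite -setI_bigcupr; apply/esym/setIidPl => x _.
  have [m _ xm] := near_infty_natSinv_lt (PosNum (@ltr01 R)).
  exists (Num.truncn `|x|).+1 => //; rewrite /J /= in_itv/= -ler_norml.
  by rewrite ltW// truncnS_gt.
have Jcvg D : measurable D -> (lebesgue_measure (D `&` J n) @[n --> \oo] --> lebesgue_measure D)%E.
  move=> mD; rewrite {2}(JT D); apply: nondecreasing_cvg_mu.
  - by move=> n; exact: mJ.
  - by rewrite -JT.
  - move=> m n mn; apply/subsetPset; apply: setIS => x; rewrite /J /= !in_itv/= => /andP[h1 h2].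
    have mn' : m%:R <= n%:R :> R by rewrite ler_nat.
    by apply/andP; split; lra.
have cAB : ((lebesgue_measure (A `&` J n) + lebesgue_measure (B `&` J n)) @[n --> \oo]
    --> lebesgue_measure A + lebesgue_measure B)%E.
  by apply: cvgeD; [rewrite ge0_adde_def// inE|exact: Jcvg|exact: Jcvg].
rewrite -(cvg_lim (@ereal_hausdorff R) cAB).
apply: lime_le; first by apply/cvg_ex; eexists; exact: cAB.
have [k _ [_ kA]] : (\bigcup_n (A `&` J n)) a0 by rewrite -JT.
have [l _ [_ lB]] : (\bigcup_n (B `&` J n)) b0 by rewrite -JT.
exists (maxn k l) => // n /=; rewrite geq_max => /andP[kn ln].
have mono (i j : nat) x : (i <= j)%N -> J i x -> J j x.
  move=> ij; rewrite /J /= !in_itv/= => /andP[h1 h2].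
  have mn' : i%:R <= j%:R :> R by rewrite ler_nat.
  by apply/andP; split; lra.
apply: (@brunn_minkowski_line_bounded _ n%:R) => //; try exact: mJ.
- by exists a0; split=> //; exact: mono kn _.
- by exists b0; split=> //; exact: mono ln _.
- by move=> a b [Aa _] [Bb _]; exact: ABC.
Qed.

Lemma measurable_superlevel d (T : measurableType d) {R : realType} (h : T -> R) (s : R) :
  measurable_fun setT h -> measurable [set x | s < h x].
Proof.
move=> mh; have m0 : measurable_fun setT (cst s : T -> R) by exact: measurable_cst.
have := measurable_fun_ltr m0 mh; move=> /(_ measurableT [set true] I).
by rewrite setTI.
Qed.

(** Tonelli on the subgraph of [h]. Keeping only the levels in []0, 1[] truncates [h] at 1, which is
    harmless for functions normalized to have supremum 1 and only loses mass for the third function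
    of Prekopa-Leindler. *)
Lemma layer_cake d (T : measurableType d) {R : realType}
    (mu : {sigma_finite_measure set T -> \bar R}) (h : T -> R) :
  measurable_fun setT h -> (forall x, 0 <= h x) ->
  (\int[@lebesgue_measure R]_(s in `]0%R, 1%R[) mu [set x | (s < h x)%R] =
   \int[mu]_x (Num.min (h x) 1)%:E)%E.
Proof.
move=> mh h0.
pose GR := measurableTypeR R.
pose S := [set p : GR * T | (p.1 \in `]0%R, 1%R[%R) /\ p.1 < h p.2].
have mS : measurable S.
  have -> : S = (fst @^-1` `]0%R, 1%R[%classic) `&` [set p | p.1 < h p.2] by [].
  apply: measurableI.
    rewrite -[X in measurable X]setTI; apply: measurable_fst => //.
  have mlt : measurable_fun setT (fun p : GR * T => p.1 < h p.2).
    apply: measurable_fun_ltr; first exact: measurable_fst.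
    by apply: (measurableT_comp mh); exact: measurable_snd.
  by have := mlt measurableT [set true] I; rewrite setTI.
pose f (p : GR * T) : \bar R := (\1_S p)%:E.
have mf : measurable_fun setT f by apply/measurable_EFinP; exact: measurable_indic.
have f0 p : (0 <= f p)%E by rewrite lee_fin.
have := @fubini_tonelli _ _ GR T R lebesgue_measure mu f mf f0.
move=> fub; transitivity (\int[@lebesgue_measure R]_x \int[mu]_y f (x, y))%E.
  rewrite integral_mkcond; apply: eq_integral => s _; rewrite patchE.
  case: ifPn => [|].
    rewrite inE /= => s01; rewrite -[in LHS](setIT [set x | _]) -integral_indic//.
      by apply: eq_integral => x _; rewrite /f !indicE /S; congr ((_ : bool)%:R)%:E; apply/idP/idP;
        rewrite !inE/= => // -[].
    exact: measurable_superlevel.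
  move=> sN; rewrite integral0_eq// => x _; rewrite /f indicE memNset// => -[] /=.
  by move: sN => /negP sN s01 _; apply: sN; rewrite inE.
rewrite fub; apply: eq_integral => x _.
transitivity (lebesgue_measure (`]0, Num.min (h x) 1[%classic : set R)).
  rewrite -[in RHS](setIT `]_, _[%classic) -integral_indic//.
  apply: eq_integral => s _; rewrite /f !indicE; congr ((_ : bool)%:R)%:E; apply/idP/idP.
    rewrite !inE /S/= !in_itv/= lt_min => -[/andP[-> ->] ->]//.
  by rewrite !inE /S/= !in_itv/= lt_min => /and3P[-> -> ->].
rewrite lebesgue_measure_itv/= lte_fin; case: ifPn => [_|]; first by rewrite sube0.
by rewrite -leNgt => mh0; congr EFin; apply/eqP; rewrite eq_le mh0 le_min h0 ler01.
Qed.

Lemma measurable_measure_superlevel d (T : measurableType d) {R : realType}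
    (mu : {sigma_finite_measure set T -> \bar R}) (h : T -> R) :
  measurable_fun setT h ->
  measurable_fun setT ((fun s => mu [set x | s < h x]) : measurableTypeR R -> \bar R).
Proof.
move=> mh; pose S := [set p : measurableTypeR R * T | p.1 < h p.2].
have mS : measurable S.
  have mlt : measurable_fun setT (fun p : measurableTypeR R * T => p.1 < h p.2).
    apply: measurable_fun_ltr; first exact: measurable_fst.
    by apply: (measurableT_comp mh); exact: measurable_snd.
  by have := mlt measurableT [set true] I; rewrite setTI.
rewrite (_ : (fun s => _) = mu \o xsection S); first exact: measurable_fun_xsection.
by apply/funext => s /=; congr (mu _); apply/seteqP; split=> x; rewrite /xsection/= inE.
Qed.

Section prekopa_leindler_line.
Context {R : realType}.
Local Notation leb := (@lebesgue_measure R).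
Local Open Scope ereal_scope.

(** Brunn-Minkowski needs nonempty sets; with both suprema equal to 1, the superlevel sets of [f]
    and [g] are nonempty for the same levels [s < 1]. Their sum lies in twice the superlevel set of
    [h], and the resulting inequality of lengths is integrated over [s]. *)
Lemma prekopa_leindler_normalized (f g h : measurableTypeR R -> R) :
  measurable_fun setT f -> measurable_fun setT g -> measurable_fun setT h ->
  (forall x, 0 <= f x <= 1)%R -> (forall x, 0 <= g x <= 1)%R ->
  (forall x, 0 <= h x)%R ->
  (forall s, s < 1 -> exists x, s < f x)%R ->
  (forall s, s < 1 -> exists x, s < g x)%R ->
  (forall x y, f x * g y <= h ((x + y) / 2) ^+ 2)%R ->
  \int[leb]_x (f x)%:E + \int[leb]_x (g x)%:E <= 2%:E * \int[leb]_x (h x)%:E.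
Proof.
move=> mf mg mh f01 g01 h0 fs gs fgh.
have lc (k : measurableTypeR R -> R) : measurable_fun setT k -> (forall x, 0 <= k x <= 1)%R ->
    \int[leb]_x (k x)%:E = \int[leb]_(s in `]0%R, 1%R[) leb [set x | (s < k x)%R].
  move=> mk k01; rewrite layer_cake//; last by move=> x; case/andP: (k01 x).
  by apply: eq_integral => x _; rewrite (min_idPl _)//; case/andP: (k01 x).
have hlc : \int[leb]_(s in `]0%R, 1%R[) leb [set x | (s < h x)%R] <= \int[leb]_x (h x)%:E.
  rewrite layer_cake//; apply: ge0_le_integral => //.
  - by move=> x _; rewrite lee_fin le_min h0 ler01.
  - by apply/measurable_EFinP; apply: measurable_minr.
  - exact/measurable_EFinP.
  - by move=> x _; rewrite lee_fin ge_min lexx.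
have mI : measurable (`]0%R, 1%R[%classic : set R) by exact: measurable_itv.
have ml (k : measurableTypeR R -> R) : measurable_fun setT k ->
    @measurable_fun _ _ (measurableTypeR R) (\bar R) (`]0%R, 1%R[%classic : set R)
      (fun s => leb [set x | (s < k x)%R]).
  move=> mk; apply: measurable_funTS; exact: measurable_measure_superlevel.
rewrite (lc f)// (lc g)// -ge0_integralD//; [|exact: ml|exact: ml].
apply: le_trans (lee_wpmul2l _ hlc); last by rewrite lee_fin.
rewrite -ge0_integralZl_EFin//; last exact: ml.
apply: ge0_le_integral => //.
- by move=> s _; rewrite adde_ge0.
- by apply: emeasurable_funD; exact: ml.
- by apply: emeasurable_funM => //; exact: ml.
move=> s /=; rewrite in_itv/= => /andP[s0 s1].
(* The superlevel set of [h] dilated by 2; this is where the factor 2 of the statement comes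
   from. *)
pose C := (fun x : R => x / 2)%R @^-1` [set x | (s < h x)%R].
have mhs := @measurable_superlevel _ _ R h s mh.
have mC : measurable C.
  have := measurable_affine 2^-1 0%R mhs.
  by rewrite (_ : (fun x => _) = (fun x => x / 2)%R)//; apply/funext => x; rewrite addr0 mulrC.
have -> : 2%:E * leb [set x | (s < h x)%R] = leb C.
  have := lebesgue_measure_affine 0 (@ltr0Sn R 1) mC; rewrite /C -comp_preimage => ->.
  congr (_ * leb _).
  by apply/seteqP; split=> x /=; rewrite addr0 mulrAC divff ?mul1r// pnatr_eq0.
apply: brunn_minkowski_line => //.
- exact: measurable_superlevel.
- exact: measurable_superlevel.
- by have [x ?] := fs _ s1; exists x.
- by have [x ?] := gs _ s1; exists x.
move=> x y /= sf sg; rewrite /C /=.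
rewrite -(@ltr_pXn2r _ 2)//; [|by rewrite nnegrE ltW|by rewrite nnegrE].
by apply: lt_le_trans (fgh x y); rewrite expr2 ltr_pM// ltW.
Qed.

(** Dividing [f] and [g] by their suprema [a] and [b], and [h] by the square root of [a b],
    preserves the midpoint hypothesis. The normalized inequality bounds an arithmetic mean of
    integrals, and the arithmetic-geometric inequality turns it into a bound on their product. *)
Lemma prekopa_leindler_bounded (n : R) (f g h : measurableTypeR R -> R) :
  measurable_fun setT f -> measurable_fun setT g -> measurable_fun setT h ->
  (forall x, 0 <= f x <= n)%R -> (forall x, 0 <= g x <= n)%R ->
  (forall x, 0 <= h x)%R ->
  (forall x y, f x * g y <= h ((x + y) / 2) ^+ 2)%R ->
  \int[leb]_x (f x)%:E * \int[leb]_x (g x)%:E <= (\int[leb]_x (h x)%:E) ^+ 2.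
Proof.
move=> mf mg mh f0n g0n h0 fgh.
have sup0 (k : measurableTypeR R -> R) : (forall x, 0 <= k x <= n)%R ->
    {a : R | (0 <= a)%R & (forall x, k x <= a)%R /\ forall s, (s < a)%R -> exists x, (s < k x)%R}.
  move=> k0n; have hk : has_sup (range k).
    by split; [exists (k 0%R); exists 0%R|exists n => _ [x _ <-]; case/andP: (k0n x)].
  have ku x : (k x <= sup (range k))%R by apply: ub_le_sup; [exact: hk.2|exists x].
  exists (sup (range k)).
    by apply: le_trans (ku 0%R); case/andP: (k0n 0%R).
  by split=> // s /(sup_gt hk.1) [_ [x _ <-]] sx; exists x.
have int0 (k : measurableTypeR R -> R) : (forall x, 0 <= k x <= n)%R -> (forall x, k x <= 0)%R ->
    \int[leb]_x (k x)%:E = 0.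
  move=> k0 kN; apply: integral0_eq => x _; congr EFin.
  by apply/eqP; rewrite eq_le kN; case/andP: (k0 x).
have [a a0 [fa sa]] := sup0 f f0n; have [b b0 [gb sb]] := sup0 g g0n.
have RHS0 : 0 <= (\int[leb]_x (h x)%:E) ^+ 2.
  by rewrite expe2 mule_ge0// integral_ge0// => x _; rewrite lee_fin.
move: a0; rewrite le_eqVlt => /predU1P[a0|a0].
  by rewrite (int0 f) ?mul0e// => x; rewrite a0.
move: b0; rewrite le_eqVlt => /predU1P[b0|b0].
  by rewrite (int0 g) ?mule0// => x; rewrite b0.
pose c := Num.sqrt (a * b).
have c0 : (0 < c)%R by rewrite sqrtr_gt0 mulr_gt0.
have c2 : (c ^+ 2 = a * b)%R by rewrite sqr_sqrtr// ltW// mulr_gt0.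
have scal (k : measurableTypeR R -> R) r : measurable_fun setT k -> (forall x, 0 <= k x)%R -> (0 < r)%R ->
    \int[leb]_x (r^-1 * k x)%:E = r^-1%:E * \int[leb]_x (k x)%:E.
  move=> mk k0 r0; under eq_integral do rewrite EFinM.
  rewrite ge0_integralZl_EFin//; last by rewrite invr_ge0 ltW.
  - by move=> x _; rewrite lee_fin.
  - exact/measurable_EFinP.
have f0 x : (0 <= f x)%R by case/andP: (f0n x).
have g0 x : (0 <= g x)%R by case/andP: (g0n x).
have := @prekopa_leindler_normalized (fun x => a^-1 * f x)%R (fun x => b^-1 * g x)%R
  (fun x => c^-1 * h x)%R.
rewrite !scal//.
have X0 : 0 <= \int[leb]_x (f x)%:E by apply: integral_ge0 => x _; rewrite lee_fin.
have Y0 : 0 <= \int[leb]_x (g x)%:E by apply: integral_ge0 => x _; rewrite lee_fin.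
have Z0 : 0 <= \int[leb]_x (h x)%:E by apply: integral_ge0 => x _; rewrite lee_fin.
move: X0 Y0 Z0; set X := \int[leb]_x _; set Y := \int[leb]_x _; set Z := \int[leb]_x _.
move=> X0 Y0 Z0 H.
have {H} : a^-1%:E * X + b^-1%:E * Y <= 2%:E * (c^-1%:E * Z).
  apply: H.
  - exact: measurable_funM.
  - exact: measurable_funM.
  - exact: measurable_funM.
  - by move=> x; apply/andP; split; [rewrite mulr_ge0// invr_ge0 ltW|rewrite mulrC ler_pdivrMr// mul1r].
  - by move=> x; apply/andP; split; [rewrite mulr_ge0// invr_ge0 ltW|rewrite mulrC ler_pdivrMr// mul1r].
  - by move=> x; rewrite mulr_ge0// invr_ge0 ltW.
  - move=> s s1; have [|x sx] := sa (s * a)%R; first by rewrite gtr_pMl.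
    by exists x; rewrite mulrC ltr_pdivlMr.
  - move=> s s1; have [|x sx] := sb (s * b)%R; first by rewrite gtr_pMl.
    by exists x; rewrite mulrC ltr_pdivlMr.
  - move=> x y; rewrite exprMn exprVn c2 mulrACA -invfM.
    by rewrite ler_pM2l// invr_gt0 mulr_gt0.
have [->|Zoo] := eqVneq Z +oo; first by rewrite expe2 leey.
have Zf : Z \is a fin_num by rewrite ge0_fin_numE// ltey.
rewrite expe2 -(fineK Zf) -!EFinM => XYZ.
have Xf : X \is a fin_num.
  rewrite ge0_fin_numE//; apply: contraTT XYZ; rewrite -leNgt leye_eq => /eqP ->.
  rewrite gt0_muley ?lte_fin ?invr_gt0// addye//.
  by rewrite gt_eqF// (lt_le_trans ltNy0)// mule_ge0// lee_fin invr_ge0 ltW.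
have Yf : Y \is a fin_num.
  rewrite ge0_fin_numE//; apply: contraTT XYZ; rewrite -leNgt leye_eq => /eqP ->.
  rewrite gt0_muley ?lte_fin ?invr_gt0// addey//.
  by rewrite gt_eqF// (lt_le_trans ltNy0)// mule_ge0// lee_fin invr_ge0 ltW.
move: XYZ X0 Y0 Z0; rewrite -(fineK Xf) -(fineK Yf) !lee_fin -expr2.
set x := fine X; set y := fine Y; set z := fine Z => XYZ x0 y0 z0.
have h1 : (a^-1 * x * (b^-1 * y) <= (c^-1 * z) ^+ 2)%R.
  have : (0 <= a^-1 * x)%R by rewrite mulr_ge0// invr_ge0 ltW.
  have : (0 <= b^-1 * y)%R by rewrite mulr_ge0// invr_ge0 ltW.
  move: XYZ; set p := (a^-1 * x)%R; set q := (b^-1 * y)%R; set r := (c^-1 * z)%R.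
  move=> pqr q0 p0.
  have h2 : ((p + q) ^+ 2 <= (2 * r) ^+ 2)%R by rewrite lerXn2r// nnegrE; lra.
  have h3 : (0 <= (p - q) ^+ 2)%R by exact: sqr_ge0.
  by rewrite !expr2 in h2 h3 *; lra.
move: h1; rewrite exprMn exprVn c2 mulrACA -invfM.
by rewrite ler_pM2l// invr_gt0 mulr_gt0.
Qed.
End prekopa_leindler_line.

(** * Slicing along the first coordinate and induction on the dimension *)

Lemma cons_rV0 {R : realType} d (p : R * 'rV[R]_d) : cons_rV p 0 0 = p.1.
Proof.
transitivity (row_mx p.1%:M p.2 0 (lshift d 0)); last by rewrite row_mxEl mxE.
by congr (row_mx _ _ _ _); exact: val_inj.
Qed.

Lemma cons_rVS {R : realType} d (p : R * 'rV[R]_d) i :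
  cons_rV p 0 (lift ord0 i) = p.2 0 i.
Proof.
transitivity (row_mx p.1%:M p.2 0 (rshift 1 i)); last by rewrite row_mxEr.
by congr (row_mx _ _ _ _); exact: val_inj.
Qed.

Lemma cons_rV_comb {R : realType} d (a b s t : R) (x y : 'rV[R]_d) :
  a *: cons_rV (s, x) + b *: cons_rV (t, y) = cons_rV (a * s + b * t, a *: x + b *: y).
Proof.
apply/rowP => i; rewrite [LHS]mxE ![fun_of_matrix (_ *: cons_rV _) _ _]mxE.
have [j ->|->] := unliftP ord0 i; last by rewrite !cons_rV0.
by rewrite !cons_rVS /= !mxE.
Qed.

Section prekopa_leindler.
Local Open Scope ereal_scope.

Lemma measurable_cons_rV_curry {R : realType} d (s : R) :
  measurable_fun setT (fun v : 'rV[R]_d => cons_rV (s, v)).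
Proof.
apply: (measurableT_comp (@measurable_cons_rV R d)).
exact: (@measurable_pair1 _ _ (measurableTypeR R)).
Qed.

Section integral_cons_rV.
Context {R : realType} (d : nat) (F : 'rV[R]_d.+1 -> \bar R).
Hypothesis (mF : measurable_fun setT F) (F0 : forall v, 0 <= F v).

Let mFc : measurable_fun setT
  ((fun p => F (cons_rV p)) : measurableTypeR R * 'rV[R]_d -> \bar R).
Proof. exact: (measurableT_comp mF (@measurable_cons_rV R d)). Qed.

Let integral_cons_pair : \int[lebesgue_rV d.+1]_v F v =
  \int[(lebesgue_measure \x lebesgue_rV d)%E]_p F (cons_rV p).
Proof.
pose mu2 : {measure set (measurableTypeR R * 'rV[R]_d) -> \bar R} :=
  (@lebesgue_measure R \x lebesgue_rV d)%E.
exact: (@ge0_integral_pushforward _ _ (measurableTypeR R * 'rV[R]_d)%type _ R _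
  (@measurable_cons_rV R d) mu2 setT F).
Qed.

Lemma integral_rVS : \int[lebesgue_rV d.+1]_v F v =
  \int[@lebesgue_measure R]_s \int[lebesgue_rV d]_v F (cons_rV (s, v)).
Proof. by rewrite integral_cons_pair fubini_tonelli1. Qed.

Lemma integral_rVS_swap : \int[lebesgue_rV d.+1]_v F v =
  \int[lebesgue_rV d]_v \int[@lebesgue_measure R]_s F (cons_rV (s, v)).
Proof.
rewrite integral_rVS.
exact: (@fubini_tonelli _ _ (measurableTypeR R) _ R _ _ (fun p => F (cons_rV p)) mFc).
Qed.

Lemma measurable_integral_cons_rV : measurable_fun setT
  ((fun s => \int[lebesgue_rV d]_v F (cons_rV (s, v))) : measurableTypeR R -> \bar R).
Proof. exact: (measurable_fun_fubini_tonelli_F _ mFc). Qed.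

Lemma measurable_integral_cons_rV_swap : measurable_fun setT
  (fun v => \int[@lebesgue_measure R]_s F (cons_rV (s, v))).
Proof. exact: (measurable_fun_fubini_tonelli_G _ mFc). Qed.

End integral_cons_rV.

Lemma cvg_mine_natr {R : realType} (x : \bar R) : (mine x n%:R%:E) @[n --> \oo] --> x.
Proof.
have cy : (n%:R%:E : \bar R) @[n --> \oo] --> +oo by apply/cvgeryP; exact: cvgr_idn.
case: x => [r| |].
- apply: (@cvg_near_cst _ _ _ _ _); near=> n.
  apply/min_idPl; rewrite lee_fin; near: n; exact: nbhs_infty_ger.
- by apply: (cvg_trans _ cy); apply: near_eq_cvg; apply: nearW => n; rewrite minye.
- by apply: (@cvg_near_cst _ _ _ _ _); apply: nearW => n; rewrite minNye.
Unshelve. all: by end_near. Qed.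

(** Values in [\bar R] are needed because the induction on the dimension applies this to integrals
    over slices, which may be infinite. Truncation at [n] reduces to the bounded case, and monotone
    convergence removes it. *)
Lemma prekopa_leindler_line {R : realType} (F G H : measurableTypeR R -> \bar R) :
  measurable_fun setT F -> measurable_fun setT G -> measurable_fun setT H ->
  (forall x, 0 <= F x) -> (forall x, 0 <= G x) -> (forall x, 0 <= H x) ->
  (forall x y, F x * G y <= H ((x + y) / 2)%R ^+ 2) ->
  \int[@lebesgue_measure R]_x F x * \int[@lebesgue_measure R]_x G x <=
  (\int[@lebesgue_measure R]_x H x) ^+ 2.
Proof.
move=> mF mG mH F0 G0 H0 FGH.
pose tr (k : measurableTypeR R -> \bar R) n x : R := fine (mine (k x) n%:R%:E).
have trE (K : measurableTypeR R -> \bar R) n x : 0 <= K x ->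
    (tr K n x)%:E = mine (K x) n%:R%:E.
  move=> Kx0; rewrite fineK// ge0_fin_numE.
    by rewrite gt_min ltry orbT.
  by rewrite le_min Kx0 lee_fin ler0n.
have mtr : forall (k : measurableTypeR R -> \bar R) n,
    measurable_fun setT k -> @measurable_fun _ _ (measurableTypeR R) R setT (tr k n).
  move=> k n mk; apply: (measurableT_comp (fine_measurable measurableT)).
  exact: measurable_mine.
have tr0 (k : measurableTypeR R -> \bar R) n x : 0 <= k x -> (0 <= tr k n x <= n%:R)%R.
  by move=> Kx0; rewrite -!lee_fin trE// le_min Kx0 lee_fin ler0n ge_min lexx orbT.
have trcvg (k : measurableTypeR R -> \bar R) : measurable_fun setT k -> (forall x, 0 <= k x) ->
    (\int[@lebesgue_measure R]_x (tr k n x)%:E) @[n --> \oo] -->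
    \int[@lebesgue_measure R]_x k x.
  move=> mk k0.
  rewrite (_ : \int[_]_x k x = \int[@lebesgue_measure R]_x limn (fun n => (tr k n x)%:E)).
    apply: cvg_monotone_convergence => //.
    - by move=> n; apply/measurable_EFinP; exact: mtr.
    - by move=> n x _; rewrite lee_fin; case/andP: (tr0 _ n x (k0 x)).
    - move=> x _ m n mn; rewrite !trE// le_min ge_min lexx/= ge_min.
      by rewrite lee_fin ler_nat mn orbT.
  apply: eq_integral => x _; apply/esym/cvg_lim => //.
  under eq_fun do rewrite trE//; exact: cvg_mine_natr.
have trle n : \int[@lebesgue_measure R]_x (tr F n x)%:E * \int[@lebesgue_measure R]_x (tr G n x)%:E
    <= (\int[@lebesgue_measure R]_x H x) ^+ 2.
  apply: (@le_trans _ _ ((\int[@lebesgue_measure R]_x (tr H n x)%:E) ^+ 2)).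
    apply: (@prekopa_leindler_bounded R n%:R); try exact: mtr; try by move=> x; exact: tr0.
      by move=> x; case/andP: (tr0 _ n x (H0 x)).
    move=> x y; set z := ((x + y) / 2)%R.
    case/andP: (tr0 _ n x (F0 x)) => f0 fn; case/andP: (tr0 _ n y (G0 y)) => g0 gn.
    (* If [H z > n], its truncation is [n], which dominates both truncated factors; otherwise the
       truncation leaves [H z] unchanged. *)
    have [Hn|nH] := leP (H z) n%:R%:E; last first.
      rewrite (_ : tr H n z = n%:R) ?expr2 ?ler_pM//.
      by apply: EFin_inj; rewrite trE//; apply/min_idPr/ltW.
    rewrite -lee_fin EFinM EFin_expe !trE// (min_idPl Hn).
    apply: le_trans (FGH x y); apply: lee_pmul; rewrite ?le_min ?F0 ?G0 ?lee_fin ?ler0n//.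
      by rewrite ge_min lexx.
    by rewrite ge_min lexx.
  rewrite !expe2; have le1 : \int[@lebesgue_measure R]_x (tr H n x)%:E <= \int[@lebesgue_measure R]_x H x.
    apply: ge0_le_integral => //.
    - by move=> x _; rewrite lee_fin; case/andP: (tr0 _ n x (H0 x)).
    - by apply/measurable_EFinP; exact: mtr.
    - by move=> x _; rewrite trE// ge_min lexx.
  have ge0 : 0 <= \int[@lebesgue_measure R]_x (tr H n x)%:E.
    by apply: integral_ge0 => x _; rewrite lee_fin; case/andP: (tr0 _ n x (H0 x)).
  exact: lee_pmul.
have R0 : 0 <= (\int[@lebesgue_measure R]_x H x) ^+ 2.
  by rewrite expe2 mule_ge0// integral_ge0.
(* Limits do not commute with the product in the case [0 * +oo], so vanishing integrals are set
   apart. *)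
have [->|Fn0] := eqVneq (\int[@lebesgue_measure R]_x F x) 0; first by rewrite mul0e.
have [->|Gn0] := eqVneq (\int[@lebesgue_measure R]_x G x) 0; first by rewrite mule0.
have FGdef : mule_def (\int[@lebesgue_measure R]_x F x) (\int[@lebesgue_measure R]_x G x).
  by rewrite mule_defE (negPf Fn0) (negPf Gn0).
have cFG : (\int[@lebesgue_measure R]_x (tr F n x)%:E *
    \int[@lebesgue_measure R]_x (tr G n x)%:E) @[n --> \oo] -->
    \int[@lebesgue_measure R]_x F x * \int[@lebesgue_measure R]_x G x.
  exact: cvgeM FGdef (trcvg _ mF F0) (trcvg _ mG G0).
rewrite -(cvg_lim (@ereal_hausdorff R) cFG).
apply: lime_le; first by apply/cvg_ex; eexists; exact: cFG.
by apply: nearW => n; exact: trle.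
Qed.

(** For fixed first coordinates [s] and [t], the slices of [F], [G] and [H] at [s], [t] and their
    midpoint satisfy the hypothesis in dimension [d]. The induction hypothesis for them is exactly
    the one-dimensional hypothesis on the integrals over slices. *)
Lemma prekopa_leindler {R : realType} d (F G H : 'rV[R]_d -> \bar R) :
  measurable_fun setT F -> measurable_fun setT G -> measurable_fun setT H ->
  (forall x, 0 <= F x) -> (forall x, 0 <= G x) -> (forall x, 0 <= H x) ->
  (forall x y, F x * G y <= H (2^-1 *: (x + y))%R ^+ 2) ->
  \int[lebesgue_rV d]_x F x * \int[lebesgue_rV d]_x G x <=
  (\int[lebesgue_rV d]_x H x) ^+ 2.
Proof.
elim: d F G H => [|d IHd] F G H mF mG mH F0 G0 H0 FGH.
  have i0 (K : 'rV[R]_0 -> \bar R) : measurable_fun setT K ->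
      \int[lebesgue_rV 0]_x K x = K 0%R.
    by move=> mK; rewrite integral_dirac//= diracT mul1e.
  rewrite !i0//; have := FGH 0%R 0%R.
  by rewrite addr0 scaler0.
rewrite !integral_rVS//; apply: prekopa_leindler_line;
  try (exact: measurable_integral_cons_rV); try (by move=> s; exact: integral_ge0).
move=> s t; apply: IHd => //;
  try (apply: measurableT_comp => //; exact: measurable_cons_rV_curry).
move=> x y; have := FGH (cons_rV (s, x)) (cons_rV (t, y)).
by rewrite scalerDr cons_rV_comb -mulrDr -scalerDr mulrC.
Qed.

End prekopa_leindler.

(** * Affine changes of variables and convex sets *)

Lemma integral_line_affine {R : realType} (c a : R) (f : measurableTypeR R -> \bar R) :
  c ^+ 2 = 1 -> measurable_fun setT f -> (forall x, 0 <= f x)%E ->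
  (\int[@lebesgue_measure R]_x f (c * x + a)%R = \int[@lebesgue_measure R]_x f x)%E.
Proof.
move=> c2 mf f0.
have mphi : measurable_fun setT ((fun x => c * x + a) : measurableTypeR R -> measurableTypeR R).
  by apply: measurable_funD => //; exact: measurable_funM.
have := @ge0_integral_pushforward _ _ (measurableTypeR R) (measurableTypeR R) R _ mphi
  lebesgue_measure setT f measurableT mf (fun x _ => f0 x).
rewrite preimage_setT => <-; apply: eq_measure_integral => A mA _.
rewrite /pushforward.
have /orP[/eqP cE|/eqP cE] : (c == 1) || (c == -1) by rewrite -eqf_sqr c2 expr1n.
all: subst c.
  by rewrite [RHS](lebesgue_measure_affine a ltr01 mA) mul1e.
rewrite [RHS](lebesgue_measure_affine a ltr01 mA) mul1e.
rewrite -[RHS]lebesgue_measureN; last exact: measurable_affine.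
rewrite /pushforward -comp_preimage; congr (lebesgue_measure _).
by apply/seteqP; split=> x /=; rewrite mul1r mulN1r.
Qed.

Lemma cons_rV_surj {R : realType} d (v : 'rV[R]_d.+1) : exists s w, v = cons_rV (s, w).
Proof.
exists (v 0 0), (\row_i v 0 (lift ord0 i)); apply/rowP => i.
by have [j ->|->] := unliftP ord0 i; rewrite ?cons_rVS ?cons_rV0//= mxE.
Qed.

(** The condition on [c] covers translations and point reflections together: the former serve in
    [laplace_strong] and [potential_not_concave], the latter in [sub_midpoint_closed]. *)
Lemma integral_rV_affine {R : realType} d (c : R) (a : 'rV[R]_d) (f : 'rV[R]_d -> \bar R) :
  c ^+ 2 = 1 -> measurable_fun setT f -> (forall x, 0 <= f x)%E ->
  (\int[lebesgue_rV d]_x f (c *: x + a)%R = \int[lebesgue_rV d]_x f x)%E.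
Proof.
move=> c2; elim: d a f => [|d IHd] a f mf f0.
  by apply: eq_integral => x _; congr f; apply/rowP => -[].
have [s [w aE]] := cons_rV_surj a; subst a.
have mfa : measurable_fun setT (fun x : 'rV[R]_d.+1 => f (c *: x + cons_rV (s, w))).
  apply: (measurableT_comp mf); apply: measurable_rVP => i.
  rewrite (_ : (fun x => _) = (fun x : 'rV_d.+1 => c * x 0 i + cons_rV (s, w) 0 i)).
    apply: measurable_funD => //; apply: measurable_funM => //; exact: measurable_coord.
  by apply/funext => x; rewrite [LHS]mxE [fun_of_matrix (_ *: _) _ _]mxE.
have mfc t : measurable_fun setT (fun v => f (cons_rV (t, v))).
  by apply: (measurableT_comp mf); exact: measurable_cons_rV_curry.
rewrite (integral_rVS mf f0) (integral_rVS mfa (fun x => f0 _)).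
transitivity (\int[@lebesgue_measure R]_t
    \int[lebesgue_rV d]_v f (cons_rV ((c * t + s)%R, v)))%E; last first.
  apply: (@integral_line_affine R c s (fun t => \int[lebesgue_rV d]_v f (cons_rV (t, v)))%E) => //.
    exact: measurable_integral_cons_rV.
  by move=> t; exact: integral_ge0.
apply: eq_integral => t _; rewrite -[RHS](IHd w)//.
apply: eq_integral => v _; congr f.
by have := cons_rV_comb c 1 t s v w; rewrite !scale1r mul1r.
Qed.

Lemma lebesgue_rV_affine {R : realType} d (c : R) (a : 'rV[R]_d) (A : set 'rV[R]_d) :
  c ^+ 2 = 1 -> measurable A -> measurable ((fun x => c *: x + a) @^-1` A) ->
  lebesgue_rV d ((fun x => c *: x + a) @^-1` A) = lebesgue_rV d A.
Proof.
move=> c2 mA mA'.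
have m1 : measurable_fun setT (fun x => (\1_A x)%:E : \bar R).
  exact/measurable_EFinP/measurable_indic.
have pos x : (0 <= (\1_A x)%:E :> \bar R)%E by rewrite lee_fin.
have H := integral_rV_affine a c2 m1 pos.
transitivity (\int[lebesgue_rV d]_x (\1_((fun x => (c *: x + a)%R) @^-1` A) x)%:E)%E.
  by rewrite integral_indic// setIT.
transitivity (\int[lebesgue_rV d]_x (\1_A x)%:E)%E; last first.
  by rewrite integral_indic// setIT.
rewrite -H.
by apply: eq_integral => x _; rewrite !indicE; congr ((_ : bool)%:R)%:E; apply/idP/idP; rewrite !inE.
Qed.

Lemma ball_rVP {R : realType} d (x y : 'rV[R]_d) (e : R) : 0 < e ->
  ball x e y <-> forall i, `|x 0 i - y 0 i| < e.
Proof.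
move=> e0; split=> [[_ h] i|h]; first exact: h.
by split=> // i j; rewrite ord1; exact: h.
Qed.

(** Unlike in [convex_set], the weight is a plain real with a separate bound, so that it can be
    computed with. *)
Definition rV_convex {R : realType} d (K : set 'rV[R]_d) := forall x y t,
  0 <= t <= 1 -> K x -> K y -> K (t *: x + (1 - t) *: y).

Lemma convex_set_rV_convex {R : realType} d (K : set 'rV[R]_d) :
  @convex_set R 'rV[R]_d K -> rV_convex K.
Proof.
move=> cK x y t t01 Kx Ky.
have t01' : Itv.spec (@Itv.num_sem R) (Itv.Real `[0%Z, 1%Z]) t.
  by rewrite /= /Itv.num_sem/= in_itv/= t01 num_real.
by have := cK x y (Itv.Def t01') (mem_set Kx) (mem_set Ky); rewrite inE.
Qed.

Lemma lebesgue_rV_fiber0 {R : realType} d (N : set 'rV[R]_d.+1) :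
  measurable N ->
  {ae lebesgue_rV d, forall v, lebesgue_measure [set s : R | N (cons_rV (s, v))] = 0%E} ->
  lebesgue_rV d.+1 N = 0%E.
Proof.
move=> mN N0.
have mf : measurable_fun setT (fun x => (\1_N x)%:E : \bar R).
  exact/measurable_EFinP/measurable_indic.
have f0 x : (0 <= (\1_N x)%:E :> \bar R)%E by rewrite lee_fin.
transitivity (\int[lebesgue_rV d.+1]_x (\1_N x)%:E)%E; first by rewrite integral_indic// setIT.
rewrite (integral_rVS_swap mf f0).
transitivity (\int[lebesgue_rV d]_v (cst 0%E v : \bar R))%E; last by rewrite integral0.
apply: ge0_ae_eq_integral => //.
- exact: (measurable_integral_cons_rV_swap mf f0).
- by move=> v _; exact: integral_ge0.
apply: filterS N0 => v /= Nv _.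
transitivity (\int[@lebesgue_measure R]_s (\1_[set s : R | N (cons_rV (s, v))] s)%:E)%E.
  by apply: eq_integral => s _; rewrite !indicE; congr ((_ : bool)%:R)%:E; apply/idP/idP; rewrite !inE.
rewrite integral_indic// ?setIT//.
have mc : measurable_fun setT ((fun s => cons_rV (s, v)) : measurableTypeR R -> 'rV[R]_d.+1).
  apply: (measurableT_comp (@measurable_cons_rV R d)).
  exact: (@measurable_pair2 _ _ (measurableTypeR R)).
by have := mc measurableT N mN; rewrite setTI.
Qed.

Lemma continuous_cons_rV {R : realType} d (s : R) : continuous (fun v : 'rV[R]_d => cons_rV (s, v)).
Proof.
move=> v A /nbhs_ballP[e /= e0 eA]; apply/nbhs_ballP; exists e => // w /= vw.
apply: eA; apply/ball_rVP => // i.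
have [j ->|->] := unliftP ord0 i; last by rewrite !cons_rV0 subrr normr0.
rewrite !cons_rVS /=.
by move: vw => /(ball_rVP _ _ e0); exact.
Qed.

Lemma lebesgue_measure_no_three {R : realType} (N : set R) :
  (forall a b c, N a -> N b -> N c -> a < b -> b < c -> False) ->
  lebesgue_measure N = 0%E.
Proof.
move=> N3; apply: countable_lebesgue_measure0; apply: finite_set_countable.
have [[p Np]|N0] := pselect (N !=set0); last first.
  by rewrite (_ : N = set0)//; apply/seteqP; split=> // x Nx; apply: N0; exists x.
have [[q [Nq qp]]|N1] := pselect (exists q, N q /\ q != p); last first.
  apply: (@sub_finite_set _ _ [set p]) => // x Nx; apply: contrapT => xp; apply: N1.
  by exists x; split=> //; apply/eqP.
apply: (@sub_finite_set _ _ [set p; q]); last by rewrite finite_setU.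
move=> x Nx; apply: contrapT => /not_orP[/eqP xp /eqP xq].
wlog pq : p q Np Nq qp xp xq / p < q.
  move=> wl; have [pq|pq|pq] := ltgtP p q; [exact: (wl p q)| |].
    by apply: (wl q p) => //; rewrite eq_sym.
  by rewrite pq eqxx in qp.
have [xp'|xp'|xp'] := ltgtP x p; [exact: (N3 x p q)| |by rewrite xp' eqxx in xp].
have [xq'|xq'|xq'] := ltgtP x q; [exact: (N3 p x q)|exact: (N3 p q x)|by rewrite xq' eqxx in xq].
Qed.

(* In the induction, the fibre over z of the boundary of K has at most two
   points as soon as z lies in the interior of every set {z | (a, z), (b, z) \in K}
   (a < b rational) that contains it; these sets are closed and convex. *)
Lemma lebesgue_rV_boundary_convex {R : realType} d (K : set 'rV[R]_d) :
  closed K -> rV_convex K -> lebesgue_rV d (K `\` K°) = 0%E.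
Proof.
elim: d K => [|d IHd] K cK vK.
  rewrite (_ : _ `\` _ = set0) ?measure0//; apply/seteqP; split=> // x [Kx]; apply.
  rewrite (_ : K = setT) ?interiorT//; apply/seteqP; split=> // y _.
  by rewrite (_ : y = x)//; apply/rowP => -[].
have mbd n (C : set 'rV[R]_n) : closed C -> measurable (C `\` C°).
  move=> cC; apply: measurableD; last first.
    by apply: open_measurable_rV; exact: open_interior.
  by rewrite -(setCK C); apply: measurableC; apply: open_measurable_rV; exact: closed_openC.
apply: lebesgue_rV_fiber0; first exact: mbd.
pose Z (q : rat * rat) := [set v : 'rV[R]_d | K (cons_rV (ratr q.1, v)) /\ K (cons_rV (ratr q.2, v))].
have cZ q : closed (Z q).
  have cc r : closed [set v : 'rV[R]_d | K (cons_rV (r, v))].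
    apply: (@preimage_closed _ _ (fun v => cons_rV (r, v)) K _ cK) => x _.
    exact: continuous_cons_rV.
  by apply: closedI; exact: cc.
have vZ q : rV_convex (Z q).
  move=> x y t t01 [Kx1 Kx2] [Ky1 Ky2]; split.
    by have := vK _ _ _ t01 Kx1 Ky1; rewrite cons_rV_comb -mulrDl addrC subrK mul1r.
  by have := vK _ _ _ t01 Kx2 Ky2; rewrite cons_rV_comb -mulrDl addrC subrK mul1r.
(* Only countably many sets [Z q] occur, so their null boundaries, given by the induction
   hypothesis, can be avoided simultaneously; the enumeration by [n] puts the quantifier in the form
   that [ae_foralln] accepts. *)
have Z0 : {ae lebesgue_rV d, forall v, forall n : nat, forall q : rat * rat,
    unpickle n = Some q -> Z q v -> (Z q)° v}.
  apply: ae_foralln => n; case: (unpickle n) => [q|]; last exact: nearW.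
  exists (Z q `\` (Z q)°); split; [exact: mbd|exact: IHd|].
  move=> v /= h; apply: contrapT => /not_andP h'; apply: h => _ [<-] Zv.
  by apply: contrapT => iZ; case: h' => //; apply.
apply: filterS Z0 => v Zv; apply: lebesgue_measure_no_three => s1 s2 s3 [K1 _] [K2 nK2] [K3 _] s12 s23.
have [a] := rat_in_itvoo s12; rewrite in_itv/= => /andP[s1a as2].
have [b] := rat_in_itvoo s23; rewrite in_itv/= => /andP[s2b bs3].
have Kfib r t u (w : 'rV[R]_d) : r < t < u -> K (cons_rV (r, w)) -> K (cons_rV (u, w)) ->
    K (cons_rV (t, w)).
  move=> /andP[rt tu] Kr Ku.
  have ru : 0 < u - r by rewrite subr_gt0 (lt_trans rt).
  have := vK _ _ ((u - t) / (u - r)) _ Kr Ku; rewrite cons_rV_comb => H.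
  have := H _; rewrite -scalerDl.
  rewrite [_ + (1 - _)]addrC subrK scale1r (_ : _ * r + _ = t); last by field; rewrite gt_eqF.
  apply; apply/andP; split; first by rewrite divr_ge0 ?ltW// subr_gt0.
  by rewrite ler_pdivrMr// mul1r lerD2l lerN2 ltW.
have Zab : Z (a, b) v.
  by split=> /=; apply: (Kfib s1 _ s3) => //; apply/andP; split=> //; [exact: lt_trans s23|exact: lt_trans s2b].
have /nbhs_ballP[e /= e0 eZ] := Zv _ _ (pickleK (a, b)) Zab.
apply: nK2; apply/nbhs_ballP.
(* A displacement smaller than [e'] keeps the tail in [Z (a, b)] and the first coordinate between
   [a] and [b], hence the point stays in [K] by convexity of the fibre. So the middle point [s2]
   would be interior to [K], a contradiction. *)
pose e' := Num.min e (Num.min (s2 - ratr a) (ratr b - s2)).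
have e'0 : 0 < e' by rewrite !lt_min e0 !subr_gt0 as2 s2b.
exists e' => // w /(ball_rVP _ _ e'0) Bw.
have [w0 [w' wE]] := cons_rV_surj w; subst w.
have Zw : Z (a, b) w'.
  apply: eZ; apply/ball_rVP => // i; have := Bw (lift ord0 i).
  by rewrite !cons_rVS /= lt_min => /andP[].
have := Bw 0; rewrite !cons_rV0 /= !lt_min !ltr_norml => /and3P[_ /andP[h1 h2] /andP[h3 h4]].
apply: (Kfib (ratr a) _ (ratr b)) => //; [|exact: Zw.1|exact: Zw.2].
by apply/andP; split; lra.
Qed.

(** * Densities and supports *)

(** The change of variables holds for the Radon-Nikodym derivative; [g] has the same integrals over
    measurable sets, so it agrees with that derivative almost everywhere. *)
Lemma integral_density d (T : measurableType d) {R : realType}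
    (nu : {finite_measure set T -> \bar R}) (mu : {sigma_finite_measure set T -> \bar R})
    (g f : T -> \bar R) :
  measurable_fun setT g -> (forall x, 0 <= g x)%E ->
  (forall A, measurable A -> nu A = \int[mu]_(x in A) g x)%E ->
  measurable_fun setT f -> (forall x, 0 <= f x)%E ->
  (\int[nu]_x f x = \int[mu]_x (f x * g x))%E.
Proof.
move=> mg g0 nuE mf f0.
have numu : nu `<< mu.
  apply/null_content_dominatesP => A mA muA; rewrite nuE//.
  by apply: null_set_integral => //; exact: measurable_funTS.
rewrite -(Radon_Nikodym_SigmaFinite.change_of_variables numu f0 measurableT mf).
have fint := Radon_Nikodym_SigmaFinite.f_integrable numu.
have ae : ae_eq mu setT (Radon_Nikodym_SigmaFinite.f nu mu) g.
  apply: integral_ae_eq => // A _ mA.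
  by rewrite -Radon_Nikodym_SigmaFinite.f_integral// nuE.
apply: ge0_ae_eq_integral => //.
- by apply: emeasurable_funM => //; exact: measurable_int fint.
- exact: emeasurable_funM.
- by move=> x _; rewrite mule_ge0// Radon_Nikodym_SigmaFinite.f_ge0.
- by move=> x _; rewrite mule_ge0.
- by apply: filterS ae => x /[apply] ->.
Qed.

Lemma lebesgue_rV_ball_gt0 {R : realType} d (x : 'rV[R]_d) (e : R) : 0 < e ->
  (0 < lebesgue_rV d (ball x e))%E.
Proof.
move=> e0.
pose a : 'rV[R]_d := \row_i (x 0 i - e / 2); pose b : 'rV[R]_d := \row_i (x 0 i + e / 2).
pose B := [set v : 'rV[R]_d | forall i, v 0 i \in `[a 0 i, b 0 i]].
have ab i : a 0 i <= b 0 i by rewrite !mxE; lra.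
have mB : measurable B.
  rewrite (_ : B = \bigcap_(i in [set: 'I_d])
      ((fun v => v 0 i) @^-1` `[a 0 i, b 0 i]%classic)).
    apply: fin_bigcap_measurable => [|i _]; first exact: finite_finset.
    by rewrite -[X in measurable X]setTI; apply: measurable_coord.
  by apply/seteqP; split=> [v vB i _|v vB i]; [exact: vB|exact: (vB i I)].
apply: (@lt_le_trans _ _ (lebesgue_rV d B)).
  rewrite lebesgue_rV_box// lte_fin prodr_gt0// => i _.
  by rewrite !mxE; lra.
apply: le_measure; rewrite ?inE//.
  by apply: open_measurable_rV; exact: ball_open.
move=> v Bv; apply/ball_rVP => // i; have := Bv i.
by rewrite !mxE in_itv/= => /andP[h1 h2]; rewrite ltr_norml; apply/andP; split; lra.
Qed.

(* A reflection argument: x and its mirror images cannot avoid D together. *)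
Lemma sub_midpoint_closed {R : realType} d (A D : set 'rV[R]_d) :
  open A -> measurable D -> (forall x y, D x -> D y -> D (2^-1 *: (x + y))) ->
  lebesgue_rV d (A `\` D) = 0%E -> A `<=` D.
Proof.
move=> oA mD midD AD0 x0 Ax0; apply: contrapT => nDx0.
have /nbhs_ballP[e /= e0 eA] : nbhs x0 A by exact: open_nbhs_nbhs.
pose B := ball x0 e.
have mB : measurable B by apply: open_measurable_rV; exact: ball_open.
have mBD : measurable (B `\` D) by exact: measurableD.
have mA : measurable A by exact: open_measurable_rV.
have BD0 : lebesgue_rV d (B `\` D) = 0%E.
  by apply: (subset_measure0 _ (measurableD mA mD)) => //; apply: setSD.
pose r (x : 'rV[R]_d) := -1 *: x + 2 *: x0.
have mr : measurable (r @^-1` (B `\` D)).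
  rewrite -[X in measurable X]setTI; apply: (_ : measurable_fun setT r) => //.
  apply: measurable_rVP => i.
  rewrite (_ : (fun x => _) = (fun x : 'rV_d => -1 * x 0 i + 2 * x0 0 i)).
    by apply: measurable_funD => //; apply: measurable_funM => //; exact: measurable_coord.
  by apply/funext => x; rewrite !mxE.
have rBD0 : lebesgue_rV d (r @^-1` (B `\` D)) = 0%E.
  by rewrite lebesgue_rV_affine// sqrrN expr1n.
have : (lebesgue_rV d B <= 0)%E.
  rewrite -[leRHS]rBD0 -(measureU0 mr mBD BD0).
  apply: le_measure; rewrite ?inE//; first exact: measurableU.
  move=> x Bx; have [Dx|nDx] := pselect (D x); [left|by right].
  split.
    apply/ball_rVP => // i; move/(ball_rVP _ _ e0) : Bx => /(_ i).
    by rewrite !mxE -normrN (_ : - (x0 0 i - x 0 i) = x0 0 i - (-1 * x 0 i + 2 * x0 0 i))//; ring.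
  move=> Drx; apply: nDx0.
  have := midD _ _ Dx Drx; rewrite (_ : 2^-1 *: _ = x0)//.
  by apply/rowP => i; rewrite !mxE; field.
by rewrite leNgt lebesgue_rV_ball_gt0.
Qed.

Lemma measurable_expeR {R : realType} : measurable_fun setT (@expeR R).
Proof.
apply: (measurability _ (ErealGenOInfty.measurableE R)) => // _ [_ [r ->] <-].
rewrite setTI; have [r0|r0] := ltP r 0.
  rewrite (_ : _ @^-1` _ = setT)//; apply/seteqP; split=> // x _ /=.
  by rewrite in_itv/= andbT (lt_le_trans _ (expeR_ge0 x))// lte_fin.
rewrite (_ : _ @^-1` _ = `]lne r%:E, +oo[%classic); first exact: emeasurable_itv.
have rE : expeR (lne r%:E) = r%:E by apply: lneK; rewrite in_itv/= lee_fin r0 leey.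
have H x : (r%:E < expeR x)%E = (lne r%:E < x)%E by rewrite -{1}rE lte_expeR.
by apply/seteqP; split=> x /=; rewrite !in_itv/= !andbT H.
Qed.

Section support.
Context {R : realType} {d : nat} (mu : probability 'rV[R]_d R).

Lemma supp_closed : closed (supp mu).
Proof.
rewrite -(setCK (supp mu)); apply: open_closedC.
rewrite openE => x /existsNP[A /not_implyP[oA /not_implyP[Ax muA]]].
rewrite /interior; apply: filterS (open_nbhs_nbhs (conj oA Ax)) => y Ay sy.
by apply: muA; exact: sy.
Qed.

(** Second countability: the complement of the support is covered by the null balls with rational
    centre and radius [1 / (k + 1)], which are countably many. *)
Lemma suppC0 : mu (~` supp mu) = 0%E.
Proof.
pose B (q : 'rV[rat]_d * nat) : set 'rV[R]_d := ball (Defs.ratrV q.1) q.2.+1%:R^-1.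
have mB q : measurable (B q).
  by apply: open_measurable_rV; apply: ball_open; rewrite invr_gt0.
pose C n := if unpickle n is Some q then (if mu (B q) == 0%E then B q else set0) else set0.
have muC : mu.-negligible (\bigcup_n C n).
  apply: negligible_bigcup => n; rewrite /C; case: (unpickle n) => [q|]; last exact: negligible_set0.
  by case: ifPn => [/eqP Bq0|_]; [exists (B q); split|exact: negligible_set0].
apply: measure_negligible.
  by apply: open_measurable_rV; apply: closed_openC; exact: supp_closed.
apply: negligibleS muC => x /existsNP[A /not_implyP[oA /not_implyP[Ax muA]]].
have muA0 : mu A = 0%E by apply/eqP; rewrite -measure_le0 leNgt; apply/negP.
have : A x by []; rewrite {1}(Defs.open_rV_bigcup oA) => -[q /= qA Bqx].
exists (pickle q) => //; rewrite /C pickleK ifT//.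
by apply/eqP; exact: (subset_measure0 (mB q) (open_measurable_rV oA) qA muA0).
Qed.

Context (U : 'rV[R]_d -> \bar R).
Hypothesis potU : has_potential mu U.

Let mU : measurable_fun setT (fun x => expeR (- U x)).
Proof.
have [mU _ _] := potU; apply: (measurableT_comp (@measurable_expeR R)).
exact: measurableT_comp.
Qed.

Lemma integral_has_potential h : measurable_fun setT h -> (forall x, 0 <= h x)%E ->
  (\int[mu]_x h x = \int[lebesgue_rV d]_x (h x * expeR (- U x)))%E.
Proof.
have [_ _ muE] := potU => mh h0.
by apply: integral_density => // x; exact: expeR_ge0.
Qed.

(** The regularity conditions control the potential only in the interior of the support. What is
    left out is the complement of the support and a convex boundary; the latter is Lebesgue-null,
    hence null for a measure with a density. *)
Lemma supp_interiorC0 : @convex_set R 'rV[R]_d (supp mu) -> mu (~` (supp mu)°) = 0%E.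
Proof.
move=> csupp; have mI : measurable (supp mu)°.
  by apply: open_measurable_rV; exact: open_interior.
have mS : measurable (supp mu).
  rewrite -(setCK (supp mu)); apply: measurableC; apply: open_measurable_rV.
  by apply: closed_openC; exact: supp_closed.
have mSI : measurable (supp mu `\` (supp mu)°) by exact: measurableD.
have S0 : mu (supp mu `\` (supp mu)°) = 0%E.
  have [_ _ ->//] := potU; apply: null_set_integral => //; first exact: measurable_funTS.
  apply: lebesgue_rV_boundary_convex; first exact: supp_closed.
  exact: convex_set_rV_convex.
have : mu (~` supp mu `|` (supp mu `\` (supp mu)°)) = 0%E.
  by rewrite measureU0//; [exact: suppC0|exact: measurableC].
apply: subset_measure0; [exact: measurableC|by apply: measurableU => //; exact: measurableC|].
by move=> x xI; have [Sx|nSx] := pselect (supp mu x); [right|left].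
Qed.

(** A converse of absolute continuity, valid where the density is positive. It turns statements that
    hold [mu]-almost everywhere into statements that hold Lebesgue-almost everywhere on an open set,
    where geometry applies. *)
Lemma potential_null A : measurable A -> mu A = 0%E ->
  (forall x, (supp mu)° x -> 0 < expeR (- U x))%E ->
  lebesgue_rV d (A `&` (supp mu)°) = 0%E.
Proof.
move=> mA muA0 pos; have mI : measurable (supp mu)°.
  by apply: open_measurable_rV; exact: open_interior.
have mAI := measurableI _ _ mA mI.
have : mu (A `&` (supp mu)°) = 0%E by exact: subset_measure0 muA0.
have [_ _ ->//] := potU => int0.
have : ae_eq (lebesgue_rV d) (A `&` (supp mu)°) (fun x => expeR (- U x)) (cst 0%E).
  apply/ae_eq_integral_abs => //; first exact: measurable_funTS.
  by rewrite -[RHS]int0; apply: eq_integral => x _; rewrite gee0_abs// expeR_ge0.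
move=> [N [mN N0 sN]]; apply: (subset_measure0 _ mN _ N0) => // x [Ax Ix].
apply: sN => /= h; have := pos _ Ix; rewrite h//; first by rewrite ltxx.
Qed.

End support.

(** * Laplace transforms *)

Section dot.
Context {R : realType} {d : nat}.
Implicit Types x y z h : 'rV[R]_d.

Definition dot x y : R := \sum_(i < d) x 0 i * y 0 i.

(** The norm dual to the sup norm of ['rV[R]_d]; see [normr_dot_le]. *)
Definition norm1 y : R := \sum_(i < d) `|y 0 i|.

Lemma dotDl x y z : dot (x + y) z = dot x z + dot y z.
Proof. by rewrite /dot -big_split; apply: eq_bigr => i _; rewrite mxE mulrDl. Qed.

Lemma dotZl a x y : dot (a *: x) y = a * dot x y.
Proof. by rewrite /dot mulr_sumr; apply: eq_bigr => i _; rewrite mxE mulrA. Qed.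

Lemma dotC x y : dot x y = dot y x.
Proof. by apply: eq_bigr => i _; rewrite mulrC. Qed.

Lemma dotNl x y : dot (- x) y = - dot x y.
Proof. by rewrite -scaleN1r dotZl mulN1r. Qed.

Lemma dotBl x y z : dot (x - y) z = dot x z - dot y z.
Proof. by rewrite dotDl dotNl. Qed.

Lemma dotDr x y z : dot x (y + z) = dot x y + dot x z.
Proof. by rewrite dotC dotDl !(dotC x). Qed.

Lemma dotZr a x y : dot x (a *: y) = a * dot x y.
Proof. by rewrite dotC dotZl dotC. Qed.

Lemma dotNr x y : dot x (- y) = - dot x y.
Proof. by rewrite dotC dotNl dotC. Qed.

Lemma dotBr x y z : dot x (y - z) = dot x y - dot x z.
Proof. by rewrite dotDr dotNr. Qed.

Lemma sqnormE x : sqnorm x = dot x x.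
Proof. by apply: eq_bigr => i _; rewrite expr2. Qed.

Lemma sqnorm_ge0 x : 0 <= sqnorm x.
Proof. by apply: sumr_ge0 => i _; exact: sqr_ge0. Qed.

Lemma norm1_ge0 y : 0 <= norm1 y.
Proof. by apply: sumr_ge0. Qed.

Lemma coord_le_norm1 y i : `|y 0 i| <= norm1 y.
Proof. by rewrite /norm1 (bigD1 i)//= lerDl sumr_ge0. Qed.

Lemma coord_le_norm x i : `|x 0 i| <= `|x|.
Proof.
apply/ler_addgt0Pr => e e0; have r0 : 0 < `|x| + e by rewrite ltr_wpDl.
have : ball x (`|x| + e) 0.
  by rewrite -ball_normE /ball_/= subr0 ltrDl.
by case=> _ /(_ 0 i); rewrite /ball/= mxE subr0 => /ltW.
Qed.

Lemma normr_dot_le x y : `|dot x y| <= `|x| * norm1 y.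
Proof.
rewrite /norm1 mulr_sumr; apply: le_trans (ler_norm_sum _ _ _) _.
by apply: ler_sum => i _; rewrite normrM ler_wpM2r// coord_le_norm.
Qed.

Lemma measurable_dot x : measurable_fun setT (dot x).
Proof.
apply: measurable_sum => i; apply: measurable_funM => //; exact: measurable_coord.
Qed.

Lemma measurable_norm1 : measurable_fun setT norm1.
Proof.
apply: measurable_sum => i; apply: (measurableT_comp (@normr_measurable R setT)).
exact: measurable_coord.
Qed.

Lemma dot_is_linear x : linear (dot x).
Proof. by move=> a u v; rewrite dotDr dotZr. Qed.

HB.instance Definition _ x :=
  GRing.isLinear.Build R 'rV[R]_d R *:%R (dot x) (dot_is_linear x).

Lemma continuous_dot x : continuous (dot x).
Proof.
rewrite (_ : dot x = \sum_(i < d) (fun y : 'rV[R]_d => x 0 i * y 0 i)); last first.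
  by apply/funext => y; rewrite fct_sumE.
move=> y; apply: differentiable_continuous; apply: differentiable_sum => i.
by apply: differentiableZ; exact: differentiable_coord.
Qed.

Lemma quadratic_differentiable (f : 'rV[R]_d -> R) x a (C e : R) : 0 < e ->
  (forall h, `|h| < e -> `|f (x + h) - f x - dot a h| <= C * `|h| ^+ 2) ->
  differentiable f x /\ 'd f x = dot a :> (_ -> _).
Proof.
move=> e0 fC.
have exp : f \o shift x = cst (f x) + dot a +o_ (0 : 'rV[R]_d) (@id 'rV[R]_d).
  apply/eqaddoP => eta eta0.
  (* [C] may vanish or be negative, while the radius [eta / C'] below requires a positive
     constant. *)
  pose C' := Num.max C 1; have C'0 : 0 < C' by rewrite lt_max ltr01 orbT.
  near=> h.
  rewrite [X in `|X| <= _](_ : _ = f (x + h) - f x - dot a h); last first.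
    by rewrite (addrC x) -addrA -opprD.
  have he : `|h| < e.
    by near: h; apply/nbhs_ballP; exists e => //= z; rewrite -ball_normE /ball_/= sub0r normrN.
  apply: le_trans (fC h he) _.
  apply: (@le_trans _ _ (C' * `|h| ^+ 2)); first by rewrite ler_wpM2r ?sqr_ge0// le_max lexx.
  rewrite expr2 mulrA ler_wpM2r// mulrC -ler_pdivlMr// ltW//.
  near: h; apply/nbhs_ballP; exists (eta / C') => /=; first exact: divr_gt0.
  by move=> z; rewrite -ball_normE /ball_/= sub0r normrN.
have dE := diff_unique (@continuous_dot a) exp.
split=> //; apply/diff_locallyP; rewrite dE; split=> //; exact: continuous_dot.
Unshelve. all: by end_near. Qed.

End dot.

(** Everything comes from [1 + t <= expR t], used at [t] and at [- t]; the latter gives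
    [expR t - 1 <= t * expR t]. *)
Lemma expR_taylor1 {R : realType} (t : R) : `|expR t - 1 - t| <= t ^+ 2 * expR `|t|.
Proof.
have h1 := expR_ge1Dx t; rewrite ger0_norm; last by lra.
have h2 : expR t - 1 <= t * expR t.
  have := expR_ge1Dx (- t); rewrite expRN => h2.
  have e0 := expR_gt0 t.
  have : (1 - t) * expR t <= 1 by rewrite -ler_pdivlMr// div1r.
  lra.
have h3 := expR_gt0 t.
have [t0|t0] := leP 0 t; rewrite expr2.
  rewrite ger0_norm// -mulrA.
  by apply: (@le_trans _ _ (t * (t * expR t))) => //; nra.
have e1 : 1 <= expR `|t| by rewrite -expR0 ler_expR.
by nra.
Qed.

Lemma Rintegral_sum d (T : measurableType d) {R : realType} (mu : {measure set T -> \bar R})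
    n (F : 'I_n -> T -> R) :
  (forall i, mu.-integrable setT (EFin \o F i)) ->
  \int[mu]_x (\sum_(i < n) F i x) = \sum_(i < n) \int[mu]_x F i x.
Proof.
move=> iF; rewrite /Rintegral.
under eq_integral do rewrite -sumEFin.
rewrite integral_sum// sum_fine// => i _.
exact: (integrable_fin_num measurableT (iF i)).
Qed.

Section laplace_transform.
Context {R : realType} {d : nat}.
Variables (mu : {measure set 'rV[R]_d -> \bar R}) (G : 'rV[R]_d -> R) (c : R).
Hypotheses (mG : measurable_fun setT G) (G0 : forall y, 0 <= G y) (c0 : 0 < c).
Implicit Types (w : 'rV[R]_d -> R) (x y h : 'rV[R]_d).

Definition tilt x y : R := G y * expR (c * dot x y).

Lemma tilt_ge0 x y : 0 <= tilt x y.
Proof. by rewrite mulr_ge0// expR_ge0. Qed.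

Lemma measurable_tilt x : measurable_fun setT (tilt x).
Proof.
apply: measurable_funM => //; apply: (measurableT_comp (@measurable_expR R)).
by apply: measurable_funM => //; exact: measurable_dot.
Qed.

Definition laplace x : \bar R := \int[mu]_y (tilt x y)%:E.

Lemma laplace_ge0 x : (0 <= laplace x)%E.
Proof. by apply: integral_ge0 => y _; rewrite lee_fin tilt_ge0. Qed.

Definition moment w x : R := \int[mu]_y (w y * tilt x y).

(** A class of weights that contains the constants and is stable under multiplication by coordinates
    ([subexponential_coord]). The derivative of a moment is then again such a moment, so one
    differentiation lemma serves at every order. *)
Definition subexponential w := measurable_fun setT w /\
  forall eta : R, 0 < eta -> exists C, forall y, `|w y| <= C * expR (eta * norm1 y).

Lemma norm1_le_expR (eta : R) y : 0 < eta -> norm1 y <= eta^-1 * expR (eta * norm1 y).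
Proof.
move=> eta0; rewrite mulrC ler_pdivlMr// mulrC.
by apply: le_trans (expR_ge1Dx _); rewrite lerDr.
Qed.

Lemma subexponential1 : subexponential (fun=> 1).
Proof.
split=> // eta eta0; exists 1 => y; rewrite normr1 mul1r -expR0 ler_expR.
by rewrite mulr_ge0 ?norm1_ge0// ltW.
Qed.

Lemma subexponential_coord w i : subexponential w -> subexponential (fun y => y 0 i * w y).
Proof.
move=> [mw sw]; split; first by apply: measurable_funM => //; exact: measurable_coord.
move=> eta eta0; have eta20 : 0 < eta / 2 by rewrite divr_gt0.
have [C wC] := sw _ eta20.
exists ((eta / 2)^-1 * C) => y; rewrite normrM.
have -> : expR (eta * norm1 y) = expR (eta / 2 * norm1 y) * expR (eta / 2 * norm1 y).
  by rewrite -expRD -mulrDl -splitr.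
rewrite mulrACA; apply: ler_pM => //.
exact: le_trans (coord_le_norm1 y i) (norm1_le_expR y eta20).
Qed.

Variables (x : 'rV[R]_d) (e : R).
Hypotheses (e0 : 0 < e) (Lfin : forall z, ball x e z -> (laplace z < +oo)%E).

(** Finiteness on a neighbourhood of [x] gives room for an exponential factor. Each
    [expR (delta * |y_i|)] is at most the sum of [expR (delta * y_i)] and [expR (- delta * y_i)];
    expanding the product over [i] gives a sum over sign vectors, whose terms are the tilts at the
    corners [z s] of a cube inside the ball. *)
Lemma integrable_tilt_norm1 : exists2 delta : R, 0 < delta &
  mu.-integrable setT (EFin \o (fun y => tilt x y * expR (delta * norm1 y))).
Proof.
pose delta := c * (e / 2); have d0 : 0 < delta by rewrite mulr_gt0// divr_gt0.
have mh : measurable_fun setT (fun y => tilt x y * expR (delta * norm1 y)).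
  apply: measurable_funM; first exact: measurable_tilt.
  apply: (measurableT_comp (@measurable_expR R)).
  by apply: measurable_funM => //; exact: measurable_norm1.
exists delta => //; apply/integrableP; split; first exact/measurable_EFinP.
pose z (s : {ffun 'I_d -> bool}) : 'rV[R]_d := x + \row_i ((-1) ^+ s i * (e / 2)).
have zb s : ball x e (z s).
  apply: (ball_sym (ball_sym _)); split=> // i j; rewrite ord1 !mxE /ball/= opprD addrA subrr add0r.
  rewrite normrN normrM normrX normrN normr1 expr1n mul1r ger0_norm; last by rewrite divr_ge0// ltW.
  by rewrite ltr_pdivrMr// mulr_natr mulr2n ltrDr.
have key y : tilt x y * expR (delta * norm1 y) <= \sum_s tilt (z s) y.
  have -> : \sum_s tilt (z s) y =
      tilt x y * \sum_(s : {ffun 'I_d -> bool}) \prod_i expR (delta * ((-1) ^+ s i * y 0 i)).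
    rewrite mulr_sumr; apply: eq_bigr => s _.
    rewrite /tilt /z dotDl mulrDr expRD mulrA; congr (_ * _).
    rewrite /dot mulr_sumr expR_sum; apply: eq_bigr => i _; rewrite !mxE /delta.
    by congr expR; ring.
  rewrite ler_wpM2l ?tilt_ge0//.
  rewrite -(bigA_distr_bigA (fun i (b : bool) => expR (delta * ((-1) ^+ b * y 0 i)))) /=.
  rewrite /norm1 mulr_sumr expR_sum; apply: ler_prod => i _; rewrite expR_ge0/=.
  rewrite (bigD1 true)//= (bigD1 false)//= big1 ?addr0; last by case.
  rewrite expr1 expr0 mul1r mulN1r.
  have [y0|y0] := leP 0 (y 0 i); [rewrite (ger0_norm y0) lerDr|rewrite (ltr0_norm y0) lerDl];
    exact: expR_ge0.
apply: (@le_lt_trans _ _ (\int[mu]_y (\sum_s (tilt (z s) y)%:E))%E).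
  apply: ge0_le_integral => //.
  - exact/measurableT_comp/measurable_EFinP.
  - by apply: emeasurable_sum => s; apply/measurable_EFinP; exact: measurable_tilt.
  - move=> y _; rewrite /= sumEFin lee_fin ger0_norm; first exact: key.
    by rewrite mulr_ge0 ?tilt_ge0 ?expR_ge0.
rewrite ge0_integral_sum//.
- by apply: lte_sum_pinfty => s _; exact: Lfin.
- by move=> s; apply/measurable_EFinP; exact: measurable_tilt.
- by move=> s y _; rewrite lee_fin tilt_ge0.
Qed.

Lemma differentiable_moment w : subexponential w ->
  differentiable (moment w) x /\
  'd (moment w) x = dot (\row_i (c * moment (fun y => y 0 i * w y) x)) :> (_ -> _).
Proof.
move=> sw; have [delta d0 idelta] := integrable_tilt_norm1.
(* The budget [delta] is split into four equal parts: one for the growth of [w], two for the square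
   of [t = c * dot h y], and one for [expR |t|] in the Taylor remainder. *)
have d40 : 0 < delta / 4 by rewrite divr_gt0.
have [mw wexp] := sw; have [C wC] := wexp _ d40.
have sub_ge0 w' C' : (forall y, `|w' y| <= C' * expR (delta / 4 * norm1 y)) -> 0 <= C'.
  by move=> /(_ 0); rewrite -(pmulr_lge0 _ (expR_gt0 (delta / 4 * norm1 (0 : 'rV[R]_d))));
    apply: le_trans.
have C0 := sub_ge0 _ _ wC.
have tiltD h y : tilt (x + h) y = tilt x y * expR (c * dot h y).
  by rewrite /tilt dotDl mulrDr expRD mulrA.
have cdot h y : c * `|h| <= delta / 4 -> `|c * dot h y| <= delta / 4 * norm1 y.
  move=> hd; rewrite normrM gtr0_norm//.
  apply: le_trans (ler_wpM2r (norm1_ge0 y) hd).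
  by rewrite -mulrA ler_pM2l// normr_dot_le.
have exp4 y : expR (delta * norm1 y) = expR (delta / 4 * norm1 y) ^+ 4.
  by rewrite -expRM_natr; congr expR; field.
have exp4_ge1 y : 1 <= expR (delta / 4 * norm1 y).
  by rewrite -[leLHS]expR0 ler_expR mulr_ge0 ?norm1_ge0// ltW.
have int w' h : subexponential w' -> c * `|h| <= delta / 4 ->
    mu.-integrable setT (EFin \o (fun y => w' y * tilt (x + h) y)).
  move=> [mw' sw'] hd; have [C' wC'] := sw' _ d40; have C'0 := sub_ge0 _ _ wC'.
  apply: (le_integrable measurableT _ _ (integrableZl measurableT C' idelta)).
    by apply/measurable_EFinP; apply: measurable_funM => //; exact: measurable_tilt.
  move=> y _ /=; rewrite lee_fin normrM tiltD.
  rewrite (ger0_norm (mulr_ge0 (tilt_ge0 _ _) (expR_ge0 _))).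
  rewrite [leRHS]ger0_norm ?mulr_ge0 ?tilt_ge0 ?expR_ge0//.
  set E := expR (delta / 4 * norm1 y).
  apply: (@le_trans _ _ (C' * E * (tilt x y * E))).
    apply: ler_pM => //; first by rewrite mulr_ge0 ?tilt_ge0 ?expR_ge0.
    rewrite ler_wpM2l ?tilt_ge0// ler_expR.
    by apply: le_trans (cdot _ y hd); exact: ler_norm.
  rewrite exp4 -/E (_ : C' * E * _ = C' * tilt x y * E ^+ 2); last by ring.
  rewrite [leRHS]mulrA ler_wpM2l ?mulr_ge0 ?tilt_ge0//.
  by apply: ler_weXn2l => //; exact: exp4_ge1.
have int0 w' : subexponential w' -> mu.-integrable setT (EFin \o (fun y => w' y * tilt x y)).
  by move=> sw'; have := int w' 0 sw'; rewrite addr0; apply; rewrite normr0 mulr0 ltW.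
have inti i : mu.-integrable setT (EFin \o (fun y => y 0 i * w y * tilt x y)).
  by apply: int0; exact: subexponential_coord.
pose I := \int[mu]_y (tilt x y * expR (delta * norm1 y)).
apply: (@quadratic_differentiable _ _ _ _ _
  (C * (c ^+ 2 * (delta / 4)^-1 ^+ 2) * I) (delta / 4 / c)); first by rewrite divr_gt0.
move=> h; rewrite ltr_pdivlMr// mulrC => /ltW hd.
have dotE : dot (\row_i (c * moment (fun y => y 0 i * w y) x)) h =
    \int[mu]_y (c * dot h y * (w y * tilt x y)).
  transitivity (\sum_(i < d) \int[mu]_y (c * h 0 i * (y 0 i * w y * tilt x y))).
    apply: eq_bigr => i _; rewrite mxE RintegralZl// -/(moment _ x); ring.
  rewrite -Rintegral_sum; last first.
    by move=> i; have := integrableZl measurableT (c * h 0 i) (inti i).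
  apply: eq_Rintegral => y _; rewrite /dot mulr_sumr mulr_suml; apply: eq_bigr => i _; ring.
have intdot : mu.-integrable setT (EFin \o (fun y => c * dot h y * (w y * tilt x y))).
  rewrite (_ : _ \o _ = fun y => (\sum_(i < d) (c * h 0 i * (y 0 i * w y * tilt x y))%:E)%E).
    by apply: integrable_sum => // i _; have := integrableZl measurableT (c * h 0 i) (inti i).
  apply/funext => y; rewrite sumEFin /=; congr EFin.
  rewrite /dot mulr_sumr mulr_suml; apply: eq_bigr => i _; ring.
have intB : mu.-integrable setT (EFin \o (fun y => w y * tilt (x + h) y - w y * tilt x y)).
  exact: (integrableB measurableT (int _ _ sw hd) (int0 _ sw)).
rewrite dotE /moment -RintegralB//; [|exact: int|exact: int0].
rewrite -RintegralB//.
have intR : mu.-integrable setT (EFin \o (fun y => w y * tilt (x + h) y - w y * tilt x y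
    - c * dot h y * (w y * tilt x y))).
  exact: (integrableB measurableT intB intdot).
apply: le_trans (le_normr_Rintegral measurableT intR) _.
rewrite mulrAC /I -RintegralZl//; apply: le_Rintegral => //.
- exact: (integrable_norm intR).
- exact: (integrableZl measurableT _ idelta).
move=> y _; rewrite tiltD.
rewrite (_ : _ - _ = w y * tilt x y * (expR (c * dot h y) - 1 - c * dot h y)); last by ring.
set t := c * dot h y; set E := expR (delta / 4 * norm1 y).
have tE : `|t| <= c * `|h| * ((delta / 4)^-1 * E).
  rewrite normrM gtr0_norm// -!mulrA ler_pM2l//.
  apply: le_trans (normr_dot_le _ _) _; rewrite ler_wpM2l//.
  exact: norm1_le_expR.
have t2 : `|expR t - 1 - t| <= (c * `|h| * ((delta / 4)^-1 * E)) ^+ 2 * E.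
  apply: le_trans (expR_taylor1 t) _; apply: ler_pM; rewrite ?sqr_ge0 ?expR_ge0//.
    by rewrite -real_normK ?num_real// lerXn2r// nnegrE// (le_trans _ tE).
  by rewrite ler_expR; exact: cdot.
rewrite normrM normrM (ger0_norm (tilt_ge0 _ _)).
apply: (@le_trans _ _ (C * E * tilt x y * ((c * `|h| * ((delta / 4)^-1 * E)) ^+ 2 * E))).
  apply: ler_pM => //; first by rewrite mulr_ge0 ?tilt_ge0.
  by rewrite ler_wpM2r ?tilt_ge0//; exact: wC.
by rewrite exp4 -/E le_eqVlt; apply/orP; left; apply/eqP; ring.
Qed.

End laplace_transform.

(** * Second differences and Hessians *)

Section second_difference_line.
Context {R : realType}.
Implicit Types (p q r : R -> R) (a b s t : R).

Let is_derive_sym p q a t : is_derive t 1 p (q t) -> is_derive (- t) 1 p (q (- t)) ->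
  is_derive t 1 (fun t => p t + p (- t) - a * t ^+ 2) (q t - q (- t) - 2 * a * t).
Proof.
move=> dp dNp.
have dN : is_derive t 1 (fun t => p (- t)) (- q (- t)).
  have := @is_derive1_comp R p -%R t (q (- t)) (- 1).
  by rewrite mulrN1; apply.
by apply: is_derive_eq; rewrite /GRing.scale/= mulr1; ring.
Qed.

(** Two mean value theorems: one on [[0, 1]] for [p t + p (- t) - b t^2], which yields
    [q xi - q (- xi) - 2 b xi], and one on [[- xi, xi]] for [q], which rewrites this as
    [2 xi (r zeta - b)]. Continuity of the second derivative is not involved. *)
Lemma second_difference_le p q r b :
  (forall t, -1 <= t <= 1 -> is_derive t 1 p (q t)) ->
  (forall t, -1 <= t <= 1 -> is_derive t 1 q (r t)) ->
  (forall t, -1 <= t <= 1 -> r t <= b) ->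
  p 1 + p (-1) - 2 * p 0 <= b.
Proof.
move=> dp dq rb.
pose g t := p t + p (- t) - b * t ^+ 2.
pose g' t := q t - q (- t) - 2 * b * t.
have dg t : 0 <= t <= 1 -> is_derive t 1 g (g' t).
  by move=> /andP[t0 t1]; apply: is_derive_sym; apply: dp; apply/andP; split; lra.
have cg : {within `[0, 1], continuous g}.
  apply: derivable_within_continuous => t; rewrite in_itv/= => t01.
  by have [] := dg t t01.
have [t|xi] := MVT ltr01 (_ : forall t, t \in `]0, 1[ -> is_derive t 1 g (g' t)) cg.
  by rewrite in_itv/= => /andP[t0 t1]; apply: dg; rewrite !ltW.
rewrite in_itv/= => /andP[xi0 xi1]; rewrite subr0 mulr1 /g oppr0 expr0n expr1n mulr0 mulr1 subr0.
have Nxi : - xi < xi by lra.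
have [t| |zeta] := @MVT R q r (- xi) xi Nxi.
- by rewrite in_itv/= => /andP[t0 t1]; apply: dq; apply/andP; split; lra.
- apply: derivable_within_continuous => t; rewrite in_itv/= => /andP[t0 t1].
  have t11 : -1 <= t <= 1 by apply/andP; split; lra.
  by have [] := dq t t11.
rewrite in_itv/= => /andP[z0 z1] qE; rewrite /g' qE.
have rz : r zeta <= b by apply: rb; apply/andP; split; lra.
move=> h; have : (r zeta - b) * xi <= 0 by rewrite mulr_le0_ge0// ?subr_le0// ltW.
lra.
Qed.

(** By contradiction: if [s < a], the expansion of [q] at 0 makes [q t - q (- t) - 2 a t] negative
    for small [t > 0], while the mean value theorem applied to [p t + p (- t) - a t^2] gives a point
    where it is nonnegative. *)
Lemma second_difference_derive_ge p q a s (e : R) : 0 < e ->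
  (forall t, `|t| < e -> is_derive t 1 p (q t)) -> is_derive (0 : R) (1 : R) q s ->
  (forall t, `|t| < e -> a * t ^+ 2 <= p t + p (- t) - 2 * p 0) -> a <= s.
Proof.
move=> e0 dp dq pa; rewrite leNgt; apply/negP => sa.
(* The expansions at [t] and [- t] err by at most [eta t] each, together [(a - s) t], which is half
   of the gap [2 (a - s) t]. *)
pose eta := (a - s) / 2; have eta0 : 0 < eta by rewrite divr_gt0// subr_gt0.
have [dq1 dq2] := dq.
have qlim : _ --> 'D_1 q 0 := dq1.
rewrite dq2 in qlim.
have /cvgrPdist_lt/(_ _ eta0) := qlim.
rewrite near_withinE => /nbhs_ballP[d /= d0 qd].
pose m := Num.min d e / 2.
have me0 : 0 < Num.min d e by rewrite lt_min d0 e0.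
have m0 : 0 < m by rewrite divr_gt0.
have mm : m < Num.min d e by rewrite /m; lra.
have qb t : t != 0 -> `|t| < d -> `|q t - q 0 - s * t| <= eta * `|t|.
  move=> t0 td; have := qd t; rewrite /ball/= sub0r normrN => /(_ td t0).
  rewrite /shift/= addr0 scaler1 /GRing.scale/= => /ltW.
  rewrite -(ler_pM2r (_ : 0 < `|t|)) ?normr_gt0// -normrM.
  by rewrite mulrBl mulrAC mulVf// mul1r distrC.
pose g t := p t + p (- t) - a * t ^+ 2.
pose g' t := q t - q (- t) - 2 * a * t.
have dg t : `|t| < e -> is_derive t 1 g (g' t).
  by move=> te; apply: is_derive_sym; apply: dp; rewrite ?normrN.
have lt_me t : 0 <= t <= m -> `|t| < e /\ `|t| < d.
  move=> /andP[t0 tm]; rewrite ger0_norm//.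
  by split; apply: (le_lt_trans tm); apply: (lt_le_trans mm); rewrite ge_min lexx ?orbT.
have cg : {within `[0, m], continuous g}.
  apply: derivable_within_continuous => t; rewrite in_itv/= => /lt_me[te _].
  by have [] := dg t te.
have [t|xi] := MVT m0 (_ : forall t, t \in `]0, m[ -> is_derive t 1 g (g' t)) cg.
  by rewrite in_itv/= => /andP[t0 t1]; apply: dg; apply: (lt_me _ _).1; rewrite !ltW.
rewrite in_itv/= => /andP[xi0 xi1].
have [xie xid] : `|xi| < e /\ `|xi| < d by apply: lt_me; rewrite !ltW.
have [me _] : `|m| < e /\ `|m| < d by apply: lt_me; rewrite lexx ltW.
have := pa m me; have xin0 : xi != 0 by rewrite gt_eqF.
have Nxin0 : - xi != 0 by rewrite oppr_eq0.
have := qb xi xin0 xid; have := qb (- xi) Nxin0 _; rewrite !normrN => /(_ xid).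
rewrite (gtr0_norm xi0) !ler_norml => /andP[h1 h2] /andP[h3 h4] h5.
rewrite subr0 /g oppr0 expr0n mulr0 subr0 => h6.
have : 0 <= g' xi * m by rewrite -h6; lra.
rewrite pmulr_lge0// /g' => h7.
have : 0 < xi * (a - s) by rewrite mulr_gt0// subr_gt0.
rewrite /eta in h1 h2 h3 h4; lra.
Qed.

End second_difference_line.

(** * Hessians as second derivatives along lines *)

Section hessian_line.
Context {R : realType} {d : nat}.
Implicit Types (u w : 'rV[R]_d -> R) (x v : 'rV[R]_d).

Lemma derive_line u x v (t : R) :
  derivable u (x + t *: v) v -> is_derive t (1 : R) (fun t => u (x + t *: v)) ('D_v u (x + t *: v)).
Proof.
have E : (fun h : R => h^-1 *: (((fun t => u (x + t *: v)) \o shift t) (h *: (1 : R)) - u (x + t *: v)))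
    = (fun h : R => h^-1 *: ((u \o shift (x + t *: v)) (h *: v) - u (x + t *: v))).
  apply/funext => h /=; congr (_ *: (u _ - _)).
  by rewrite scaler1 scalerDl addrCA.
by move=> uv; split; rewrite /derivable /derive E.
Qed.

Lemma diff_partial u x v : differentiable u x ->
  'd u x v = \sum_i v 0 i * partial i u x.
Proof.
move=> du; rewrite [v in LHS]row_sum_delta linear_sum; apply: eq_bigr => i _.
by rewrite linearZ /partial deriveE.
Qed.

Lemma is_derive_line u x v (t : R) : differentiable u (x + t *: v) ->
  is_derive t (1 : R) (fun t => u (x + t *: v)) (\sum_i v 0 i * partial i u (x + t *: v)).
Proof.
move=> du; rewrite -diff_partial// -deriveE//.
by apply: derive_line; exact: diff_derivable.
Qed.

Definition hessian_form u x v : R := (v *m hessian u x *m v^T) 0 0.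

Lemma hessian_formE u x v :
  hessian_form u x v = \sum_i v 0 i * \sum_j v 0 j * partial j (partial i u) x.
Proof.
rewrite /hessian_form mxE; apply: eq_bigr => i _; rewrite !mxE mulrC; congr (_ * _).
by apply: eq_bigr => j _; rewrite mxE.
Qed.

Lemma is_derive2_line u x v (t : R) :
  (forall i, differentiable (partial i u) (x + t *: v)) ->
  is_derive t (1 : R) (fun t => \sum_i v 0 i * partial i u (x + t *: v))
    (hessian_form u (x + t *: v) v).
Proof.
move=> du; rewrite hessian_formE.
have dui i : is_derive t (1 : R) (fun t => v 0 i * partial i u (x + t *: v))
    (v 0 i * \sum_j v 0 j * partial j (partial i u) (x + t *: v)).
  have := is_derive_line (du i); move=> H.
  exact: is_deriveZ.
have := @is_derive_sum R R R d (fun i t => v 0 i * partial i u (x + t *: v)) t 1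
  (fun i => v 0 i * \sum_j v 0 j * partial j (partial i u) (x + t *: v)) dui.
by rewrite (_ : \sum_(i < d) _ = fun t => \sum_i v 0 i * partial i u (x + t *: v))//;
  apply/funext => s; rewrite fct_sumE.
Qed.

Lemma second_difference_hessian_le u (A : set 'rV[R]_d) x v (b : R) :
  (forall t : R, -1 <= t <= 1 -> A (x + t *: v)) ->
  (forall y, A y -> twice_differentiable u y) ->
  (forall y, A y -> hessian_form u y v <= b) ->
  u (x + v) + u (x - v) - 2 * u x <= b.
Proof.
move=> Axv du hb.
have := @second_difference_le R (fun t => u (x + t *: v)) _ _ b
  (fun t t11 => is_derive_line (nbhs_singleton (du _ (Axv t t11)).1))
  (fun t t11 => is_derive2_line (du _ (Axv t t11)).2)
  (fun t t11 => hb _ (Axv t t11)).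
by rewrite /= scale1r scaleN1r scale0r addr0.
Qed.

Lemma hessian_second_difference_ge u x v (a e : R) : 0 < e ->
  twice_differentiable u x ->
  (forall t : R, `|t| < e -> a * t ^+ 2 <= u (x + t *: v) + u (x - t *: v) - 2 * u x) ->
  a <= hessian_form u x v.
Proof.
move=> e0 [du du2] ua.
have [e1 e10 due] : exists2 e1, 0 < e1 & forall t : R, `|t| < e1 -> differentiable u (x + t *: v).
  move/nbhs_ballP: du => [r /= r0 ur].
  exists (r / (`|v| + 1)); first by rewrite divr_gt0// ltr_wpDl.
  move=> t; rewrite ltr_pdivlMr ?ltr_wpDl// => tr; apply: ur.
  rewrite -ball_normE /ball_/= opprD addrA subrr add0r normrN normrZ.
  by apply: le_lt_trans tr; rewrite ler_wpM2l// lerDl.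
have d2 := @is_derive2_line u x v 0; rewrite scale0r addr0 in d2.
apply: (@second_difference_derive_ge R (fun t => u (x + t *: v)) _ a _ (Num.min e e1) _ _ (d2 du2)).
- by rewrite lt_min e0.
- move=> t; rewrite lt_min => /andP[_ te1].
  exact: is_derive_line (due t te1).
- by move=> t; rewrite lt_min => /andP[te _]; rewrite scaleNr scale0r addr0; exact: ua.
Qed.

Lemma near_eq_differentiable u w x : (\forall y \near x, u y = w y) ->
  differentiable u x -> differentiable w x.
Proof.
move=> uw du; have ux := nbhs_singleton uw.
have /diff_locallyP[cd /eqaddoP exp] := du.
have expw : w \o shift x = cst (w x) + 'd u x +o_ (0 : 'rV[R]_d) (@id 'rV[R]_d).
  apply/eqaddoP => eta eta0; move/nbhs_ballP : uw => [r /= r0 uw].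
  have near0 : \forall h \near (0 : 'rV[R]_d), `|h| < r.
    by apply/nbhs_ballP; exists r => //= z; rewrite -ball_normE /ball_/= sub0r normrN.
  apply: filterS2 (exp eta eta0) near0 => h; rewrite -[_ h]/(u (h + x) - (u x + 'd u x h)).
  rewrite -[(_ - _) h]/(w (h + x) - (w x + 'd u x h)) => uh hr.
  rewrite -ux -uw//; rewrite -ball_normE /ball_/= opprD addrCA subrr addr0 normrN//.
have dE := diff_unique cd expw.
by apply/diff_locallyP; rewrite dE.
Qed.

Lemma near_eq_partial u w x i : (\forall y \near x, u y = w y) ->
  \forall y \near x, partial i u y = partial i w y.
Proof.
move=> /near_join H; apply: filterS H => y uw.
by rewrite /partial; apply: near_eq_derive.
Qed.

(** Brenier potentials are extended-real functions that agree with a logarithm of a Laplace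
    transform only on an open set, so derivatives have to be transported along local equalities. *)
Lemma near_eq_twice_differentiable u w x : (\forall y \near x, u y = w y) ->
  twice_differentiable u x -> twice_differentiable w x /\ hessian w x = hessian u x.
Proof.
move=> uw [du du2]; split; first split.
- apply: filterS2 (near_join uw) du => y; exact: near_eq_differentiable.
- by move=> i; apply: near_eq_differentiable (du2 i); exact: near_eq_partial.
apply/matrixP => i j; rewrite !mxE; apply/esym.
by apply: (nbhs_singleton (near_eq_partial i (near_eq_partial j uw))).
Qed.

End hessian_line.

(** * Regularity of the logarithm of a Laplace transform *)

Section log_laplace.
Context {R : realType} {d : nat}.
Variables (mu : {measure set 'rV[R]_d -> \bar R}) (G : 'rV[R]_d -> R) (c : R).
Hypotheses (mG : measurable_fun setT G) (G0 : forall y, 0 <= G y) (c0 : 0 < c).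
Variables (A : set 'rV[R]_d) (eps : R).
Hypotheses (oA : open A) (Afin : forall x, A x -> (laplace mu G c x < +oo)%E)
  (Apos : forall x, A x -> 0 < fine (laplace mu G c x)).

Local Notation M w := (moment mu G c w).
Local Notation u := (fun x => eps * ln (fine (laplace mu G c x))).
Local Notation coordw i w := (fun y : 'rV[R]_d => y 0 i * w y).

Let M1E x : M (fun=> 1) x = fine (laplace mu G c x).
Proof. by apply: eq_Rintegral => y _; rewrite mul1r. Qed.

Let diffM w x : subexponential w -> A x -> differentiable (M w) x /\
  forall i, partial i (M w) x = c * M (coordw i w) x.
Proof.
move=> sw Ax; have /nbhs_ballP[e /= e0 eA] : nbhs x A by exact: open_nbhs_nbhs.
have [dM dME] := @differentiable_moment R d mu G c mG G0 c0 x e e0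
  (fun z xz => Afin (eA _ xz)) w sw.
split=> // i; rewrite /partial deriveE// dME /dot (bigD1 i)//= big1 ?addr0.
  by rewrite !mxE !eqxx mulr1.
by move=> j ji; rewrite !mxE (negPf ji) andbF mulr0.
Qed.

Let s1 := @subexponential1 R d.

Let du x : A x -> differentiable u x /\
  forall i, partial i u x = eps * (c * M (coordw i (fun=> 1)) x / M (fun=> 1) x).
Proof.
move=> Ax; have [dM pM] := diffM s1 Ax.
have uE : u = (fun t => eps * ln t) \o M (fun=> 1).
  by apply/funext => y /=; rewrite M1E.
have M0 : 0 < M (fun=> 1) x by rewrite M1E Apos.
have dl : is_derive (M (fun=> 1) x) 1 (fun t : R => eps * ln t) (eps * (M (fun=> 1) x)^-1).
  have := is_derive1_ln M0 => ?; exact: is_deriveZ.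
have ddl : differentiable (fun t : R => eps * ln t) (M (fun=> 1) x).
  by apply/derivable1_diffP; case: dl.
split; first by rewrite uE; exact: differentiable_comp.
move=> i; rewrite /partial uE deriveE; last exact: differentiable_comp.
rewrite diff_comp// /= -[X in 'd _ _ X]deriveE// -/(partial i _ x) pM.
rewrite deriv1E; last by case: dl.
rewrite derive1E; case: dl => _ ->.
by rewrite /GRing.scale/=; ring.
Qed.

(** The first partial derivatives are quotients of moments, hence differentiable by the same lemma
    one order higher. Symmetry of the Hessian is read off the explicit formula and needs no theorem
    on mixed derivatives. *)
Lemma twice_differentiable_log_laplace x : A x ->
  twice_differentiable u x /\ (hessian u x)^T = hessian u x.
Proof.
move=> Ax; have nA : \forall y \near x, A y by exact: open_nbhs_nbhs.
have M0 : 0 < M (fun=> 1) x by rewrite M1E Apos.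
pose v i y := eps * (c * M (coordw i (fun=> 1)) y / M (fun=> 1) y).
have uv i : \forall y \near x, v i y = partial i u y.
  by apply: filterS nA => y Ay; rewrite (du Ay).2.
have si i := subexponential_coord i s1.
have dv i : differentiable (v i) x.
  apply: differentiableZ; apply: differentiableM.
    by apply: differentiableZ; exact: (diffM (si i) Ax).1.
  by apply: differentiableV; [exact: (diffM s1 Ax).1|rewrite gt_eqF].
split; first split.
- by apply: filterS nA => y Ay; exact: (du Ay).1.
- by move=> i; apply: near_eq_differentiable (dv i); exact: uv.
(* Up to the factor [eps * c ^+ 2], this is the covariance of the coordinates [i] and [j] under the
   normalized tilted measure. *)
have pv i j : partial i (partial j u) x = eps * (c * (c * M (coordw i (coordw j (fun=> 1))) x)
    / M (fun=> 1) x - c * M (coordw j (fun=> 1)) x * (c * M (coordw i (fun=> 1)) x)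
    / M (fun=> 1) x ^+ 2).
  rewrite -(nbhs_singleton (near_eq_partial i (uv j))).
  have dMj := (diffM (si j) Ax).1; have dM1 := (diffM s1 Ax).1.
  have h1 : derivable (M (coordw j (fun=> 1))) x (delta_mx 0 i) by exact: diff_derivable.
  have h2 : derivable (M (fun=> 1)) x (delta_mx 0 i) by exact: diff_derivable.
  have M0' : M (fun=> 1) x != 0 by rewrite gt_eqF.
  have hj : is_derive x (delta_mx 0 i) (M (coordw j (fun=> 1)))
      (c * M (coordw i (coordw j (fun=> 1))) x).
    by split=> //; exact: (diffM (si j) Ax).2.
  have hN : is_derive x (delta_mx 0 i) (fun y => (M (fun=> 1) y)^-1)
      (- (M (fun=> 1) x) ^- 2 *: (c * M (coordw i (fun=> 1)) x)).
    split; first exact: derivableV.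
    by rewrite deriveV//; congr (_ *: _); exact: (diffM s1 Ax).2.
  have := is_deriveZ eps (is_deriveM (is_deriveZ c hj) hN).
  case=> _; rewrite /partial /v => ->.
  have scE (a b : R) : a *: (b : R^o) = a * b by [].
  by rewrite /GRing.scale_fun !scE; field; exact: M0'.
apply/matrixP => i j; rewrite !mxE !pv.
have -> : M (coordw j (coordw i (fun=> 1))) x = M (coordw i (coordw j (fun=> 1))) x.
  by apply: eq_Rintegral => y _; ring.
by congr (_ * (_ - _)); ring.
Qed.

End log_laplace.

(** * Convexity and smoothness of log-Laplace transforms *)

(** Pointwise, [q <= (t / 2) a + b / (2 t)] for every [t > 0], by the arithmetic-geometric
    inequality. The choice of [t] as the square root of [B / A] makes the two integrated terms
    equal; integrability of [q] is obtained along the way. *)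
Lemma integral_cauchy_schwarz d (T : measurableType d) {R : realType}
    (mu : {measure set T -> \bar R}) (a b q : T -> R) :
  measurable_fun setT a -> measurable_fun setT b -> measurable_fun setT q ->
  (forall x, 0 <= a x) -> (forall x, 0 <= b x) -> (forall x, 0 <= q x) ->
  (forall x, q x ^+ 2 <= a x * b x) ->
  (0 < \int[mu]_x (a x)%:E < +oo)%E -> (0 < \int[mu]_x (b x)%:E < +oo)%E ->
  ((\int[mu]_x (q x)%:E) ^+ 2 <= \int[mu]_x (a x)%:E * \int[mu]_x (b x)%:E)%E.
Proof.
move=> ma mb mq a0 b0 q0 qab /andP[A0 Aoo] /andP[B0 Boo].
have Af : (\int[mu]_x (a x)%:E \is a fin_num)%E by rewrite ge0_fin_numE// ltW.
have Bf : (\int[mu]_x (b x)%:E \is a fin_num)%E by rewrite ge0_fin_numE// ltW.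
move: A0 B0; rewrite -(fineK Af) -(fineK Bf) !lte_fin.
set A := fine _; set B := fine _ => A0 B0.
pose t := Num.sqrt (B / A); have BA0 : 0 < B / A by rewrite divr_gt0.
have t0 : 0 < t by rewrite sqrtr_gt0.
have t2 : t ^+ 2 = B / A by rewrite sqr_sqrtr// ltW.
have le1 : (\int[mu]_x (q x)%:E <= (t / 2 * A + (2 * t)^-1 * B)%:E)%E.
  have Zl (f : T -> R) (s : R) : measurable_fun setT f -> (forall x, 0 <= f x) -> 0 <= s ->
      (s%:E * \int[mu]_x (f x)%:E = \int[mu]_x (s * f x)%:E)%E.
    move=> mf f0 s0; under [RHS]eq_integral do rewrite EFinM.
    rewrite ge0_integralZl_EFin//; last exact/measurable_EFinP.
    by move=> x _; rewrite lee_fin.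
  have u0 : 0 <= t / 2 by rewrite divr_ge0// ltW.
  have v0 : 0 <= (2 * t)^-1 by rewrite invr_ge0 mulr_ge0// ltW.
  rewrite EFinD !EFinM !fineK// !Zl// -ge0_integralD//; first last.
  - by apply/measurable_EFinP; exact: measurable_funM.
  - by move=> x _; rewrite lee_fin mulr_ge0.
  - by apply/measurable_EFinP; exact: measurable_funM.
  - by move=> x _; rewrite lee_fin mulr_ge0.
  apply: ge0_le_integral => //.
  - by move=> x _; rewrite lee_fin.
  - exact/measurable_EFinP.
  - by apply: emeasurable_funD; apply/measurable_EFinP; exact: measurable_funM.
  move=> x _; rewrite -EFinD lee_fin.
  rewrite -(@ler_pXn2r _ 2)// ?nnegrE//; last first.
    by rewrite addr_ge0// mulr_ge0// ?divr_ge0 ?invr_ge0 ?mulr_ge0// ltW.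
  apply: le_trans (qab x) _.
  have -> : a x * b x = 4 * (t / 2 * a x) * ((2 * t)^-1 * b x) by field; rewrite gt_eqF.
  set p := t / 2 * a x; set r := (2 * t)^-1 * b x.
  by have := sqr_ge0 (p - r); rewrite !expr2; lra.
have Q0 : (0 <= \int[mu]_x (q x)%:E)%E by apply: integral_ge0 => x _; rewrite lee_fin.
rewrite expe2; apply: le_trans (lee_pmul Q0 Q0 le1 le1) _.
rewrite -!EFinM lee_fin.
have -> : (2 * t)^-1 * B = t / 2 * A.
  have -> : B = t ^+ 2 * A by rewrite t2 divfK// gt_eqF.
  by field; rewrite gt_eqF.
rewrite -mulrDl -splitr mulrACA -expr2 t2 mulrA divfK ?gt_eqF//.
by rewrite mulrC.
Qed.

Section laplace_inequalities.
Context {R : realType} {d : nat} (c : R).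
Hypothesis c0 : 0 < c.
Implicit Types (N k : 'rV[R]_d -> R) (x y h w : 'rV[R]_d).

Lemma dot_shift x y h w : dot (x + w) (y + h) + dot (x - w) (y - h) = 2 * dot x y + 2 * dot w h.
Proof. by rewrite !(dotDl, dotDr, dotNl, dotNr); ring. Qed.

Lemma sqnormZ (a : R) x : sqnorm (a *: x) = a ^+ 2 * sqnorm x.
Proof. by rewrite !sqnormE dotZl dotZr mulrA expr2. Qed.

Lemma sqnorm_comb (a b : R) x y : sqnorm (a *: x - b *: y) =
  a ^+ 2 * sqnorm x - 2 * a * b * dot x y + b ^+ 2 * sqnorm y.
Proof. by rewrite !sqnormE !(dotBl, dotBr, dotZl, dotZr) (dotC y x); ring. Qed.

(** Prekopa-Leindler for the tilts at [x + h] and [x - h] against a multiple of the tilt at [x]. The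
    exponents differ by [c <h, y1 - y2>], and the log-concavity of [N] offers
    [kappa / 4 |y1 - y2|^2] to absorb it; the best constant that remains is [c^2 / kappa |h|^2].
    Since [H] occurs squared, the multiple is the square root [k] of [K]. *)
Lemma laplace_smooth N (kappa : R) : 0 < kappa ->
  measurable_fun setT N -> (forall y, 0 <= N y) ->
  (forall y1 y2, N y1 * N y2 * expR (kappa / 4 * sqnorm (y1 - y2)) <= N (2^-1 *: (y1 + y2)) ^+ 2) ->
  forall x h, (laplace (lebesgue_rV d) N c (x + h)%R * laplace (lebesgue_rV d) N c (x - h)%R <=
    laplace (lebesgue_rV d) N c x ^+ 2 * (expR (c ^+ 2 / kappa * sqnorm h))%:E)%E.
Proof.
move=> kappa0 mN N0 NN x h.
set K := expR (c ^+ 2 / kappa * sqnorm h).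
pose k := expR (c ^+ 2 / kappa * sqnorm h / 2).
have kK : k ^+ 2 = K by rewrite -expRM_natr divfK// pnatr_eq0.
have mt z : measurable_fun setT (fun y => (tilt N c z y)%:E) by apply/measurable_EFinP; exact: measurable_tilt.
have t0 z y : (0 <= (tilt N c z y)%:E)%E by rewrite lee_fin tilt_ge0.
have -> : (laplace (lebesgue_rV d) N c x ^+ 2 * K%:E)%E =
    ((\int[lebesgue_rV d]_y (k%:E * (tilt N c x y)%:E)) ^+ 2)%E.
  rewrite ge0_integralZl_EFin//; last exact: expR_ge0.
  by rewrite !expe2 muleACA -EFinM -expr2 kK muleC.
apply: prekopa_leindler => //.
- exact: emeasurable_funM.
- by move=> y; rewrite mule_ge0// lee_fin expR_ge0.
move=> y1 y2; rewrite expe2 -!EFinM lee_fin -expr2 /tilt.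
set y := 2^-1 *: (y1 + y2); set D := sqnorm (y1 - y2).
have -> : N y1 * expR (c * dot (x + h) y1) * (N y2 * expR (c * dot (x - h) y2)) =
    N y1 * N y2 * expR (kappa / 4 * D) *
    expR (2 * c * dot x y + c * dot h (y1 - y2) - kappa / 4 * D).
  rewrite mulrACA -expRD -[RHS]mulrA -expRD; congr (_ * expR _).
  by rewrite /y dotZr !(dotDl, dotDr, dotNl, dotNr); field.
have -> : (k * (N y * expR (c * dot x y))) ^+ 2 =
    N y ^+ 2 * expR (2 * c * dot x y + c ^+ 2 / kappa * sqnorm h).
  rewrite exprMn kK exprMn -expRM_natr mulrCA -expRD; congr (_ * expR _).
  by rewrite /K; ring.
apply: ler_pM => //; first by rewrite !mulr_ge0// expR_ge0.
rewrite ler_expR -addrA lerD2l.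
(* The completed square behind the bound of [c <h, y1 - y2> - kappa / 4 |y1 - y2|^2] by
   [c^2 / kappa |h|^2]. *)
have := sqnorm_ge0 (c *: h - (kappa / 2) *: (y1 - y2)).
rewrite sqnorm_comb -/D => H.
rewrite -(ler_pM2l kappa0) -subr_ge0.
have -> : kappa * (c ^+ 2 / kappa * sqnorm h) = c ^+ 2 * sqnorm h by field; rewrite gt_eqF.
by apply: le_trans H _; rewrite le_eqVlt; apply/orP; left; apply/eqP; field.
Qed.

(** The tilt at [y] is the geometric mean of the tilts at [y + w] and [y - w]. This plain convexity
    provides the first admissible constant, before any curvature is known. *)
Lemma laplace_log_convex (mu : {measure set 'rV[R]_d -> \bar R}) k y w :
  measurable_fun setT k -> (forall x, 0 <= k x) ->
  (0 < laplace mu k c (y + w)%R < +oo)%E -> (0 < laplace mu k c (y - w)%R < +oo)%E ->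
  (laplace mu k c y ^+ 2 <= laplace mu k c (y + w)%R * laplace mu k c (y - w)%R)%E.
Proof.
move=> mk k0 h1 h2.
have mt z : measurable_fun setT (tilt k c z) by exact: measurable_tilt.
have t0 z x : 0 <= tilt k c z x by exact: tilt_ge0.
refine (integral_cauchy_schwarz (mt _) (mt _) (mt _) (t0 _) (t0 _) (t0 _) _ h1 h2).
move=> x; rewrite /tilt le_eqVlt; apply/orP; left; apply/eqP.
rewrite exprMn [RHS]mulrACA -expr2 -expRD -expRM_natr; congr (_ * expR _).
by rewrite dotDl dotBl; ring.
Qed.

Lemma laplace_strong k (K : R) y w : 0 < K ->
  measurable_fun setT k -> (forall x, 0 <= k x) ->
  (forall x h, k x ^+ 2 * expR (- (K * sqnorm h)) <= k (x + h) * k (x - h)) ->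
  (0 < laplace (lebesgue_rV d) k c (y + w)%R < +oo)%E ->
  (0 < laplace (lebesgue_rV d) k c (y - w)%R < +oo)%E ->
  (laplace (lebesgue_rV d) k c y ^+ 2 * (expR (c ^+ 2 / K * sqnorm w))%:E <=
   laplace (lebesgue_rV d) k c (y + w)%R * laplace (lebesgue_rV d) k c (y - w)%R)%E.
Proof.
move=> K0 mk k0 kk.
(* Translating the two integrals by [h] and [- h] gains [2 c <w, h>] in the exponent and costs
   [K |h|^2]. This [h] maximizes the difference, whose maximum is [c^2 / K |w|^2]. *)
pose h := (c / K) *: w.
have shift z g : laplace (lebesgue_rV d) k c z = (\int[lebesgue_rV d]_x (tilt k c z (1 *: x + g))%:E)%E.
  apply/esym; apply: (@integral_rV_affine R d 1 g (fun x => (tilt k c z x)%:E)).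
  - by rewrite expr1n.
  - by apply/measurable_EFinP; exact: measurable_tilt.
  - by move=> x; rewrite lee_fin tilt_ge0.
rewrite (shift (y + w) h) (shift (y - w) (- h)) => h1 h2.
pose C := expR (c ^+ 2 / K * sqnorm w / 2).
have C2 : C ^+ 2 = expR (c ^+ 2 / K * sqnorm w) by rewrite -expRM_natr divfK// pnatr_eq0.
rewrite -C2 expe2 EFinM muleACA -expe2.
rewrite [X in (X ^+ 2)%E](_ : _ = \int[lebesgue_rV d]_x (tilt k c y x * C)%:E)%E; last first.
  rewrite muleC -ge0_integralZl_EFin//.
  - by apply: eq_integral => x _; rewrite -EFinM mulrC.
  - by move=> x _; rewrite lee_fin tilt_ge0.
  - by apply/measurable_EFinP; exact: measurable_tilt.
  - exact: expR_ge0.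
have mtg z g : measurable_fun setT (fun x => tilt k c z (1 *: x + g)).
  apply: (measurableT_comp (measurable_tilt c mk z)).
  apply: measurable_rVP => i.
  rewrite (_ : (fun x => _) = (fun x : 'rV_d => x 0 i + g 0 i)).
    by apply: measurable_funD => //; exact: measurable_coord.
  by apply/funext => x; rewrite !mxE mul1r.
have mq : measurable_fun setT (fun x => tilt k c y x * C).
  by apply: measurable_funM => //; exact: measurable_tilt.
have t0 z x : 0 <= tilt k c z x by exact: tilt_ge0.
have q0 x : 0 <= tilt k c y x * C by rewrite mulr_ge0 ?expR_ge0.
refine (integral_cauchy_schwarz (mtg _ h) (mtg _ (- h)) mq (fun x => t0 _ _) (fun x => t0 _ _) q0 _ h1 h2).
clear h1 h2.
move=> x; rewrite !scale1r /tilt.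
rewrite exprMn C2 exprMn [leRHS]mulrACA -expRD -mulrDr.
rewrite (dotC _ (x + h)) (dotC _ (x - h)) dot_shift.
apply: (@le_trans _ _ (k x ^+ 2 * expR (- (K * sqnorm h)) * expR (c * (2 * dot x y + 2 * dot h w)))).
  rewrite -[leLHS]mulrA -[leRHS]mulrA; apply: ler_wpM2l; first exact: sqr_ge0.
  rewrite -expRM_natr -!expRD ler_expR.
  rewrite /h sqnormZ dotZl -sqnormE (dotC y x) le_eqVlt; apply/orP; left; apply/eqP.
  by field; rewrite gt_eqF.
by rewrite ler_wpM2r ?expR_ge0.
Qed.

End laplace_inequalities.

(** * From integrals against a measure to integrals against its density *)

Section potential.
Context {R : realType} {d : nat} (mu : probability 'rV[R]_d R) (U : 'rV[R]_d -> \bar R).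
Hypotheses (potU : has_potential mu U) (csupp : @convex_set R 'rV[R]_d (supp mu)).
Hypothesis Ufin : forall x, (supp mu)° x -> U x \is a fin_num.

(** Outside the interior of the support [U] may be [+oo], where [fine] returns 0 and the exponential
    would be 1 instead of 0. The indicator removes this region, which carries no mass. *)
Definition weight (k : 'rV[R]_d -> R) x : R :=
  \1_((supp mu)°) x * (k x * expR (- fine (U x))).

Lemma weight_ge0 (k : 'rV[R]_d -> R) x : (forall x, 0 <= k x) -> 0 <= weight k x.
Proof. by move=> k0; rewrite !mulr_ge0 ?expR_ge0. Qed.

Let mI : measurable (supp mu)°.
Proof. by apply: open_measurable_rV; exact: open_interior. Qed.

Lemma measurable_weight (k : 'rV[R]_d -> R) : measurable_fun setT k -> measurable_fun setT (weight k).
Proof.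
move=> mk; have [mU _ _] := potU.
apply: measurable_funM; first exact: measurable_indic.
apply: measurable_funM => //; apply: (measurableT_comp (@measurable_expR R)).
apply: (measurableT_comp (@oppr_measurable R setT)).
exact: (measurableT_comp (fine_measurable measurableT)).
Qed.

Lemma laplace_weight (k : 'rV[R]_d -> R) (c : R) x : measurable_fun setT k -> (forall x, 0 <= k x) ->
  laplace mu k c x = laplace (lebesgue_rV d) (weight k) c x.
Proof.
move=> mk k0; have mt := measurable_tilt c mk x.
have t0 y : (0 <= (tilt k c x y)%:E)%E by rewrite lee_fin tilt_ge0.
transitivity (\int[mu]_y ((\1_((supp mu)°) y * tilt k c x y)%:E))%E.
  apply: ge0_ae_eq_integral => //.
  - exact/measurable_EFinP.
  - by apply/measurable_EFinP; apply: measurable_funM => //; exact: measurable_indic.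
  - by move=> y _; rewrite lee_fin mulr_ge0 ?tilt_ge0.
  exists (~` (supp mu)°); split; first exact: measurableC.
    exact: supp_interiorC0 potU csupp.
  move=> y /= h Iy; apply: h => _; rewrite indicE mem_set// mul1r//.
rewrite (integral_has_potential potU); first last.
- by move=> y; rewrite lee_fin mulr_ge0 ?tilt_ge0.
- by apply/measurable_EFinP; apply: measurable_funM => //; exact: measurable_indic.
apply: eq_integral => y _; rewrite /tilt /weight indicE.
have [Iy|nIy] := pselect ((supp mu)° y); last by rewrite memNset// !mul0r mul0e.
rewrite mem_set//.
have [r Ur] : exists r, U y = r%:E.
  by exists (fine (U y)); rewrite fineK//; exact: Ufin.
by rewrite Ur /= -EFinM; congr EFin; ring.
Qed.

End potential.

(** The exponential at a midpoint is at most the sum of the exponentials at the ends, so the domain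
    of finiteness is stable under midpoints. It has full Lebesgue measure in the interior of the
    support because the density of [nu] is positive there, and [sub_midpoint_closed] fills in the
    missing points. *)
Lemma sub_laplace_dom {R : realType} {d : nat} (mu nu : probability 'rV[R]_d R)
    (U : 'rV[R]_d -> \bar R) (k : 'rV[R]_d -> R) (c : R) :
  has_potential nu U -> (forall x, (supp nu)° x -> 0 < expeR (- U x))%E ->
  measurable_fun setT k -> (forall x, 0 <= k x) ->
  measurable [set x | laplace mu k c x = +oo%E] ->
  nu [set x | laplace mu k c x = +oo%E] = 0%E ->
  forall x, (supp nu)° x -> (laplace mu k c x < +oo)%E.
Proof.
move=> potU Upos mk k0 mD D0.
have : (supp nu)° `<=` [set x | (laplace mu k c x < +oo)%E].
  have DE : [set x | (laplace mu k c x < +oo)%E] = ~` [set x | laplace mu k c x = +oo%E].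
    by apply/seteqP; split=> x /=; rewrite ltey => /eqP.
  apply: sub_midpoint_closed.
  - exact: open_interior.
  - by rewrite DE; exact: measurableC.
  - move=> x y /= xfin yfin.
    apply: (@le_lt_trans _ _ (laplace mu k c x + laplace mu k c y)%E); last first.
      by rewrite lte_add_pinfty.
    have mt z : measurable_fun setT (EFin \o tilt k c z).
      by apply/measurable_EFinP; exact: measurable_tilt.
    rewrite -ge0_integralD//; first last.
    - exact: mt.
    - by move=> z _; rewrite lee_fin tilt_ge0.
    - exact: mt.
    - by move=> z _; rewrite lee_fin tilt_ge0.
    apply: ge0_le_integral => //.
    - by move=> z _; rewrite lee_fin tilt_ge0.
    - exact: mt.
    - by apply: emeasurable_funD; exact: mt.
    move=> z _; rewrite -EFinD lee_fin /tilt -mulrDr ler_wpM2l// dotZl dotDl.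
    set a := dot x z; set b := dot y z.
    have [ab|ab] := leP (c * a) (c * b).
      by rewrite ler_wpDl ?expR_ge0// ler_expR; lra.
    by rewrite ler_wpDr ?expR_ge0// ler_expR; lra.
  - rewrite DE setDE setCK setIC.
    exact: (potential_null potU mD D0 Upos).
by move=> sub x /sub.
Qed.

(** * The Schrodinger system *)

Section fixed_point.
Context {R : rcfType} (alpha beta eps : R).
Hypotheses (a0 : 0 < alpha) (b0 : 0 < beta) (e0 : 0 < eps).

Let D := 4 * beta / alpha + eps ^+ 2 * beta ^+ 2.
Let Lstar := 2^-1 * (Num.sqrt D - eps * beta).

Let D0 : 0 < D.
Proof. by rewrite addr_gt0// ?divr_gt0 ?mulr_gt0 ?exprn_gt0. Qed.

Let sqrtD2 : Num.sqrt D ^+ 2 = D.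
Proof. by rewrite sqr_sqrtr// ltW. Qed.

Lemma fixed_point_ge0 : 0 <= Lstar.
Proof.
rewrite mulr_ge0// subr_ge0 -(@ler_pXn2r _ 2)// ?nnegrE ?sqrtr_ge0 ?mulr_ge0 ?ltW//.
by rewrite sqrtD2 exprMn /D ltrDr divr_gt0// mulr_gt0.
Qed.

Lemma fixed_point_eq : Lstar * (Lstar + eps * beta) = beta / alpha.
Proof.
have -> : Lstar * (Lstar + eps * beta) = 4^-1 * (Num.sqrt D ^+ 2 - eps ^+ 2 * beta ^+ 2).
  by rewrite /Lstar; field.
by rewrite sqrtD2 /D; field; rewrite gt_eqF.
Qed.

(** Multiplying out, the terms [c^2 L] cancel and leave [alpha L (c L + beta) <= c beta], that is,
    [L (L + eps beta) <= beta / alpha]. Completing the square bounds [2 L + eps beta] by the square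
    root of [D]. *)
Lemma le_fixed_point L : 0 <= L ->
  L <= eps^-1 / (eps^-1 * (eps^-1 / (eps^-1 * L + beta)) + alpha) -> L <= Lstar.
Proof.
move=> L0; set c := eps^-1; have c0 : 0 < c by rewrite invr_gt0.
have K0 : 0 < c * L + beta by rewrite ltr_wpDl// mulr_ge0// ltW.
have den0 : 0 < c * (c / (c * L + beta)) + alpha.
  by rewrite addr_gt0// mulr_gt0// divr_gt0.
rewrite ler_pdivlMr// => H.
have {}H : L * (c * (c / (c * L + beta)) + alpha) * (c * L + beta) <= c * (c * L + beta).
  by rewrite ler_pM2r.
have E : L * (c * (c / (c * L + beta)) + alpha) * (c * L + beta) =
    L * c ^+ 2 + alpha * L * (c * L + beta) by field; rewrite gt_eqF.
have {H E} H : alpha * L * (c * L + beta) <= c * beta.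
  by move: H; rewrite E mulrDr; lra.
have {}H : L * (L + eps * beta) <= beta / alpha.
  rewrite ler_pdivlMr//.
  have : eps * (alpha * L * (c * L + beta)) <= eps * (c * beta) by rewrite ler_pM2l.
  rewrite (_ : eps * (c * beta) = beta); last by rewrite /c; field; rewrite gt_eqF.
  rewrite (_ : eps * _ = L * (L + eps * beta) * alpha)//.
  by rewrite /c; field; rewrite gt_eqF.
have h : 2 * L + eps * beta <= Num.sqrt D.
  have nn : 0 <= 2 * L + eps * beta by rewrite addr_ge0 ?mulr_ge0// ltW.
  rewrite -(@ler_pXn2r _ 2)// ?nnegrE ?sqrtr_ge0//.
  rewrite sqrtD2 /D -mulrA.
  have -> : (2 * L + eps * beta) ^+ 2 = 4 * (L * (L + eps * beta)) + eps ^+ 2 * beta ^+ 2 by ring.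
  by rewrite lerD2r ler_pM2l.
by rewrite /Lstar; lra.
Qed.

(** The left-hand side is the inverse of [Lstar + eps beta], which equals [(alpha / beta) Lstar] by
    [fixed_point_eq]; the factor [alpha / beta] then moves inside the square root and exchanges the
    two constants. *)
Lemma dual_fixed_point : eps^-1 / (eps^-1 * Lstar + beta) =
  2^-1 * (Num.sqrt (4 * alpha / beta + eps ^+ 2 * alpha ^+ 2) - eps * alpha).
Proof.
have -> : Num.sqrt (4 * alpha / beta + eps ^+ 2 * alpha ^+ 2) = alpha / beta * Num.sqrt D.
  have -> : 4 * alpha / beta + eps ^+ 2 * alpha ^+ 2 = (alpha / beta) ^+ 2 * D.
    by rewrite /D; field; rewrite !gt_eqF.
  by rewrite sqrtrM ?sqr_ge0// sqrtr_sqr ger0_norm// divr_ge0// ltW.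
have K0 : 0 < Lstar + eps * beta.
  by rewrite ltr_wpDl ?fixed_point_ge0// mulr_gt0.
have -> : eps^-1 / (eps^-1 * Lstar + beta) = (Lstar + eps * beta)^-1.
  have e1 : eps != 0 by rewrite gt_eqF.
  have -> : eps^-1 * Lstar + beta = eps^-1 * (Lstar + eps * beta) by field.
  by rewrite invfM invrK mulrA mulVf// mul1r.
have Ln : Lstar + eps * beta != 0 by rewrite gt_eqF.
apply: (mulIf Ln); rewrite mulVf//.
have -> : 2^-1 * (alpha / beta * Num.sqrt D - eps * alpha) = alpha / beta * Lstar.
  by rewrite /Lstar; field; rewrite gt_eqF.
by rewrite -[RHS]mulrA fixed_point_eq; field; rewrite !gt_eqF.
Qed.

End fixed_point.

(** For [s > 0] the inequality reads [ln (a / q) / s <= L], a closed condition on [L]. This is why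
    the smallest smoothness constant is attained. *)
Lemma le_mul_expR_inf {R : realType} (a q s : R) (S : set R) : 0 < a -> 0 < q -> 0 <= s ->
  S !=set0 -> (forall L, S L -> a <= q * expR (L * s)) -> a <= q * expR (inf S * s).
Proof.
move=> a0 q0 s0 S0 Sa; have [L SL] := S0.
move: s0; rewrite le_eqVlt => /predU1P[s0|s0].
  by have := Sa L SL; rewrite -s0 !mulr0.
pose t := ln (a / q); have aE : expR t = a / q by rewrite lnK// posrE divr_gt0.
have key M : (a <= q * expR (M * s)) = (t / s <= M).
  by rewrite mulrC -ler_pdivrMr// -aE ler_expR ler_pdivrMr.
by rewrite key; apply: lb_le_inf => // M SM; rewrite -key; exact: Sa.
Qed.

Lemma fine_sqr_leM {R : realType} (x y z : \bar R) (k : R) :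
  x \is a fin_num -> y \is a fin_num -> z \is a fin_num ->
  (x ^+ 2 * k%:E <= y * z)%E -> fine x ^+ 2 * k <= fine y * fine z.
Proof. by case: x y z => [x| |] [y| |] [z| |]//= _ _ _; rewrite expe2 -!EFinM lee_fin expr2. Qed.

Lemma fine_mul_leX {R : realType} (x y z : \bar R) (k : R) :
  x \is a fin_num -> y \is a fin_num -> z \is a fin_num ->
  (y * z <= x ^+ 2 * k%:E)%E -> fine y * fine z <= fine x ^+ 2 * k.
Proof. by case: x y z => [x| |] [y| |] [z| |]//= _ _ _; rewrite expe2 -!EFinM lee_fin expr2. Qed.

Lemma invr_mulM_le_sqr {R : realFieldType} (p p1 p2 e : R) : 0 < p -> 0 < p1 -> 0 < p2 ->
  p ^+ 2 * e <= p1 * p2 -> p1^-1 * p2^-1 * e <= p^-1 ^+ 2.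
Proof.
move=> p0 p10 p20 H; rewrite -invfM exprVn.
by rewrite mulrC ler_pdivrMr ?mulr_gt0// [leRHS]mulrC ler_pdivlMr ?exprn_gt0// mulrC.
Qed.

Lemma invr_sqrM_le_mul {R : realFieldType} (p p1 p2 e : R) : 0 < p -> 0 < p1 -> 0 < p2 -> 0 < e ->
  p1 * p2 <= p ^+ 2 * e -> p^-1 ^+ 2 * e^-1 <= p1^-1 * p2^-1.
Proof.
by move=> p0 p10 p20 e0 H; rewrite exprVn -!invfM lef_pV2// posrE mulr_gt0// exprn_gt0.
Qed.

Lemma interior_rV_convex {R : realType} d (K : set 'rV[R]_d) : rV_convex K -> rV_convex K°.
Proof.
move=> cK y1 y2 t t01 /nbhs_ballP[e1 /= e10 s1] /nbhs_ballP[e2 /= e20 s2]; apply/nbhs_ballP.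
have em0 : 0 < Num.min e1 e2 by rewrite lt_min e10.
exists (Num.min e1 e2) => // z /(ball_rVP _ _ em0) bz.
pose r := z - (t *: y1 + (1 - t) *: y2).
have rlt i : `|r 0 i| < e1 /\ `|r 0 i| < e2.
  by have := bz i; rewrite distrC lt_min => /andP[h1 h2]; rewrite !mxE in h1 h2 *.
have -> : z = t *: (y1 + r) + (1 - t) *: (y2 + r).
  by apply/rowP => i; rewrite !mxE; ring.
apply: cK => //.
- by apply: s1; apply/ball_rVP => // i; rewrite mxE opprD addrA subrr add0r normrN; have [] := rlt i.
- by apply: s2; apply/ball_rVP => // i; rewrite mxE opprD addrA subrr add0r normrN; have [] := rlt i.
Qed.

Section schrodinger_system.
Context {R : realType} {d : nat} (P Q : probability 'rV[R]_d R).
Variables (V W : 'rV[R]_d -> \bar R) (F G : 'rV[R]_d -> R) (eps : R).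
Local Notation c := (eps^-1).
Hypotheses (potP : has_potential P V) (potQ : has_potential Q W).
Hypothesis regPQ : regular P Q V W.
Hypotheses (e0 : 0 < eps) (mF : measurable_fun setT F) (mG : measurable_fun setT G).
Hypotheses (F0 : forall x, 0 <= F x) (G0 : forall y, 0 <= G y).
(* Where a Laplace transform is +oo, the junk value (fine +oo)^-1 = 0 is the right one. *)
Hypotheses (FE : forall x, F x = (fine (laplace Q G c x))^-1)
  (GE : forall y, G y = (fine (laplace P F c y))^-1).
Hypotheses (Qpos : forall x, (0 < laplace Q G c x)%E)
  (Ppos : forall y, (0 < laplace P F c y)%E).
Hypotheses (F_ae : P [set x | F x = 0] = 0%E) (G_ae : Q [set y | G y = 0] = 0%E).

Local Notation Omega := ((supp Q)°).
Local Notation Phi := (laplace Q G c).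
Local Notation Psi := (laplace P F c).

Let c0 : 0 < c. Proof. by rewrite invr_gt0. Qed.

Let suppP : (supp P)° = setT.
Proof. by rewrite (regular_full_support regPQ) interiorT. Qed.

Let csuppP : @convex_set R 'rV[R]_d (supp P).
Proof. by rewrite (regular_full_support regPQ) => x y t _ _; rewrite inE. Qed.

Let csuppQ := regular_convex_support regPQ.

Let Vfin x : V x \is a fin_num.
Proof. by have [[/nbhs_singleton]] := (regular_C2_l regPQ (I : setT x)). Qed.

Let Wfin y : Omega y -> W y \is a fin_num.
Proof. by move=> /(regular_C2_r regPQ) [[/nbhs_singleton]]. Qed.

Let inv_fine_eq0 (t : \bar R) : (0 < t)%E -> (fine t)^-1 = 0 -> t = +oo%E.
Proof.
case: t => //= r; rewrite lte_fin => r0 /eqP.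
by rewrite invr_eq0 gt_eqF.
Qed.

Let measurable_zero (h : 'rV[R]_d -> R) : measurable_fun setT h -> measurable [set x | h x = 0].
Proof. by move=> mh; rewrite -[X in measurable X]setTI; exact: (mh measurableT [set 0]). Qed.

(** Since [F] is the inverse of [Phi], with value 0 where [Phi] is infinite, the set of infinite
    values is the zero set of [F], which is [P]-null. As [P] has full support, [sub_laplace_dom]
    reaches every point. *)
Lemma Phi_fin x : (Phi x < +oo)%E.
Proof.
have E : [set x | Phi x = +oo%E] = [set x | F x = 0].
  apply/seteqP; split=> z /=; rewrite FE; first by move=> ->; rewrite invr0.
  exact: inv_fine_eq0.
apply: (@sub_laplace_dom R d Q P V) => //.
- by move=> z _; exact: (regular_positive_l regPQ).
- by rewrite E; exact: measurable_zero.
- by rewrite E.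
- by rewrite suppP.
Qed.

Lemma Psi_fin y : Omega y -> (Psi y < +oo)%E.
Proof.
have E : [set x | Psi x = +oo%E] = [set x | G x = 0].
  apply/seteqP; split=> z /=; rewrite GE; first by move=> ->; rewrite invr0.
  exact: inv_fine_eq0.
apply: (@sub_laplace_dom R d P Q W) => //.
- by move=> z; exact: (regular_positive_r regPQ).
- by rewrite E; exact: measurable_zero.
- by rewrite E.
Qed.

Lemma Phi_fin_num x : Phi x \is a fin_num.
Proof. by rewrite ge0_fin_numE ?laplace_ge0// Phi_fin. Qed.

Lemma Psi_fin_num y : Omega y -> Psi y \is a fin_num.
Proof. by move=> Oy; rewrite ge0_fin_numE ?laplace_ge0// Psi_fin. Qed.

Lemma fine_Phi_gt0 x : 0 < fine (Phi x).
Proof. by rewrite fine_gt0// Qpos Phi_fin. Qed.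

Lemma fine_Psi_gt0 y : Omega y -> 0 < fine (Psi y).
Proof. by move=> Oy; rewrite fine_gt0// Ppos Psi_fin. Qed.

Variables (alpha beta : R).
Hypotheses (a0 : 0 < alpha) (b0 : 0 < beta).
Hypothesis Vsmooth : forall x h,
  fine (V (x + h)) + fine (V (x - h)) - 2 * fine (V x) <= beta * sqnorm h.
Hypothesis Wconvex : forall y h, Omega (y + h) -> Omega (y - h) ->
  alpha * sqnorm h <= fine (W (y + h)) + fine (W (y - h)) - 2 * fine (W y).

(** Exponentiated form of [phi (x + h) + phi (x - h) - 2 phi x <= L |h|^2], with
    [phi = eps ln Phi]. *)
Definition Phi_smooth (L : R) := forall x h,
  fine (Phi (x + h)) * fine (Phi (x - h)) <= fine (Phi x) ^+ 2 * expR (c * L * sqnorm h).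

(** Exponentiated form of [psi (y + h) + psi (y - h) - 2 psi y >= m |h|^2]. It is confined to
    [Omega] because [Psi] may be [+oo] elsewhere, where [fine] is meaningless. *)
Definition Psi_convex (m : R) := forall y h, Omega (y + h) -> Omega (y - h) ->
  fine (Psi y) ^+ 2 * expR (c * m * sqnorm h) <= fine (Psi (y + h)) * fine (Psi (y - h)).

Let Omega_mid y1 y2 : Omega y1 -> Omega y2 -> Omega (2^-1 *: (y1 + y2)).
Proof.
move=> h1 h2; have half : (0 <= (2^-1 : R)) && ((2^-1 : R) <= 1) by apply/andP; split; lra.
have := interior_rV_convex (convex_set_rV_convex csuppQ) half h1 h2.
by rewrite (_ : 1 - 2^-1 = 2^-1 :> R) ?scalerDr//; lra.
Qed.

Let mid_shift (y h : 'rV[R]_d) : 2^-1 *: ((y + h) + (y - h)) = y.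
Proof. by apply/rowP => i; rewrite !mxE; field. Qed.

Lemma Omega_midr y h : Omega (y + h) -> Omega (y - h) -> Omega y.
Proof. by move=> h1 h2; rewrite -(mid_shift y h); exact: Omega_mid. Qed.

Lemma Psi_convex0 : Psi_convex 0.
Proof.
move=> y h O1 O2; rewrite mulr0 mul0r expR0.
apply: fine_sqr_leM; try exact: Psi_fin_num.
  by apply: Psi_fin_num; exact: (Omega_midr O1 O2).
rewrite mule1; apply: laplace_log_convex => //; apply/andP; split => //; exact: Psi_fin.
Qed.

Lemma Phi_smooth_of_Psi_convex m : 0 <= m -> Psi_convex m ->
  Phi_smooth (c / (c * m + alpha)).
Proof.
move=> m0 Pm x h.
set kappa := c * m + alpha.
have k0 : 0 < kappa by rewrite ltr_wpDl// mulr_ge0// ltW.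
apply: fine_mul_leX; try exact: Phi_fin_num.
rewrite !(laplace_weight potQ csuppQ Wfin c _ mG G0).
rewrite (_ : c * (c / kappa) = c ^+ 2 / kappa); last by rewrite expr2 mulrA.
apply: laplace_smooth => //.
- exact: (measurable_weight potQ mG).
- by move=> y; exact: weight_ge0.
move=> y1 y2; rewrite /weight.
have [ O1|nO1] := pselect (Omega y1); last first.
  by rewrite [in leLHS]indicE memNset// !mul0r sqr_ge0.
have [ O2|nO2] := pselect (Omega y2); last first.
  by rewrite [\1_(_) y2]indicE memNset// mul0r mulr0 mul0r sqr_ge0.
have Om := Omega_mid O1 O2.
rewrite !indicE !mem_set// !mul1r.
pose y := 2^-1 *: (y1 + y2); pose h' := 2^-1 *: (y1 - y2).
have y1E : y1 = y + h' by apply/rowP => i; rewrite !mxE; field.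
have y2E : y2 = y - h' by apply/rowP => i; rewrite !mxE; field.
have dE : kappa / 4 * sqnorm (y1 - y2) = kappa * sqnorm h'.
  by rewrite /h' sqnormZ; field.
rewrite -/y dE.
have O1' := O1; have O2' := O2; rewrite y1E in O1'; rewrite y2E in O2'.
(* Inversion turns the convexity of [psi] into strong log-concavity of [G], which adds up with the
   convexity of [W] to the modulus [kappa = c m + alpha]. *)
have Gm : G y1 * G y2 * expR (c * m * sqnorm h') <= G y ^+ 2.
  have := Pm y h' O1' O2'; rewrite !GE -y1E -y2E.
  exact: invr_mulM_le_sqr (fine_Psi_gt0 Om) (fine_Psi_gt0 O1) (fine_Psi_gt0 O2).
have Wm := Wconvex O1' O2'; rewrite -y1E -y2E in Wm.
rewrite exprMn -expRM_natr.
have -> : G y1 * expR (- fine (W y1)) * (G y2 * expR (- fine (W y2))) * expR (kappa * sqnorm h')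
   = G y1 * G y2 * expR (c * m * sqnorm h') *
     expR (alpha * sqnorm h' - fine (W y1) - fine (W y2)).
  rewrite mulrACA -!mulrA -!expRD; congr (_ * (_ * expR _)); rewrite /kappa; ring.
apply: ler_pM => //; first by rewrite !mulr_ge0 ?expR_ge0.
by rewrite ler_expR; lra.
Qed.

(** The lower bound on the integrand at [x + h] and [x - h] must hold for all [x] and [h]. Full
    support of [P] makes this possible: the indicator in [weight] is identically 1. *)
Lemma Psi_convex_of_Phi_smooth L : 0 <= L -> Phi_smooth L ->
  Psi_convex (c / (c * L + beta)).
Proof.
move=> L0 PL y w O1 O2.
set K := c * L + beta.
have K0 : 0 < K by rewrite ltr_wpDl// mulr_ge0// ltW.
have P1 : (0 < Psi (y + w) < +oo)%E by rewrite Ppos Psi_fin.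
have P2 : (0 < Psi (y - w) < +oo)%E by rewrite Ppos Psi_fin.
apply: fine_sqr_leM; [exact: (Psi_fin_num (Omega_midr O1 O2))|exact: Psi_fin_num|exact: Psi_fin_num|].
have Vfin' x : (supp P)° x -> V x \is a fin_num by [].
rewrite !(laplace_weight potP csuppP Vfin' c _ mF F0) in P1 P2 *.
rewrite (_ : c * (c / K) = c ^+ 2 / K); last by rewrite expr2 mulrA.
have mk := measurable_weight potP mF.
have k0 x : 0 <= weight P V F x by exact: weight_ge0.
refine (laplace_strong K0 mk k0 _ P1 P2).
clear P1 P2 => x h; rewrite /weight suppP !indicT !mul1r.
have Fm : F x ^+ 2 * expR (- (c * L * sqnorm h)) <= F (x + h) * F (x - h).
  have := PL x h; rewrite !FE.
  rewrite expRN; apply: invr_sqrM_le_mul (expR_gt0 _); exact: fine_Phi_gt0.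
have Vm := Vsmooth x h.
rewrite exprMn -expRM_natr.
have -> : F x ^+ 2 * expR (- fine (V x) * 2%:R) * expR (- (K * sqnorm h)) =
    F x ^+ 2 * expR (- (c * L * sqnorm h)) * expR (- (beta * sqnorm h) - 2 * fine (V x)).
  by rewrite -[LHS]mulrA -[RHS]mulrA -!expRD; congr (_ * expR _); rewrite /K; ring.
rewrite [leRHS]mulrACA -expRD.
apply: ler_pM => //; first by rewrite mulr_ge0 ?expR_ge0 ?sqr_ge0.
by rewrite ler_expR; lra.
Qed.

Let smooth_inf (S : set R) : S !=set0 -> (forall L, S L -> Phi_smooth L) ->
  Phi_smooth (inf S).
Proof.
move=> S0 Ss x h; rewrite (_ : c * _ * _ = inf S * (c * sqnorm h)); last by ring.
apply: le_mul_expR_inf => //.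
- exact: mulr_gt0 (fine_Phi_gt0 _) (fine_Phi_gt0 _).
- exact: exprn_gt0 (fine_Phi_gt0 x).
- exact: mulr_ge0 (ltW c0) (sqnorm_ge0 h).
by move=> L SL; rewrite (mulrCA L) mulrA; exact: Ss.
Qed.

Local Notation Lstar := (2^-1 * (Num.sqrt (4 * beta / alpha + eps ^+ 2 * beta ^+ 2) - eps * beta)).

(** Plain convexity of [psi] makes [c / alpha] admissible, so [S] is not empty. One passage through
    [Psi_convex_of_Phi_smooth] and [Phi_smooth_of_Psi_convex] sends [inf S] to another element of
    [S], which is therefore at least [inf S]. *)
Lemma Phi_smooth_sharp : Phi_smooth Lstar.
Proof.
pose S := [set L | 0 <= L /\ Phi_smooth L].
have lS : lbound S 0 by move=> L [].
have S0 : S !=set0.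
  exists (c / (c * 0 + alpha)); split.
    by rewrite mulr0 add0r; exact: divr_ge0 (ltW c0) (ltW a0).
  by apply: Phi_smooth_of_Psi_convex => //; exact: Psi_convex0.
have sI : Phi_smooth (inf S) by apply: smooth_inf => // L [].
have I0 : 0 <= inf S by apply: lb_le_inf.
have m0 : 0 <= c / (c * inf S + beta).
  exact: divr_ge0 (ltW c0) (addr_ge0 (mulr_ge0 (ltW c0) I0) (ltW b0)).
have Ile : inf S <= Lstar.
  apply: le_fixed_point => //; apply: ge_inf; first by exists 0.
  split; first exact: divr_ge0 (ltW c0) (addr_ge0 (mulr_ge0 (ltW c0) m0) (ltW a0)).
  by apply: Phi_smooth_of_Psi_convex => //; exact: Psi_convex_of_Phi_smooth.
move=> x h; apply: le_trans (sI x h) _; rewrite ler_wpM2l ?sqr_ge0// ler_expR.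
by rewrite ler_wpM2r ?sqnorm_ge0// ler_wpM2l// ltW.
Qed.

Lemma Psi_convex_sharp :
  Psi_convex (2^-1 * (Num.sqrt (4 * alpha / beta + eps ^+ 2 * alpha ^+ 2) - eps * alpha)).
Proof.
rewrite -dual_fixed_point//; apply: Psi_convex_of_Phi_smooth; first exact: fixed_point_ge0.
exact: Phi_smooth_sharp.
Qed.

End schrodinger_system.

(** * The entropic Brenier potentials *)

Section loewner_bounds.
Context {R : realType} {d : nat}.
Implicit Types (u : 'rV[R]_d -> R) (x v : 'rV[R]_d).

Let is_deriveNfun (p q : R -> R) t : is_derive t (1 : R) p (q t) ->
  is_derive t (1 : R) (fun t => - p t) (- q t).
Proof. by move=> dp; exact: is_deriveN. Qed.

Lemma second_difference_hessian_ge u (A : set 'rV[R]_d) x v (b : R) :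
  (forall t : R, -1 <= t <= 1 -> A (x + t *: v)) ->
  (forall y, A y -> twice_differentiable u y) ->
  (forall y, A y -> b <= hessian_form u y v) ->
  b <= u (x + v) + u (x - v) - 2 * u x.
Proof.
move=> Axv du hb.
have hb' t : -1 <= t <= 1 -> - hessian_form u (x + t *: v) v <= - b.
  by move=> t11; rewrite lerN2; exact: hb (Axv t t11).
have := @second_difference_le R (fun t => - u (x + t *: v)) _ _ (- b)
  (fun t t11 => is_deriveNfun (q := fun t => \sum_i v 0 i * partial i u (x + t *: v))
     (is_derive_line (nbhs_singleton (du _ (Axv t t11)).1)))
  (fun t t11 => is_deriveNfun (q := fun t => hessian_form u (x + t *: v) v)
     (is_derive2_line (du _ (Axv t t11)).2))
  hb'.
rewrite /= scale1r scaleN1r scale0r addr0; lra.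
Qed.

Lemma hessian_second_difference_le u x v (a e : R) : 0 < e ->
  twice_differentiable u x ->
  (forall t : R, `|t| < e -> u (x + t *: v) + u (x - t *: v) - 2 * u x <= a * t ^+ 2) ->
  hessian_form u x v <= a.
Proof.
move=> e0 [du du2] ua.
have [e1 e10 due] : exists2 e1, 0 < e1 & forall t : R, `|t| < e1 -> differentiable u (x + t *: v).
  move/nbhs_ballP: du => [r /= r0 ur].
  exists (r / (`|v| + 1)); first by rewrite divr_gt0// ltr_wpDl.
  move=> t; rewrite ltr_pdivlMr ?ltr_wpDl// => tr; apply: ur.
  rewrite -ball_normE /ball_/= opprD addrA subrr add0r normrN normrZ.
  by apply: le_lt_trans tr; rewrite ler_wpM2l// lerDl.
have d2 := @is_derive2_line _ _ u x v 0; rewrite scale0r addr0 in d2.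
rewrite -lerN2.
apply: (@second_difference_derive_ge R (fun t => - u (x + t *: v))
  (fun t => - \sum_i v 0 i * partial i u (x + t *: v)) _ _ (Num.min e e1)).
- by rewrite lt_min e0.
- move=> t; rewrite lt_min => /andP[_ te1].
  exact: (is_deriveNfun (q := fun t => \sum_i v 0 i * partial i u (x + t *: v))
    (is_derive_line (due t te1))).
- exact: (is_deriveNfun (q := fun=> hessian_form u x v) (d2 du2)).
- move=> t; rewrite lt_min => /andP[te _]; have := ua t te.
  by rewrite scaleNr scale0r addr0; lra.
Qed.

Lemma form_scalar (a : R) v : (v *m a%:M *m v^T) 0 0 = a * sqnorm v.
Proof.
rewrite mul_mx_scalar -scalemxAl mxE; congr (_ * _); rewrite mxE.
by apply: eq_bigr => i _; rewrite mxE expr2.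
Qed.

Lemma loewner_form_le u x (b : R) v : loewner (hessian u x) b%:M ->
  hessian_form u x v <= b * sqnorm v.
Proof. by move=> [_ /(_ v)]; rewrite mulmxBr mulmxBl mxE form_scalar mxE subr_ge0. Qed.

Lemma loewner_form_ge u x (b : R) v : loewner b%:M (hessian u x) ->
  b * sqnorm v <= hessian_form u x v.
Proof.
move=> [_ /(_ v)]; rewrite mulmxBr mulmxBl mxE [X in _ + X]mxE form_scalar subr_ge0.
exact.
Qed.

Lemma form_le_loewner u x (b : R) : (hessian u x)^T = hessian u x ->
  (forall v, hessian_form u x v <= b * sqnorm v) -> loewner (hessian u x) b%:M.
Proof.
move=> sym H; split; first by rewrite linearB/= tr_scalar_mx sym.
by move=> v; rewrite mulmxBr mulmxBl mxE form_scalar mxE subr_ge0; exact: H.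
Qed.

Lemma form_ge_loewner u x (b : R) : (hessian u x)^T = hessian u x ->
  (forall v, b * sqnorm v <= hessian_form u x v) -> loewner b%:M (hessian u x).
Proof.
move=> sym H; split; first by rewrite linearB/= tr_scalar_mx sym.
move=> v; rewrite mulmxBr mulmxBl mxE [X in _ + X]mxE form_scalar subr_ge0; exact: H.
Qed.

End loewner_bounds.

(* If V were concave, P (B + h) + P (B - h) >= 2 P B would contradict tightness. *)
Lemma potential_not_concave {R : realType} d (P : probability 'rV[R]_d.+1 R) V (beta : R) :
  has_potential P V -> supp P = setT -> (forall x, V x \is a fin_num) ->
  (forall x h, fine (V (x + h)) + fine (V (x - h)) - 2 * fine (V x) <= beta * sqnorm h) ->
  0 < beta.
Proof.
move=> potP sP Vfin Vb; rewrite ltNge; apply/negP => beta0.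
pose k x := expR (- fine (V x)).
have k0 x : 0 <= k x by exact: expR_ge0.
have mk : measurable_fun setT k.
  have [mV _ _] := potP; apply: (measurableT_comp (@measurable_expR R)).
  apply: (measurableT_comp (@oppr_measurable R setT)).
  exact: (measurableT_comp (fine_measurable measurableT)).
(* A concave [V] makes [exp (- V)] log-convex, hence midpoint convex by the arithmetic-geometric
   inequality. *)
have kk x h : 2 * k x <= k (x + h) + k (x - h).
  have Vh := Vb x h; have bs : beta * sqnorm h <= 0 by rewrite mulr_le0_ge0// sqnorm_ge0.
  rewrite /k; set a := fine (V (x + h)) in Vh *; set b := fine (V (x - h)) in Vh *.
  apply: (@le_trans _ _ (2 * expR (- (a + b) / 2))).
    by rewrite ler_pM2l// ler_expR; lra.
  have -> : expR (- a) = expR (- a / 2) ^+ 2 by rewrite -expRM_natr divfK// pnatr_eq0.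
  have -> : expR (- b) = expR (- b / 2) ^+ 2 by rewrite -expRM_natr divfK// pnatr_eq0.
  have -> : expR (- (a + b) / 2) = expR (- a / 2) * expR (- b / 2).
    by rewrite -expRD; congr expR; field.
  by have := sqr_ge0 (expR (- a / 2) - expR (- b / 2)); rewrite !expr2; lra.
pose B : set 'rV[R]_d.+1 := ball 0 1.
have mB : measurable B by apply: open_measurable_rV; exact: ball_open.
have PE A : measurable A -> P A = (\int[lebesgue_rV d.+1]_x (\1_A x * k x)%:E)%E.
  move=> mA; have [_ _ ->//] := potP; rewrite integral_mkcond; apply: eq_integral => x _.
  rewrite patchE indicE; case: ifPn => _; last by rewrite mul0r.
  by rewrite mul1r -(fineK (Vfin x)).
pose T (h : 'rV[R]_d.+1) (x : 'rV[R]_d.+1) := 1 *: x + h.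
have mT h : measurable_fun setT (T h).
  apply: measurable_rVP => i; rewrite (_ : (fun x => _) = (fun x : 'rV_d.+1 => x 0 i + h 0 i)).
    by apply: measurable_funD => //; exact: measurable_coord.
  by apply/funext => x; rewrite !mxE mul1r.
have mTB h : measurable (T h @^-1` B).
  by rewrite -[X in measurable X]setTI; exact: mT.
have PT h : P (T (- h) @^-1` B) = (\int[lebesgue_rV d.+1]_x (\1_B x * k (x + h))%:E)%E.
  rewrite (PE _ (mTB _)).
  have H := @integral_rV_affine R d.+1 1 h (fun x => (\1_(T (- h) @^-1` B) x * k x)%:E).
  rewrite -H; first last.
  - by move=> x; rewrite lee_fin mulr_ge0.
  - apply/measurable_EFinP; apply: measurable_funM => //; exact: measurable_indic.
  - by rewrite expr1n.
  apply: eq_integral => x _; rewrite scale1r; congr ((_ * _)%:E).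
  by rewrite !indicE; congr ((_ : bool)%:R); apply/idP/idP; rewrite !inE /T/= scale1r addrK.
have mBk h : measurable_fun setT (fun x => (\1_B x * k (x + h))%:E).
  apply/measurable_EFinP; apply: measurable_funM; first exact: measurable_indic.
  apply: (measurableT_comp mk); have := mT h.
  by rewrite (_ : T h = fun x => x + h)//; apply/funext => x; rewrite /T scale1r.
have le2 (h : 'rV[R]_d.+1) :
    (2%:E * P B <= P (T (- h)%R @^-1` B) + P (T (- - h)%R @^-1` B))%E.
  rewrite !PT PE// -ge0_integralZl_EFin//; first last.
  - by have := mBk 0; under eq_fun do rewrite addr0.
  - by move=> x _; rewrite lee_fin mulr_ge0.
  rewrite -ge0_integralD//; first last.
  - by move=> x _; rewrite lee_fin mulr_ge0.
  - by move=> x _; rewrite lee_fin mulr_ge0.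
  apply: ge0_le_integral => //.
  - by move=> x _; rewrite -EFinM lee_fin mulr_ge0// mulr_ge0.
  - by apply: emeasurable_funM => //; have := mBk 0; under eq_fun do rewrite addr0.
  - exact: emeasurable_funD.
  by move=> x _; rewrite -EFinM -EFinD lee_fin -mulrDr mulrCA ler_wpM2l.
have PB0 : (0 < P B)%E.
  rewrite lt0e measure_ge0 andbT; apply/eqP => PB.
  have := potential_null potP mB PB; rewrite sP interiorT setIT => H.
  have pos x : [set: 'rV[R]_d.+1] x -> (0 < expeR (- V x))%E.
    by move=> _; apply: expeR_gt0; rewrite -(fineK (Vfin x)) ltNyr.
  by have := @lebesgue_rV_ball_gt0 R d.+1 0 1 ltr01; rewrite -/B (H pos) ltxx.
(* These sets decrease to the empty set, so their mass eventually falls below that of [B]. The first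
   coordinate exists because the dimension is positive. *)
pose C n := [set x : 'rV[R]_d.+1 | n%:R < `|x 0 0|].
have mC n : measurable (C n).
  have mn : measurable_fun setT (fun x : 'rV[R]_d.+1 => `|x 0 0|).
    by apply: (measurableT_comp (@normr_measurable R setT)); exact: measurable_coord.
  exact: measurable_superlevel.
have C0 : \bigcap_n C n = set0.
  apply/seteqP; split=> // x Cx; have := Cx (Num.truncn `|x 0 0|).+1 I.
  by rewrite /C/= ltNge => /negP; apply; rewrite ltW// truncnS_gt.
have cvgC : P (C n) @[n --> \oo] --> 0%E.
  rewrite -(measure0 P) -C0; apply: nonincreasing_cvg_mu.
  - by apply: (le_lt_trans (probability_le1 _ (mC 0%N))); rewrite ltry.
  - exact: mC.
  - by rewrite C0.
  - move=> m n mn; apply/subsetPset => x; rewrite /C/=; apply: le_lt_trans.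
    by rewrite ler_nat.
have [n Cn] : exists n, (P (C n) < P B)%E.
  have /fine_cvgP[Pf Pc] := cvgC.
  have PBf : P B \is a fin_num by rewrite fin_num_measure.
  have PB0' : 0 < fine (P B) by rewrite fine_gt0// PB0 ltey_eq PBf.
  have /cvgrPdist_lt/(_ _ PB0') [N _ HN] := Pc.
  exists N; have := HN N (leqnn N); rewrite /= sub0r normrN.
  rewrite ger0_norm ?fine_ge0 ?measure_ge0// => h.
  by rewrite -(fineK PBf) -(@fineK _ (P (C N))) ?lte_fin// fin_num_measure.
(* The ball has radius 1, so a shift by [n + 1] in either direction puts it inside [C n]; the two
   translates together then weigh less than [2 P B]. *)
pose h : 'rV[R]_d.+1 := const_mx (n.+1%:R).
have sub (s : bool) : (P (T (- ((-1) ^+ s *: h))%R @^-1` B) <= P (C n))%E.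
  apply: le_measure; rewrite ?inE//.
  move=> x; rewrite /B /T/= => /(ball_rVP _ _ ltr01) /(_ 0).
  rewrite /C/= !mxE sub0r normrN mul1r -natr1.
  by case: s; rewrite ?expr1 ?expr0 ?mulN1r ?mul1r ltr_norml => /andP[h1 h2];
    rewrite lter_normr; apply/orP; [right|left]; lra.
have := le2 h; have := sub false; have := sub true.
rewrite expr1 expr0 scaleN1r scale1r => s1 s2 s3.
have : (2%:E * P B <= P (C n) + P (C n))%E by exact: le_trans s3 (leeD s2 s1).
have PBf : P B \is a fin_num by rewrite fin_num_measure.
have PCf : P (C n) \is a fin_num by rewrite fin_num_measure.
move: Cn; rewrite -(fineK PBf) -(fineK PCf) -EFinM -EFinD lte_fin lee_fin.
lra.
Qed.

(** * Gibbs weights and the multiplicative form of one optimality equation *)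

Section entropic_half.
Context {R : realType} {d : nat} (mu : probability 'rV[R]_d R) (eps : R).
Hypothesis e0 : 0 < eps.
Implicit Types f g : 'rV[R]_d -> \bar R.
Local Notation c := (eps^-1).
Let c0 : 0 < c. Proof. by rewrite invr_gt0. Qed.

(* exp (- phi / eps), which is 0 where f = -oo *)
Definition gibbs f (x : 'rV[R]_d) : R := fine (expeR (c%:E * (f x - (sqnorm x / 2)%:E))).

Let kernel f y x := expeR (c%:E * (f x - (cost x y)%:E)).

Lemma costE (x y : 'rV[R]_d) : cost x y = sqnorm x / 2 - dot x y + sqnorm y / 2.
Proof.
by rewrite /cost !sqnormE !(dotBl, dotBr) (dotC y x); field.
Qed.

Lemma costC (x y : 'rV[R]_d) : cost x y = cost y x.
Proof. by rewrite !costE (dotC y x); ring. Qed.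

Lemma gibbs_ge0 f x : 0 <= gibbs f x.
Proof. by rewrite fine_ge0// expeR_ge0. Qed.

Let measurable_sqnorm : measurable_fun setT (fun x : 'rV[R]_d => sqnorm x / 2).
Proof.
apply: measurable_funM => //; apply: measurable_sum => i.
by apply: measurable_funX; exact: measurable_coord.
Qed.

Lemma measurable_gibbs f : measurable_fun setT f -> measurable_fun setT (gibbs f).
Proof.
move=> mf; apply: (measurableT_comp (fine_measurable measurableT)).
apply: (measurableT_comp (@measurable_expeR R)); apply: measurable_funeM.
by apply: emeasurable_funB => //; exact/measurable_EFinP.
Qed.

Lemma gibbs_eq0 f x : f x \is a fin_num -> gibbs f x != 0.
Proof. by rewrite /gibbs; case: (f x) => // r _; rewrite /= gt_eqF// expR_gt0. Qed.

Let measurable_kernel f y : measurable_fun setT f -> measurable_fun setT (kernel f y).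
Proof.
move=> mf; apply: (measurableT_comp (@measurable_expeR R)); apply: measurable_funeM.
apply: emeasurable_funB => //; apply/measurable_EFinP.
rewrite (_ : (fun x => _) = (fun x => sqnorm x / 2 - dot y x + sqnorm y / 2)).
  apply: measurable_funD => //; apply: measurable_funB => //; exact: measurable_dot.
by apply/funext => x; rewrite costE (dotC x).
Qed.

(** Expanding the cost, the term in [|x|^2] goes into [gibbs], the scalar product into the tilt, and
    the term in [|y|^2] factors out. The value [f x = +oo] has to be excluded: there the kernel is
    infinite while [fine] makes [gibbs] vanish. At [-oo] both sides are 0. *)
Let kernelE f y x : (f x < +oo)%E ->
  kernel f y x = ((expR (- (c * (sqnorm y / 2))))%:E * (tilt (gibbs f) c y x)%:E)%E.
Proof.
rewrite /kernel /tilt /gibbs; case: (f x) => [r _| |_] //=.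
  rewrite -EFinM; congr EFin; rewrite -!expRD; congr expR.
  by rewrite costE (dotC x); ring.
by rewrite mulrNy gtr0_sg//= mul1e mul0r mule0.
Qed.

(** An integrable [f] is finite almost everywhere, so the kernel is positive almost everywhere; a
    zero integral would make the whole space null for a probability measure. *)
Lemma integral_kernel_gt0 f y : mu.-integrable setT f -> (0 < \int[mu]_x kernel f y x)%E.
Proof.
move=> fi; have mk := measurable_kernel y (measurable_int mu fi).
have k0 x : (0 <= kernel f y x)%E by exact: expeR_ge0.
rewrite lt0e integral_ge0// andbT; apply/eqP => I0.
have /(ae_eq_integral_abs mu measurableT mk) ae0 :
    (\int[mu]_(x in setT) `|kernel f y x| = 0)%E.
  by rewrite -[RHS]I0; apply: eq_integral => x _; rewrite gee0_abs.
have aef := integrable_ae measurableT fi.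
have : {ae mu, forall x : 'rV[R]_d, False}.
  apply: filterS2 ae0 aef => x /(_ I) h /(_ I) fx.
  have : (0 < kernel f y x)%E.
    by apply: expeR_gt0; move: fx; rewrite /kernel; case: (f x) => // r _; rewrite -EFinB -EFinM ltNyr.
  by rewrite h/= ltxx.
move=> [N [mN N0 sN]]; have NT : N = setT.
  by apply/seteqP; split=> // x _; apply: sN => /=.
by have := @probability_setT _ _ _ mu; rewrite -NT N0 => /esym/eqP; rewrite onee_eq0.
Qed.

Lemma potential_lty f g y : mu.-integrable setT f ->
  g y = (- (eps%:E * lne (\int[mu]_x kernel f y x)))%E -> (g y < +oo)%E.
Proof.
move=> fi ->; have := integral_kernel_gt0 y fi.
case: (\int[mu]_x _)%E => [r| |]//; rewrite ?lte_fin => r0.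
  by rewrite lne_EFin// ltry.
by rewrite /= mulry gtr0_sg//= mul1e.
Qed.

Section system.
Variables (f g : 'rV[R]_d -> \bar R).
Hypotheses (fi : mu.-integrable setT f) (fy : forall x, (f x < +oo)%E).
Hypothesis gE : forall y, g y = (- (eps%:E * lne (\int[mu]_x kernel f y x)))%E.

Let kernel_laplace y : (\int[mu]_x kernel f y x)%E =
  ((expR (- (c * (sqnorm y / 2))))%:E * laplace mu (gibbs f) c y)%E.
Proof.
rewrite -ge0_integralZl_EFin//; first last.
- apply/measurable_EFinP; apply: measurable_tilt; apply: measurable_gibbs.
  exact: (measurable_int mu fi).
- by move=> x _; rewrite lee_fin mulr_ge0 ?gibbs_ge0 ?expR_ge0.
by apply: eq_integral => x _; rewrite kernelE.
Qed.

Lemma laplace_gibbs_gt0 y : (0 < laplace mu (gibbs f) c y)%E.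
Proof.
have := integral_kernel_gt0 y fi; rewrite kernel_laplace => H.
rewrite lt0e laplace_ge0 ?andbT; last by move=> x; exact: gibbs_ge0.
by apply: contraTneq H => ->; rewrite mule0 ltxx.
Qed.

Lemma potential_fin y : (laplace mu (gibbs f) c y < +oo)%E ->
  g y = (sqnorm y / 2 - eps * ln (fine (laplace mu (gibbs f) c y)))%:E.
Proof.
rewrite gE kernel_laplace; have := laplace_gibbs_gt0 y.
case: (laplace _ _ _ _) => [r| |]//; rewrite lte_fin => r0 _.
rewrite -EFinM lne_EFin ?mulr_gt0 ?expR_gt0// lnM ?posrE ?expR_gt0// expRK.
by rewrite -EFinM -EFinN; congr EFin => /=; field; rewrite gt_eqF.
Qed.

Lemma gibbs_inv y : gibbs g y = (fine (laplace mu (gibbs f) c y))^-1.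
Proof.
have [Lfin|] := ltP (laplace mu (gibbs f) c y) +oo%E.
  rewrite /gibbs (potential_fin Lfin) -EFinB -EFinM /=.
  have r0 : 0 < fine (laplace mu (gibbs f) c y) by rewrite fine_gt0// laplace_gibbs_gt0 Lfin.
  rewrite -[in RHS](lnK r0) -expRN; congr expR.
  by field; rewrite gt_eqF.
(* Here [g y = -oo], so both sides are 0. *)
rewrite leye_eq => /eqP Ly; rewrite Ly /= invr0.
rewrite /gibbs gE kernel_laplace Ly gt0_muley ?lte_fin ?expR_gt0//=.
by rewrite gt0_muley ?lte_fin//= gt0_muleNy ?lte_fin.
Qed.

Lemma gibbs_ae_neq0 : mu [set x | gibbs f x = 0] = 0%E.
Proof.
have [N [mN N0 sN]] := integrable_ae measurableT fi.
apply: (subset_measure0 _ mN _ N0).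
  have mg : measurable_fun setT (gibbs f).
    by apply: measurable_gibbs; exact: (measurable_int mu fi).
  by rewrite -[X in measurable X]setTI; exact: (mg measurableT [set 0]).
move=> x /= gx; apply: sN => /= h; have := gibbs_eq0 (h I).
by rewrite gx eqxx.
Qed.

End system.
End entropic_half.

Section ln_mul_sqr.
Context {R : realType} (eps r1 r2 r b s : R).
Hypotheses (e0 : 0 < eps) (r10 : 0 < r1) (r20 : 0 < r2) (r0 : 0 < r).

Let lnE : eps * ln (r1 * r2) - eps * ln (r ^+ 2 * expR (eps^-1 * b * s)) =
  eps * ln r1 + eps * ln r2 - 2 * (eps * ln r) - b * s.
Proof.
rewrite !lnM ?posrE ?mulr_gt0 ?expR_gt0// expRK.
by field; rewrite gt_eqF.
Qed.

Let e1_gt0 : 0 < r ^+ 2 * expR (eps^-1 * b * s).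
Proof. by rewrite mulr_gt0 ?exprn_gt0 ?expR_gt0. Qed.

Let r12_gt0 : 0 < r1 * r2. Proof. exact: mulr_gt0. Qed.

Lemma ln_mul_le_sqr : r1 * r2 <= r ^+ 2 * expR (eps^-1 * b * s) ->
  eps * ln r1 + eps * ln r2 - 2 * (eps * ln r) <= b * s.
Proof.
by rewrite -ler_ln ?posrE// -(ler_pM2l e0) -subr_le0 lnE subr_le0.
Qed.

Lemma ln_sqr_le_mul : r ^+ 2 * expR (eps^-1 * b * s) <= r1 * r2 ->
  b * s <= eps * ln r1 + eps * ln r2 - 2 * (eps * ln r).
Proof.
by rewrite -ler_ln ?posrE// -(ler_pM2l e0) -subr_ge0 lnE subr_ge0.
Qed.

End ln_mul_sqr.

Section brenier.
Context {R : realType} {d : nat} (mu : probability 'rV[R]_d R) (eps : R).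
Variables (k : 'rV[R]_d -> R) (g : 'rV[R]_d -> \bar R) (A : set 'rV[R]_d).
Hypotheses (e0 : 0 < eps) (mk : measurable_fun setT k) (k0 : forall x, 0 <= k x).
Local Notation c := (eps^-1).
Local Notation L := (laplace mu k c).
Local Notation u := (fun x => eps * ln (fine (L x))).
Hypotheses (oA : open A) (Afin : forall x, A x -> (L x < +oo)%E) (Lpos : forall x, (0 < L x)%E).
Hypothesis gL : forall x, A x -> g x = (sqnorm x / 2 - eps * ln (fine (L x)))%:E.

Lemma etwice_differentiable_brenier x : A x ->
  etwice_differentiable (brenier_potential g) x /\
  (forall B, (forall v, hessian_form u x v <= B * sqnorm v) ->
     loewner (ehessian (brenier_potential g) x) B%:M) /\
  (forall B, (forall v, B * sqnorm v <= hessian_form u x v) ->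
     loewner B%:M (ehessian (brenier_potential g) x)).
Proof.
move=> Ax; have nA : \forall y \near x, A y by exact: open_nbhs_nbhs.
have bE y : A y -> brenier_potential g y = (u y)%:E.
  by move=> Ay; rewrite /brenier_potential gL// -EFinB; congr EFin; ring.
have c0 : 0 < c by rewrite invr_gt0.
have Apos y : A y -> 0 < fine (L y) by move=> Ay; rewrite fine_gt0// Lpos Afin.
have [tu su] := twice_differentiable_log_laplace mk k0 c0 eps oA Afin Apos Ax.
have ub : \forall y \near x, u y = (fine \o brenier_potential g) y.
  by apply: filterS nA => y Ay /=; rewrite bE.
have [tb hb] := near_eq_twice_differentiable ub tu.
split; first by split; [apply: filterS nA => y Ay; rewrite bE|exact: tb].
by rewrite /ehessian hb; split=> B H; [exact: form_le_loewner|exact: form_ge_loewner].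
Qed.

Lemma form_log_laplace_le B x v : (forall y, A y) ->
  (forall h, fine (L (x + h)) * fine (L (x - h)) <= fine (L x) ^+ 2 * expR (c * B * sqnorm h)) ->
  hessian_form u x v <= B * sqnorm v.
Proof.
move=> AT H; have c0 : 0 < c by rewrite invr_gt0.
have Apos y : A y -> 0 < fine (L y) by move=> Ay; rewrite fine_gt0// Lpos Afin.
have [tu _] := twice_differentiable_log_laplace mk k0 c0 eps oA Afin Apos (AT x).
apply: (hessian_second_difference_le ltr01 tu) => t _.
rewrite -mulrA (mulrC (sqnorm v)) -sqnormZ.
exact: ln_mul_le_sqr e0 (Apos _ (AT _)) (Apos _ (AT _)) (Apos _ (AT _)) (H _).
Qed.

Lemma form_log_laplace_ge B x v : A x ->
  (forall h, A (x + h) -> A (x - h) ->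
    fine (L x) ^+ 2 * expR (c * B * sqnorm h) <= fine (L (x + h)) * fine (L (x - h))) ->
  B * sqnorm v <= hessian_form u x v.
Proof.
move=> Ax H; have c0 : 0 < c by rewrite invr_gt0.
have Apos y : A y -> 0 < fine (L y) by move=> Ay; rewrite fine_gt0// Lpos Afin.
have [tu _] := twice_differentiable_log_laplace mk k0 c0 eps oA Afin Apos Ax.
have /nbhs_ballP[r0 /= r00 rA] : nbhs x A by exact: open_nbhs_nbhs.
have e10 : 0 < r0 / (`|v| + 1) by rewrite divr_gt0// ltr_wpDl.
apply: (hessian_second_difference_ge e10 tu) => t.
rewrite ltr_pdivlMr ?ltr_wpDl// => tr.
have tv : `|t *: v| < r0.
  by rewrite normrZ; apply: le_lt_trans tr; rewrite ler_wpM2l// lerDl.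
have A1 : A (x + t *: v).
  by apply: rA; rewrite -ball_normE /ball_/= opprD addrA subrr add0r normrN.
have A2 : A (x - t *: v).
  by apply: rA; rewrite -ball_normE /ball_/= opprD addrA subrr add0r opprK.
rewrite -mulrA (mulrC (sqnorm v)) -sqnormZ.
exact: ln_sqr_le_mul e0 (Apos _ A1) (Apos _ A2) (Apos _ Ax) (H _ A1 A2).
Qed.

End brenier.

Lemma loewner0 {R : realType} (A B : 'M[R]_0) : loewner A B.
Proof.
split; first by apply/matrixP => -[].
by move=> v; rewrite mxE big_ord0.
Qed.

(** Both bounds of the theorem for one ordered pair: the upper one for the potential on the
    full-support side, the lower one for the other potential. In both equations the integration
    variable comes first in [cost], which makes the system symmetric and allows the exchange of [P]
    and [Q]. *)
Lemma entropic_hessian_bounds {R : realType} {d : nat} (P Q : probability 'rV[R]_d R)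
    (V W f g : 'rV[R]_d -> \bar R) (alpha beta eps : R) :
  has_potential P V -> has_potential Q W -> regular P Q V W -> 0 < alpha ->
  (forall x, loewner (ehessian V x) beta%:M) ->
  (forall y, (supp Q)° y -> loewner alpha%:M (ehessian W y)) ->
  0 < eps -> P.-integrable setT f -> Q.-integrable setT g ->
  (forall x, f x = - (eps%:E * lne (\int[Q]_y expeR (eps^-1%:E * (g y - (cost y x)%:E)))))%E ->
  (forall y, g y = - (eps%:E * lne (\int[P]_x expeR (eps^-1%:E * (f x - (cost x y)%:E)))))%E ->
  (forall x, etwice_differentiable (brenier_potential f) x /\
     loewner (ehessian (brenier_potential f) x)
       (2^-1 * (Num.sqrt (4 * beta / alpha + eps ^+ 2 * beta ^+ 2) - eps * beta))%:M) /\
  (forall y, (supp Q)° y -> etwice_differentiable (brenier_potential g) y /\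
     loewner (2^-1 * (Num.sqrt (4 * alpha / beta + eps ^+ 2 * alpha ^+ 2) - eps * alpha))%:M
       (ehessian (brenier_potential g) y)).
Proof.
move=> potP potQ regPQ a0 HV HW e0 fi gi fE gE.
have fy x : (f x < +oo)%E := potential_lty e0 gi (fE x).
have gy y : (g y < +oo)%E := potential_lty e0 fi (gE y).
have mF : measurable_fun setT (gibbs eps f) := measurable_gibbs eps (measurable_int P fi).
have mG : measurable_fun setT (gibbs eps g) := measurable_gibbs eps (measurable_int Q gi).
have F0 := gibbs_ge0 eps f; have G0 := gibbs_ge0 eps g.
have FE := gibbs_inv e0 gi gy fE; have GE := gibbs_inv e0 fi fy gE.
have Qpos := laplace_gibbs_gt0 e0 gi gy; have Ppos := laplace_gibbs_gt0 e0 fi fy.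
have F_ae := gibbs_ae_neq0 eps fi; have G_ae := gibbs_ae_neq0 eps gi.
have Pf := Phi_fin potP regPQ mF mG G0 FE Qpos F_ae.
have Qf := Psi_fin potQ regPQ mF mG F0 GE Ppos G_ae.
have fL x : setT x -> f x = (sqnorm x / 2 - eps * ln (fine (laplace Q (gibbs eps g) eps^-1 x)))%:E.
  by move=> _; exact: (potential_fin e0 gi gy fE (Pf x)).
have gL y : (supp Q)° y -> g y = (sqnorm y / 2 - eps * ln (fine (laplace P (gibbs eps f) eps^-1 y)))%:E.
  by move=> Oy; exact: (potential_fin e0 fi fy gE (Qf y Oy)).
have oO : open (supp Q)° by exact: open_interior.
have Pf' x : setT x -> (laplace Q (gibbs eps g) eps^-1 x < +oo)%E by move=> _; exact: Pf.
have D1 x := etwice_differentiable_brenier e0 mG G0 openT Pf' Qpos fL (I : setT x).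
have D2 y (Oy : (supp Q)° y) := etwice_differentiable_brenier e0 mF F0 oO Qf Ppos gL Oy.
(* In dimension 0 [beta] may be nonpositive, but any two matrices are comparable; in positive
   dimension [potential_not_concave] provides [0 < beta]. *)
case: d P Q V W f g potP potQ regPQ HV HW fi gi fE gE fy gy mF mG F0 G0 FE GE Qpos Ppos F_ae G_ae
  Pf Qf fL gL oO Pf' D1 D2 => [|d].
  move=> P Q V W f g potP potQ regPQ HV HW fi gi fE gE fy gy mF mG F0 G0 FE GE Qpos Ppos F_ae G_ae
    Pf Qf fL gL oO Pf' D1 D2.
  split=> [x|y Oy]; split; try exact: loewner0; [exact: (D1 x).1|exact: (D2 y Oy).1].
move=> P Q V W f g potP potQ regPQ HV HW fi gi fE gE fy gy mF mG F0 G0 FE GE Qpos Ppos F_ae G_ae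
  Pf Qf fL gL oO Pf' D1 D2.
have Vfin x : V x \is a fin_num.
  by have [[/nbhs_singleton]] := (regular_C2_l regPQ (I : setT x)).
have Vsmooth x h : fine (V (x + h)) + fine (V (x - h)) - 2 * fine (V x) <= beta * sqnorm h.
  apply: (@second_difference_hessian_le R d.+1 (fine \o V) setT) => //.
    by move=> y _; have [[_ ?] _] := (regular_C2_l regPQ (I : setT y)).
  by move=> y _; apply: loewner_form_le; exact: HV.
have b0 := potential_not_concave potP (regular_full_support regPQ) Vfin Vsmooth.
have Wconvex y h : (supp Q)° (y + h) -> (supp Q)° (y - h) ->
    alpha * sqnorm h <= fine (W (y + h)) + fine (W (y - h)) - 2 * fine (W y).
  move=> O1 O2; apply: (@second_difference_hessian_ge R d.+1 (fine \o W) (supp Q)°).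
  - move=> t /andP[t1 t2].
    have cO := interior_rV_convex (convex_set_rV_convex (regular_convex_support regPQ)).
    (* This is the weight of [y + h] when [y + t h] is written as a convex combination of [y + h]
       and [y - h]. *)
    have t01 : (0 <= (1 + t) / 2) && ((1 + t) / 2 <= 1) by apply/andP; split; lra.
    have E : ((1 + t) / 2) *: (y + h) + (1 - (1 + t) / 2) *: (y - h) = y + t *: h.
      by apply/rowP => i; rewrite !mxE; field.
    by rewrite -E; exact: cO t01 O1 O2.
  - by move=> z /(regular_C2_r regPQ)[[_ ?] _].
  - by move=> z Oz; apply: loewner_form_ge; exact: HW.
have smooth := Phi_smooth_sharp potP potQ regPQ e0 mF mG F0 G0 FE GE Qpos Ppos F_ae G_ae
  a0 b0 Vsmooth Wconvex.
have convex := Psi_convex_sharp potP potQ regPQ e0 mF mG F0 G0 FE GE Qpos Ppos F_ae G_ae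
  a0 b0 Vsmooth Wconvex.
split=> [x|y Oy].
  have [? [le _]] := D1 x; split=> //; apply: le => v.
  by apply: (form_log_laplace_le e0 mG G0 openT Pf' Qpos) => // h; exact: smooth.
have [? [_ ge]] := D2 y Oy; split=> //; apply: ge => v.
by apply: (form_log_laplace_ge e0 mF F0 oO Qf Ppos) => // h; exact: convex.
Qed.

Theorem theorem4 (R : realType) (d : nat) (P Q : probability 'rV[R]_d R)
    (V W : 'rV[R]_d -> \bar R) :
  has_potential P V -> has_potential Q W ->
  finite_second_moment P -> finite_second_moment Q ->
  (regular P Q V W ->
   forall betaV alphaW : R, 0 < alphaW ->
     (forall x, loewner (ehessian V x) betaV%:M) ->
     (forall y, (supp Q)° y -> loewner alphaW%:M (ehessian W y)) ->
   forall (eps : R) (f g : 'rV[R]_d -> \bar R), 0 < eps ->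
     entropic_potentials P Q eps f g ->
   forall x, etwice_differentiable (brenier_potential f) x /\
     loewner (ehessian (brenier_potential f) x)
       (2^-1 * (Num.sqrt (4 * betaV / alphaW + eps ^+ 2 * betaV ^+ 2)
                - eps * betaV))%:M) /\
  (regular Q P W V ->
   forall alphaV betaW : R, 0 < alphaV ->
     (forall x, (supp P)° x -> loewner alphaV%:M (ehessian V x)) ->
     (forall y, loewner (ehessian W y) betaW%:M) ->
   forall (eps : R) (f g : 'rV[R]_d -> \bar R), 0 < eps ->
     entropic_potentials P Q eps f g ->
   forall x, (supp P)° x -> etwice_differentiable (brenier_potential f) x /\
     loewner
       (2^-1 * (Num.sqrt (4 * alphaV / betaW + eps ^+ 2 * alphaV ^+ 2)
                - eps * alphaV))%:M
       (ehessian (brenier_potential f) x)).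
Proof.
have swap (f g : 'rV[R]_d -> \bar R) eps :
    (forall x, f x = - (eps%:E * lne (\int[Q]_y expeR (eps^-1%:E * (g y - (cost x y)%:E)))))%E ->
    forall x, f x = (- (eps%:E * lne (\int[Q]_y expeR (eps^-1%:E * (g y - (cost y x)%:E)))))%E.
  by move=> fE x; rewrite fE; under eq_integral do rewrite costC.
move=> potP potQ _ _; split=> [reg betaV alphaW a0 HV HW|reg alphaV betaW a0 HV HW]
  eps f g e0 [fi gi _ /swap fE gE _].
  by have [] := entropic_hessian_bounds potP potQ reg a0 HV HW e0 fi gi fE gE.
(* With the measures exchanged, [g] sits on the full-support side, and the bound on [f] is the
   second conclusion. *)
by have [] := entropic_hessian_bounds potQ potP reg a0 HW HV e0 gi fi gE fE.
Qed.
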